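(* Let $A$ be a finite dimensional $k$-algebra over a field $k$ with $\operatorname{s.gl.dim}A<\infty$. Let $X_0\to X_1\to\cdots\to X_r$ be a non-zero sectional path in $\mathbf{C}_{\equiv m}(\operatorname{proj}A)$ with $m>1$ (that is, a sectional path whose composition of irreducible morphisms is non-zero). Then one of the following statements holds. (a) None of the complexes $X_1,X_2,\dots,X_r$ is projective-injective. (b) None of the complexes $X_0,X_1,\dots,X_{r-1}$ is projective-injective. (c) $X_0$ and $X_r$ are projective-injective complexes and none of $X_1,\dots,X_{r-1}$ is projective-injective.
   Context: $\operatorname{proj}A$ is the category of finitely generated projective $A$-modules and $\mathbf{K}^b(\operatorname{proj}A)$ the bounded homotopy category. The strong global dimension is $\operatorname{s.gl.dim}A=\sup\{\ell(X): X\in\mathbf{K}^b(\operatorname{proj}A)\text{ indecomposable}\}$, where $\ell(X)$ is the least $b-a$ such that $X$ is isomorphic in $\mathbf{K}^b(\operatorname{proj}A)$ to a complex concentrated in degrees $[a,b]$. $\mathbf{C}_{\equiv m}(\operatorname{proj}A)$ is the category of $m$-periodic complexes: complexes $X=(X^i,d_X^i)_{i\in\mathbb{Z}}$ over $\operatorname{proj}A$ with $X^i=X^j$, $d_X^i=d_X^j$ whenever $i\equiv j\pmod m$; morphisms are chain maps $(f^i)$ with $f^i=f^j$ whenever $i\equiv j\pmod m$. It is a Frobenius category with conflations the sequences that are split exact in each degree; ''projective-injective'' refers to this exact structure. Almost split sequences are conflations $X\xrightarrow{f}Y\xrightarrow{g}Z$ with $f$ minimal left almost split and $g$ minimal right almost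 split, and then $\tau^{-1}_{\mathbf{C}_{\equiv m}}X=Z$. A morphism is irreducible if it is neither a section nor a retraction and, whenever $f=hg$, either $g$ is a section or $h$ is a retraction. A path $X_0\to X_1\to\cdots\to X_r$ of irreducible morphisms between indecomposable complexes is sectional if $\tau^{-1}_{\mathbf{C}_{\equiv m}}X_i\not\simeq X_{i+2}$ for every $i=0,\dots,r-2$ (the condition holds automatically when $X_i$ is not the starting term of an almost split sequence). *)

(* Defs.v *)
From HB Require Import structures.
From mathcomp Require Import all_boot all_order all_algebra all_field.

Set Implicit Arguments.
Unset Strict Implicit.
Unset Printing Implicit Defensive.

Import Order.TTheory GRing.Theory Num.Theory.
Local Open Scope ring_scope.

(* Preadditive categories whose hom-groups are setoids: [meq] is the equality
   of morphisms.  This lets K^b(proj A) be the category with the chain maps as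
   (representatives of) morphisms and homotopy as equality. *)
Record preadditive := Preadditive {
  ob :> Type;
  mor : ob -> ob -> Type;
  meq : forall X Y, mor X Y -> mor X Y -> Prop;
  idm : forall X, mor X X;
  mcomp : forall X Y Z, mor Y Z -> mor X Y -> mor X Z;
  zerom : forall X Y, mor X Y;
  oppm : forall X Y, mor X Y -> mor X Y;
  addm : forall X Y, mor X Y -> mor X Y -> mor X Y;
  meq_refl : forall X Y (f : mor X Y), meq f f;
  meq_sym : forall X Y (f g : mor X Y), meq f g -> meq g f;
  meq_trans : forall X Y (f g h : mor X Y), meq f g -> meq g h -> meq f h;
  mcomp_meq : forall X Y Z (g g' : mor Y Z) (f f' : mor X Y),
    meq g g' -> meq f f' -> meq (mcomp g f) (mcomp g' f');
  oppm_meq : forall X Y (f f' : mor X Y), meq f f' -> meq (oppm f) (oppm f');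
  addm_meq : forall X Y (f f' g g' : mor X Y),
    meq f f' -> meq g g' -> meq (addm f g) (addm f' g');
  mcompA : forall X Y Z W (h : mor Z W) (g : mor Y Z) (f : mor X Y),
    meq (mcomp h (mcomp g f)) (mcomp (mcomp h g) f);
  mcomp1m : forall X Y (f : mor X Y), meq (mcomp (idm Y) f) f;
  mcompm1 : forall X Y (f : mor X Y), meq (mcomp f (idm X)) f;
  addmA : forall X Y (f g h : mor X Y),
    meq (addm f (addm g h)) (addm (addm f g) h);
  addmC : forall X Y (f g : mor X Y), meq (addm f g) (addm g f);
  add0m : forall X Y (f : mor X Y), meq (addm (zerom X Y) f) f;
  addNm : forall X Y (f : mor X Y), meq (addm (oppm f) f) (zerom X Y);
  mcompDl : forall X Y Z (g g' : mor Y Z) (f : mor X Y),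
    meq (mcomp (addm g g') f) (addm (mcomp g f) (mcomp g' f));
  mcompDr : forall X Y Z (g : mor Y Z) (f f' : mor X Y),
    meq (mcomp g (addm f f')) (addm (mcomp g f) (mcomp g f'))
}.

Arguments idm {p} X.
Arguments zerom {p} X Y.

Notation "f =m g" := (meq f g) (at level 70, no associativity).
Notation "g \om f" := (mcomp g f) (at level 50, left associativity).

Section Preadditive.
Variable C : preadditive.
Implicit Types X Y Z W : C.

Definition section_mor X Y (f : mor X Y) : Prop :=
  exists g : mor Y X, g \om f =m idm X.

Definition retraction_mor X Y (f : mor X Y) : Prop :=
  exists g : mor Y X, f \om g =m idm Y.

Definition iso_mor X Y (f : mor X Y) : Prop :=
  exists g : mor Y X, g \om f =m idm X /\ f \om g =m idm Y.

Definition isomorphic X Y : Prop := exists f : mor X Y, iso_mor f.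

Definition zero_ob X : Prop := idm X =m zerom X X.

(* X is isomorphic to the direct sum of Y and Z. *)
Definition is_biproduct X Y Z : Prop :=
  exists (i1 : mor Y X) (i2 : mor Z X) (p1 : mor X Y) (p2 : mor X Z),
    [/\ p1 \om i1 =m idm Y, p2 \om i2 =m idm Z,
        p1 \om i2 =m zerom Z Y, p2 \om i1 =m zerom Y Z &
        addm (i1 \om p1) (i2 \om p2) =m idm X].

Definition indecomposable X : Prop :=
  ~ zero_ob X /\
  (forall Y Z, is_biproduct X Y Z -> zero_ob Y \/ zero_ob Z).

Definition irreducible_mor X Y (f : mor X Y) : Prop :=
  [/\ ~ section_mor f, ~ retraction_mor f &
      forall W (h : mor W Y) (g : mor X W),
        f =m h \om g -> section_mor g \/ retraction_mor h].

Definition left_minimal X Y (f : mor X Y) : Prop :=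
  forall u : mor Y Y, u \om f =m f -> iso_mor u.

Definition right_minimal X Y (f : mor X Y) : Prop :=
  forall u : mor X X, f \om u =m f -> iso_mor u.

Definition left_almost_split X Y (f : mor X Y) : Prop :=
  ~ section_mor f /\
  (forall W (h : mor X W), ~ section_mor h ->
     exists h' : mor Y W, h' \om f =m h).

Definition right_almost_split X Y (f : mor X Y) : Prop :=
  ~ retraction_mor f /\
  (forall W (h : mor W Y), ~ retraction_mor h ->
     exists h' : mor W X, f \om h' =m h).

Fixpoint path_comp (X : nat -> C) (f : forall i, mor (X i) (X i.+1)) (n : nat)
    : mor (X 0%N) (X n) :=
  match n return mor (X 0%N) (X n) with
  | 0 => idm (X 0%N)
  | n'.+1 => f n' \om path_comp f n'
  end.

End Preadditive.

(* Modules are left modules; right A-modules are left modules over A^c. *)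
Definition fin_gen (A : nzRingType) (M : lmodType A) : Prop :=
  exists s : seq M, forall x : M,
    exists c : nat -> A, x = \sum_(i < size s) c i *: s`_i.

Definition projective_module (A : nzRingType) (P : lmodType A) : Prop :=
  forall (M N : lmodType A) (g : {linear M -> N}) (f : {linear P -> N}),
    (forall y : N, exists x : M, g x = y) ->
    exists h : {linear P -> M}, forall x, g (h x) = f x.

Record projmod (A : nzRingType) := Projmod {
  projmod_sort :> lmodType A;
  projmod_fin_gen : fin_gen projmod_sort;
  projmod_projective : projective_module projmod_sort
}.

(* Complexes graded by the additive group of I.  With I = int these are the
   usual (cochain) complexes; with I = 'Z_m and m > 1 these are the m-periodic
   ones, a family (X^i) over the integers that only depends on i mod m being
   the same thing as a family over Z/m. *)
Record complex (I : nzRingType) (A : nzRingType) := Complex {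
  cx_ob :> I -> projmod A;
  cx_d : forall i, {linear cx_ob i -> cx_ob (i + 1)};
  cx_dd : forall i x, cx_d (i + 1) (cx_d i x) = 0
}.

Arguments cx_d {I A} X i : rename.

Record chain_map (I A : nzRingType) (X Y : complex I A) := ChainMap {
  cm_fun :> forall i, {linear X i -> Y i};
  cm_d : forall i x, cm_fun (i + 1) (cx_d X i x) = cx_d Y i (cm_fun i x)
}.

Section ChainMaps.
Variables I A : nzRingType.
Implicit Types X Y Z W : complex I A.

Definition cm_id X : chain_map X X :=
  @ChainMap I A X X (fun i => idfun : {linear X i -> X i}) (fun i x => erefl).

Lemma cm_comp_d X Y Z (g : chain_map Y Z) (f : chain_map X Y) i x :
  g (i + 1) (f (i + 1) (cx_d X i x)) = cx_d Z i (g i (f i x)).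
Proof. by rewrite !cm_d. Qed.

Definition cm_comp X Y Z (g : chain_map Y Z) (f : chain_map X Y) :
    chain_map X Z :=
  @ChainMap I A X Z (fun i => g i \o f i : {linear X i -> Z i})
    (cm_comp_d g f).

Lemma cm_zero_d X Y i (x : X i) : 0 = cx_d Y i 0.
Proof. by rewrite linear0. Qed.

Definition cm_zero X Y : chain_map X Y :=
  @ChainMap I A X Y (fun i => \0 : {linear X i -> Y i}) (@cm_zero_d X Y).

Lemma cm_opp_d X Y (f : chain_map X Y) i x :
  - f (i + 1) (cx_d X i x) = cx_d Y i (- f i x).
Proof. by rewrite cm_d linearN. Qed.

Definition cm_opp X Y (f : chain_map X Y) : chain_map X Y :=
  @ChainMap I A X Y (fun i => \- f i : {linear X i -> Y i}) (cm_opp_d f).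

Lemma cm_add_d X Y (f g : chain_map X Y) i x :
  f (i + 1) (cx_d X i x) + g (i + 1) (cx_d X i x) =
  cx_d Y i (f i x + g i x).
Proof. by rewrite !cm_d linearD. Qed.

Definition cm_add X Y (f g : chain_map X Y) : chain_map X Y :=
  @ChainMap I A X Y (fun i => f i \+ g i : {linear X i -> Y i}) (cm_add_d f g).

Definition cm_eq X Y (f g : chain_map X Y) : Prop := forall i x, f i x = g i x.

(* Every degree is of the form i + 1, so this is the usual
   f - g = d h + h d, with [h i] going from degree i + 1 to degree i. *)
Definition homotopic X Y (f g : chain_map X Y) : Prop :=
  exists h : forall i, {linear X (i + 1) -> Y i}, forall i (x : X (i + 1)),
    f (i + 1) x - g (i + 1) x =
    cx_d Y i (h i x) + h (i + 1) (cx_d X (i + 1) x).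

Definition Ccat : preadditive.
Proof.
refine (@Preadditive (complex I A) (@chain_map I A) cm_eq cm_id cm_comp
  cm_zero cm_opp cm_add _ _ _ _ _ _ _ _ _ _ _ _ _ _ _).
- by [].
- by move=> X Y f g fg i x; rewrite fg.
- by move=> X Y f g h fg gh i x; rewrite fg.
- by move=> X Y Z g g' f f' gg ff i x; rewrite /= ff gg.
- by move=> X Y f f' ff i x; rewrite /= ff.
- by move=> X Y f f' g g' ff gg i x; rewrite /= ff gg.
- by [].
- by [].
- by [].
- by move=> X Y f g h i x; rewrite /= addrA.
- by move=> X Y f g i x; rewrite /= addrC.
- by move=> X Y f i x; rewrite /= add0r.
- by move=> X Y f i x; rewrite /= addNr.
- by [].
- by move=> X Y Z g f f' i x; rewrite /= linearD.
Defined.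

Lemma cm_eq_homotopic X Y (f g : chain_map X Y) : cm_eq f g -> homotopic f g.
Proof.
move=> fg; exists (fun i => \0 : {linear X (i + 1) -> Y i}) => i x.
by rewrite fg subrr linear0 addr0.
Qed.

Lemma homotopic_sym X Y (f g : chain_map X Y) : homotopic f g -> homotopic g f.
Proof.
case=> h hP; exists (fun i => \- h i : {linear X (i + 1) -> Y i}) => i x /=.
by rewrite -opprB hP opprD linearN.
Qed.

Lemma homotopic_trans X Y (f g e : chain_map X Y) :
  homotopic f g -> homotopic g e -> homotopic f e.
Proof.
case=> h hP [k kP].
exists (fun i => h i \+ k i : {linear X (i + 1) -> Y i}) => i x /=.
by rewrite -(subrKA (g (i + 1) x)) hP kP linearD addrACA.
Qed.

Lemma homotopic_comp X Y Z (g g' : chain_map Y Z) (f f' : chain_map X Y) :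
  homotopic g g' -> homotopic f f' ->
  homotopic (cm_comp g f) (cm_comp g' f').
Proof.
case=> k kP [h hP].
exists (fun i => (g i \o h i) \+ (k i \o f' (i + 1))
  : {linear X (i + 1) -> Z i}) => i x /=.
rewrite -(subrKA (g (i + 1) (f' (i + 1) x))) -linearB hP kP.
by rewrite !linearD -!cm_d addrACA.
Qed.

Lemma homotopic_opp X Y (f f' : chain_map X Y) :
  homotopic f f' -> homotopic (cm_opp f) (cm_opp f').
Proof.
case=> h hP; exists (fun i => \- h i : {linear X (i + 1) -> Y i}) => i x /=.
by rewrite -opprD hP opprD linearN.
Qed.

Lemma homotopic_add X Y (f f' g g' : chain_map X Y) :
  homotopic f f' -> homotopic g g' -> homotopic (cm_add f g) (cm_add f' g').
Proof.
case=> h hP [k kP].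
exists (fun i => h i \+ k i : {linear X (i + 1) -> Y i}) => i x /=.
by rewrite opprD addrACA hP kP linearD addrACA.
Qed.

End ChainMaps.

Definition concentrated (A : nzRingType) (X : complex int A) (a b : int) :=
  forall i, ~~ (a <= i <= b) -> forall x : X i, x = 0.

Record bcomplex (A : nzRingType) := Bcomplex {
  bcx :> complex int A;
  bcx_bounded : exists a b, concentrated bcx a b
}.

Definition Kb (A : nzRingType) : preadditive.
Proof.
refine (@Preadditive (bcomplex A) (fun X Y => chain_map X Y)
  (fun X Y => @homotopic int A X Y) (fun X => cm_id X)
  (fun X Y Z g f => cm_comp g f) (fun X Y => cm_zero X Y)
  (fun X Y f => cm_opp f) (fun X Y f g => cm_add f g) _ _ _ _ _ _ _ _ _ _ _ _ _ _ _).
- by move=> X Y f; apply: cm_eq_homotopic.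
- by move=> X Y; apply: homotopic_sym.
- by move=> X Y; apply: homotopic_trans.
- by move=> X Y Z; apply: homotopic_comp.
- by move=> X Y; apply: homotopic_opp.
- by move=> X Y; apply: homotopic_add.
- by move=> X Y Z W h g f; apply: cm_eq_homotopic.
- by move=> X Y f; apply: cm_eq_homotopic.
- by move=> X Y f; apply: cm_eq_homotopic.
- by move=> X Y f g h; apply: cm_eq_homotopic (@addmA (Ccat int A) X Y f g h).
- by move=> X Y f g; apply: cm_eq_homotopic (@addmC (Ccat int A) X Y f g).
- by move=> X Y f; apply: cm_eq_homotopic (@add0m (Ccat int A) X Y f).
- by move=> X Y f; apply: cm_eq_homotopic (@addNm (Ccat int A) X Y f).
- by move=> X Y Z g g' f; apply: cm_eq_homotopic.
- move=> X Y Z g f f'.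
  exact: cm_eq_homotopic (@mcompDr (Ccat int A) X Y Z g f f').
Defined.

Definition has_width (A : nzRingType) (X : Kb A) (n : nat) : Prop :=
  exists (a : int) (Y : Kb A), concentrated Y a (a + n%:Z) /\ isomorphic X Y.

Definition is_length (A : nzRingType) (X : Kb A) (n : nat) : Prop :=
  has_width X n /\ (forall n', has_width X n' -> (n <= n')%N).

Definition length_bound (A : nzRingType) (n : nat) : Prop :=
  forall (X : Kb A) (l : nat), indecomposable X -> is_length X l -> (l <= n)%N.

(* s.gl.dim A = n, as a least upper bound; s.gl.dim A is finite iff such a
   natural number n exists. *)
Definition is_sgldim (A : nzRingType) (n : nat) : Prop :=
  length_bound A n /\ (forall n', length_bound A n' -> (n <= n')%N).

(* The category of m-periodic complexes, for m > 1 ('Z_m is Z/2 if m <= 1). *)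
Definition Cper (m : nat) (A : nzRingType) : preadditive := Ccat 'Z_m A.

Section Periodic.
Variables (m : nat) (A : nzRingType).
Implicit Types X Y Z P : Cper m A.

Definition split_exact (U V W : lmodType A)
    (f : {linear U -> V}) (g : {linear V -> W}) : Prop :=
  [/\ injective f,
      forall y, g y = 0 <-> exists x, f x = y &
      exists s : {linear W -> V}, forall z, g (s z) = z].

Definition conflation X Y Z (f : mor X Y) (g : mor Y Z) : Prop :=
  forall i, split_exact (cm_fun f i) (cm_fun g i).

Definition ex_projective P : Prop :=
  forall X Y Z (f : mor X Y) (g : mor Y Z), conflation f g ->
  forall h : mor P Z, exists h' : mor P Y, g \om h' =m h.

Definition ex_injective P : Prop :=
  forall X Y Z (f : mor X Y) (g : mor Y Z), conflation f g ->
  forall h : mor X P, exists h' : mor Y P, h' \om f =m h.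

Definition projective_injective P : Prop := ex_projective P /\ ex_injective P.

Definition almost_split_seq X Y Z (f : mor X Y) (g : mor Y Z) : Prop :=
  [/\ conflation f g, left_minimal f, left_almost_split f,
      right_minimal g & right_almost_split g].

Definition is_tau_inv X Z : Prop :=
  exists Y (f : mor X Y) (g : mor Y Z), almost_split_seq f g.

(* A path X_0 -> ... -> X_r is given by infinite families of objects and
   morphisms of which only X_0, ..., X_r and f_0, ..., f_(r-1) matter. *)
Definition sectional_path (r : nat) (X : nat -> Cper m A)
    (f : forall i, mor (X i) (X i.+1)) : Prop :=
  [/\ forall i, (i <= r)%N -> indecomposable (X i),
      forall i, (i < r)%N -> irreducible_mor (f i) &
      forall i, (i.+2 <= r)%N ->
        forall Z, is_tau_inv (X i) Z -> ~ isomorphic Z (X i.+2)].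

End Periodic.

(* Main.v *)
Require Import Defs.
From HB Require Import structures.
From mathcomp Require Import all_boot all_order all_algebra all_field.
From mathcomp Require Import boolp.

(** A path violating the trichotomy has a projective-injective term X_i with
    0 < i < r.  That is impossible for a sectional path, by the following fact
    ([tau_inv_across_projective]): if X -> J and J -> Y are irreducible
    morphisms between indecomposable periodic complexes and J is projective,
    then there is an almost split sequence X -> E -> Y.

    Let J be such a complex.  It is contractible ([projective_contraction])
    and indecomposable, so it is the complex P = P in two consecutive degrees
    j and j + 1, with P an indecomposable projective module
    ([contractible_jdata]).  Let S be the top of P.  A chain map from W to J is
    a linear map a from the term W^(j+1) to P, and it is not a retraction
    exactly when the composite of a with the differential of W is radical.  In
    that case a lifts along the minimal projective resolution of S, folded
    modulo m: the folded resolution maps to J by a minimal right almost split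
    map, and X, being an indecomposable summand of it, is the folded
    resolution itself ([irreducible_to_contractible]).  Dually, Y is the
    folded complex P -> Q_0 -> Q_1 -> ... that resolves the dual of S over the
    opposite algebra.

    Folding requires that these resolutions are finite.  The truncation of a
    minimal resolution at length n is an indecomposable object of K^b(proj A)
    of length n, unless its last term vanishes, so a bound on the strong
    global dimension bounds the resolutions ([res_htpy_local], [kb_bound]).

    The term P is shared by X and Y, and its identity gives a chain map theta
    from Y to the shift of X; the middle term E is the corresponding twisted
    sum.  A chain map h from W to Y lifts to E if and only if theta h is null
    homotopic, that is, if the map a from W^j to P underlying h is the sum of
    a radical map and of a map that factors through the differential of W.
    Otherwise a nondegenerate pairing, with values in the division ring
    End(P)/rad End(P), produces b from P to W^j that composes with a to the
    identity and with the differential of W to a radical map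
    ([jrad_factor_or_dual]).  Such a map b extends to a chain map from Y to W,
    whose composite with h is invertible because the endomorphisms of Y are
    detected, modulo homotopy and the radical, on the term P ([tot_local]).
    Hence h is a retraction ([serre_pairing]).  This is Serre duality for the
    simple module S, expressed through Hom(-, P)/rad and Hom(P, -)/rad only.

    Each argument has a dual.  For this reason the theory is developed for
    complexes over a linear category [kcat] whose axioms are self-dual, and
    the left-hand versions are the right-hand ones in the opposite
    category. *)

Set Implicit Arguments.
Unset Strict Implicit.
Unset Printing Implicit Defensive.

Import GRing.Theory.
Local Open Scope ring_scope.

(** * Equalities in abelian groups *)

(** Equalities between sums and opposites are decided by comparing the
    integer coefficients of the atoms; [zmod] reifies a goal of this kind and
    applies [zeval_eq]. *)
Inductive zexp := ZVar of nat | ZZero | ZAdd of zexp & zexp | ZOpp of zexp.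

Fixpoint zeval (V : zmodType) (s : seq V) (t : zexp) : V :=
  match t with
  | ZVar i => s`_i
  | ZZero => 0
  | ZAdd a b => zeval s a + zeval s b
  | ZOpp a => - zeval s a
  end.

Fixpoint zcoef (t : zexp) (i : nat) : int :=
  match t with
  | ZVar j => (i == j)%:R
  | ZZero => 0
  | ZAdd a b => zcoef a i + zcoef b i
  | ZOpp a => - zcoef a i
  end.

Lemma zevalE (V : zmodType) (s : seq V) t :
  zeval s t = \sum_(i < size s) s`_i *~ zcoef t i.
Proof.
elim: t => [j||a IHa b IHb|a IHa] /=.
- case: (ltnP j (size s)) => js; last first.
    rewrite nth_default // big1 // => i _.
    by case: eqP => [ij|_]; rewrite ?mulr0z //; move: js; rewrite -ij leqNgt ltn_ord.
  rewrite (bigD1 (Ordinal js)) //= eqxx big1 ?addr0 // => i.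
  by rewrite -val_eqE /= => /negPf->; rewrite mulr0z.
- by rewrite big1 // => i _; rewrite mulr0z.
- by rewrite IHa IHb -big_split; apply: eq_bigr => i _; rewrite /= mulrzDr.
- by rewrite IHa -sumrN; apply: eq_bigr => i _; rewrite mulrNz.
Qed.

Lemma zeval_eq (V : zmodType) (s : seq V) t u :
  all (fun i => zcoef t i == zcoef u i) (iota 0 (size s)) ->
  zeval s t = zeval s u.
Proof.
move=> /allP h; rewrite !zevalE; apply: eq_bigr => i _.
by rewrite (eqP (h i _)) // mem_iota /=.
Qed.

Ltac zindex x s :=
  lazymatch s with
  | x :: _ => constr:(0%N)
  | _ :: ?s' => let n := zindex x s' in constr:(n.+1)
  end.
Ltac zmem x s :=
  lazymatch s with
  | nil => constr:(false)
  | x :: _ => constr:(true)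
  | _ :: ?s' => zmem x s'
  end.
Ltac zatoms t s :=
  lazymatch t with
  | GRing.add ?a ?b => let s := zatoms a s in zatoms b s
  | GRing.opp ?a => zatoms a s
  | GRing.zero => s
  | _ => match zmem t s with true => s | false => constr:(t :: s) end
  end.
Ltac zreify t s :=
  lazymatch t with
  | GRing.add ?a ?b =>
    let a := zreify a s in let b := zreify b s in constr:(ZAdd a b)
  | GRing.opp ?a => let a := zreify a s in constr:(ZOpp a)
  | GRing.zero => constr:(ZZero)
  | _ => let n := zindex t s in constr:(ZVar n)
  end.
Ltac zmod :=
  lazymatch goal with
  | |- @eq ?T ?a ?b =>
    let s0 := constr:(@nil T) in
    let s := zatoms a s0 in let s := zatoms b s in
    let ta := zreify a s in let tb := zreify b s in
    exact: (@zeval_eq _ s ta tb isT)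
  end.

(** * Bounded linear independence *)

(** Finite dimension is a bound on the size of independent families rather
    than a basis, so that subspaces, given by arbitrary predicates, inherit
    it at once. *)
Definition dim_le (k : fieldType) (V : lmodType k) (U : V -> Prop) (N : nat) :=
  forall v : 'I_N.+1 -> V, (forall i, U (v i)) ->
  exists c : 'I_N.+1 -> k, (exists i, c i != 0) /\ \sum_i c i *: v i = 0.

Lemma dim_le_sub (k : fieldType) (V : lmodType k) (U U' : V -> Prop) N :
  (forall x, U' x -> U x) -> dim_le U N -> dim_le U' N.
Proof. by move=> sUU h v Uv; apply: h => i; apply/sUU/Uv. Qed.

(** An independent family of maximal length spans. *)
Lemma dim_le_span (k : fieldType) (V : lmodType k) (U : V -> Prop) N :
  dim_le U N ->
  exists n (w : 'I_n -> V), (forall i, U (w i)) /\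
    forall x, U x -> exists c : 'I_n -> k, x = \sum_i c i *: w i.
Proof.
elim: N => [|N IHN] hU.
  exists 0%N, (fun=> 0); split=> [[]//|x Ux].
  have [c [[i ci0] cE]] := hU (fun=> x) (fun=> Ux).
  exists (fun=> 0); rewrite big_ord0.
  move: cE; rewrite big_ord_recl big_ord0 addr0 => /eqP; rewrite scaler_eq0.
  by move: ci0; rewrite (ord1 i) => /negPf-> /eqP.
have [/IHN //|] := EM (dim_le U N).
rewrite /dim_le -existsNE => -[v]; rewrite not_implyE => -[Uv vfree].
exists N.+1, v; split=> // x Ux.
have [|c [[i ci0] cE]] := hU (fun i => oapp v x (unlift ord0 i)).
  by move=> i; case: unliftP => [j|] _ /=.
have c0 : c ord0 != 0.
  apply/negP => /eqP c0; apply: vfree.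
  exists (fun i => c (lift ord0 i)); split.
    case: (unliftP ord0 i) ci0 => [j ->|->]; first by exists j.
    by rewrite c0 eqxx.
  move: cE; rewrite big_ord_recl c0 scale0r add0r => cE; rewrite -[RHS]cE.
  by apply: eq_bigr => j _; rewrite liftK.
exists (fun i => - (c ord0)^-1 * c (lift ord0 i)).
move: cE; rewrite big_ord_recl unlift_none /= => /(canRL (addrK _)).
rewrite add0r => /(congr1 (GRing.scale (c ord0)^-1)).
rewrite scalerA mulVf // scale1r => ->.
rewrite scalerN -scaleNr scaler_sumr; apply: eq_bigr => j _.
by rewrite liftK /= scalerA.
Qed.

(** * Linear categories *)

(** All the axioms are self-dual. The last one says that every object is a
    retract of a finite power of the object [kgenob]: for modules this is the
    regular module. *)
Record kcat (k : fieldType) := KCat {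
  kob :> Type;
  khom : kob -> kob -> lmodType k;
  kid : forall X, khom X X;
  kcomp : forall X Y Z, khom Y Z -> khom X Y -> khom X Z;
  kcompA : forall X Y Z W (h : khom Z W) (g : khom Y Z) (f : khom X Y),
    kcomp h (kcomp g f) = kcomp (kcomp h g) f;
  kcomp1l : forall X Y (f : khom X Y), kcomp (kid Y) f = f;
  kcomp1r : forall X Y (f : khom X Y), kcomp f (kid X) = f;
  kcompDl : forall X Y Z (g g' : khom Y Z) (f : khom X Y),
    kcomp (g + g') f = kcomp g f + kcomp g' f;
  kcompDr : forall X Y Z (g : khom Y Z) (f f' : khom X Y),
    kcomp g (f + f') = kcomp g f + kcomp g f';
  kcompZl : forall X Y Z c (g : khom Y Z) (f : khom X Y),
    kcomp (c *: g) f = c *: kcomp g f;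
  kcompZr : forall X Y Z c (g : khom Y Z) (f : khom X Y),
    kcomp g (c *: f) = c *: kcomp g f;
  kfd : forall X Y, exists N, dim_le (fun _ : khom X Y => True) N;
  kbip : forall X Y, exists Z (i1 : khom X Z) (i2 : khom Y Z)
    (p1 : khom Z X) (p2 : khom Z Y),
    [/\ kcomp p1 i1 = kid X, kcomp p2 i2 = kid Y, kcomp p1 i2 = 0,
        kcomp p2 i1 = 0 & kcomp i1 p1 + kcomp i2 p2 = kid Z];
  ksplit : forall X (e : khom X X), kcomp e e = e ->
    exists Y (s : khom Y X) (t : khom X Y),
      kcomp t s = kid Y /\ kcomp s t = e;
  kgenob : kob;
  kgen : forall X, exists n (s : 'I_n -> khom X kgenob)
    (t : 'I_n -> khom kgenob X), \sum_i kcomp (t i) (s i) = kid X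
}.

Notation "g \oc f" := (kcomp g f) (at level 40, left associativity).
Arguments kid {k C} X : rename.
Notation "\1" := (kid _).

Section Kcat.
Variables (k : fieldType) (C : kcat k).
Implicit Types X Y Z W M N P : C.

Lemma kcomp0l X Y Z (f : khom X Y) : (0 : khom Y Z) \oc f = 0.
Proof. by have := kcompZl 0 (0 : khom Y Z) f; rewrite !scale0r. Qed.

Lemma kcomp0r X Y Z (g : khom Y Z) : g \oc (0 : khom X Y) = 0.
Proof. by have := kcompZr 0 g (0 : khom X Y); rewrite !scale0r. Qed.

Lemma kcompNl X Y Z (g : khom Y Z) (f : khom X Y) : (- g) \oc f = - (g \oc f).
Proof. by rewrite -scaleN1r kcompZl scaleN1r. Qed.

Lemma kcompNr X Y Z (g : khom Y Z) (f : khom X Y) : g \oc (- f) = - (g \oc f).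
Proof. by rewrite -scaleN1r kcompZr scaleN1r. Qed.

Lemma kcompBl X Y Z (g g' : khom Y Z) (f : khom X Y) :
  (g - g') \oc f = g \oc f - g' \oc f.
Proof. by rewrite kcompDl kcompNl. Qed.

Lemma kcompBr X Y Z (g : khom Y Z) (f f' : khom X Y) :
  g \oc (f - f') = g \oc f - g \oc f'.
Proof. by rewrite kcompDr kcompNr. Qed.

Lemma kcomp_suml X Y Z I (r : seq I) (p : pred I) (g : I -> khom Y Z)
    (f : khom X Y) :
  (\sum_(i <- r | p i) g i) \oc f = \sum_(i <- r | p i) (g i \oc f).
Proof.
exact: (big_morph (fun g => g \oc f) (fun x y => kcompDl x y f) (kcomp0l _ f)).
Qed.

Lemma kcomp_sumr X Y Z I (r : seq I) (p : pred I) (g : khom Y Z)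
    (f : I -> khom X Y) :
  g \oc (\sum_(i <- r | p i) f i) = \sum_(i <- r | p i) (g \oc f i).
Proof. exact: (big_morph (kcomp g) (kcompDr g) (kcomp0r _ _)). Qed.

Definition kcompE :=
  (kcompA, kcompDl, kcompDr, kcompNl, kcompNr, kcomp0l, kcomp0r, kcomp1l,
   kcomp1r).

(** This form of x y = z rewrites inside a composite that is associated to
    the left. *)
Lemma kcr X Y Z (x : khom Y Z) (y : khom X Y) z : x \oc y = z ->
  forall W (a : khom Z W), a \oc x \oc y = a \oc z.
Proof. by move=> <- W a; rewrite kcompA. Qed.

Lemma kcr3 X Y Z V (x : khom Y Z) (y : khom X Y) (w : khom V X) z :
  x \oc y \oc w = z ->
  forall W (a : khom Z W), a \oc x \oc y \oc w = a \oc z.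
Proof. by move=> <- W a; rewrite !kcompA. Qed.

(** ** Isomorphisms and the radical *)

Definition kiso X Y (f : khom X Y) :=
  exists g : khom Y X, g \oc f = \1 /\ f \oc g = \1.
Definition ksec X Y (f : khom X Y) := exists g : khom Y X, g \oc f = \1.
Definition kret X Y (f : khom X Y) := exists g : khom Y X, f \oc g = \1.

Lemma kiso1 X : kiso (kid X).
Proof. by exists \1; rewrite kcomp1l. Qed.

Lemma kiso_comp X Y Z (g : khom Y Z) (f : khom X Y) :
  kiso g -> kiso f -> kiso (g \oc f).
Proof.
move=> [g' [g'g gg']] [f' [f'f ff']]; exists (f' \oc g').
by rewrite !kcompA (kcr g'g) (kcr ff') !kcomp1r.
Qed.

Lemma kiso_secret X Y (f : khom X Y) : ksec f -> kret f -> kiso f.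
Proof.
move=> [g gf] [h fh]; exists g; split=> //.
suff -> : g = h by [].
by rewrite -[g]kcomp1r -fh kcompA gf kcomp1l.
Qed.

Lemma kiso_retl X Y Z (g : khom Y Z) (f : khom X Y) :
  kiso (g \oc f) -> kret g.
Proof. by move=> [h [_ E]]; exists (f \oc h); rewrite kcompA. Qed.

Lemma kiso_secr X Y Z (g : khom Y Z) (f : khom X Y) :
  kiso (g \oc f) -> ksec f.
Proof. by move=> [h [E _]]; exists (h \oc g); rewrite -kcompA. Qed.

(** If h inverts 1 - a b, then 1 + b h a inverts 1 - b a. *)
Lemma kiso_swap X Y (a : khom Y X) (b : khom X Y) :
  kiso (\1 - a \oc b) -> kiso (\1 - b \oc a).
Proof.
move=> [h [h1 h2]]; exists (\1 + b \oc h \oc a).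
have e1 : h \oc a \oc b = h - \1.
  by move: h1; rewrite !kcompE => <-; rewrite opprB addrC subrK.
have e2 : a \oc b \oc h = h - \1.
  by move: h2; rewrite !kcompE => <-; rewrite opprB addrC subrK.
split; rewrite !kcompE.
  by rewrite (kcr3 e1) !kcompE; zmod.
by rewrite (kcr3 e2) !kcompE; zmod.
Qed.

(** The Jacobson radical of the category. The symmetric condition on g f is
    equivalent, by [kiso_swap]. *)
Definition jrad X Y (f : khom X Y) := forall g : khom Y X, kiso (\1 - f \oc g).

Lemma jrad_swap X Y (f : khom X Y) (g : khom Y X) :
  jrad f -> kiso (\1 - g \oc f).
Proof. by move=> /(_ g) /kiso_swap. Qed.

Lemma jradP X Y (f : khom X Y) :
  (forall g : khom Y X, kiso (\1 - g \oc f)) -> jrad f.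
Proof. by move=> h g; apply: kiso_swap. Qed.

Lemma jrad_compr X Y Z (g : khom Y Z) (f : khom X Y) :
  jrad g -> jrad (g \oc f).
Proof. by move=> h a; rewrite -kcompA; apply: h. Qed.

Lemma jrad_compl X Y Z (g : khom Y Z) (f : khom X Y) :
  jrad f -> jrad (g \oc f).
Proof. by move=> h; apply: jradP => a; rewrite kcompA; apply: jrad_swap. Qed.

Lemma jradN X Y (f : khom X Y) : jrad f -> jrad (- f).
Proof. by move=> h g; rewrite kcompNl -kcompNr; apply: h. Qed.

Lemma kiso_jradB X Y (u : khom X Y) (f : khom X Y) :
  kiso u -> jrad f -> kiso (u - f).
Proof.
move=> [u' [u'u uu']] jf.
have -> : u - f = (\1 - f \oc u') \oc u.
  by rewrite !kcompE (kcr u'u) kcomp1r.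
by apply: kiso_comp (jf _) _; exists u'.
Qed.

Lemma jradD X Y (f g : khom X Y) : jrad f -> jrad g -> jrad (f + g).
Proof.
move=> jf jg a; rewrite kcompDl opprD addrA.
by apply: kiso_jradB (jf a) _; apply: jrad_compr.
Qed.

Lemma jrad0 X Y : jrad (0 : khom X Y).
Proof. by move=> g; rewrite kcomp0l subr0; apply: kiso1. Qed.

Lemma jrad_sum X Y I (r : seq I) (p : pred I) (f : I -> khom X Y) :
  (forall i, p i -> jrad (f i)) -> jrad (\sum_(i <- r | p i) f i).
Proof.
by move=> h; elim/big_ind: _ => //; [exact: jrad0|exact: jradD].
Qed.

Lemma jrad_idem X (e : khom X X) : e \oc e = e -> jrad e -> e = 0.
Proof.
move=> ee /(_ \1); rewrite kcomp1r => -[h [_ E]].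
by have := kcomp1r e; rewrite -E !kcompE ee subrr.
Qed.

(** ** Powers of an endomorphism *)

(** A name for endomorphism groups on which the ring structure, with its
    powers, is declared. *)
Definition kend X : Type := khom X X.
HB.instance Definition _ X := GRing.Lmodule.on (kend X).
HB.instance Definition _ X := GRing.Zmodule_isPzRing.Build (kend X)
  (fun x y z : kend X => kcompA (x : khom X X) y z) (fun x => kcomp1l x)
  (fun x => kcomp1r x) (fun x y z => kcompDl x y z) (fun x y z => kcompDr x y z).

Lemma kendM X (x y : kend X) : x * y = kcomp (x : khom X X) y. Proof. by []. Qed.

Lemma kend_scaleAl X c (x y : kend X) : (c *: x) * y = c *: (x * y).
Proof. by rewrite !kendM kcompZl. Qed.

Lemma kend_scaleAr X c (x y : kend X) : x * (c *: y) = c *: (x * y).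
Proof. by rewrite !kendM kcompZr. Qed.

(** A linear relation between the powers of u, divided by its lowest nonzero
    coefficient. *)
Lemma fitting X (u : kend X) : exists a (w : kend X),
  [/\ u * w = w * u & u ^+ a = u ^+ a.+1 * w].
Proof.
have [N hN] := kfd X X.
have [|c [exc cE]] := hN (fun i => u ^+ i) => //.
have exc' : exists n, (n <= N)%N && (c (inord n) != 0).
  by case: exc => i ci; exists i; rewrite -ltnS ltn_ord inord_val.
case: (ex_minnP exc') => a /andP[aN ca] amin.
pose w : kend X :=
  \sum_(i < N.+1 | (a < i)%N) (- (c (inord a))^-1 * c i) *: u ^+ (i - a.+1).
exists a, w; split.
  rewrite mulr_suml mulr_sumr; apply: eq_bigr => i _.
  by rewrite kend_scaleAl kend_scaleAr -exprS -exprSr.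
rewrite mulr_sumr.
have -> : \sum_(i < N.+1 | (a < i)%N) u ^+ a.+1 *
     ((- (c (inord a))^-1 * c i) *: u ^+ (i - a.+1)) =
    - (c (inord a))^-1 *: \sum_(i < N.+1 | (a < i)%N) (c i *: u ^+ i).
  rewrite scaler_sumr; apply: eq_bigr => i ai.
  by rewrite kend_scaleAr -exprD subnKC // scalerA.
move: cE; rewrite (bigID (fun i : 'I__ => (a < i)%N)) /= addrC.
have aK : (inord a : 'I_N.+1) = a :> nat by rewrite inordK.
rewrite (bigD1 (inord a)) /= ?aK ?ltnn // big1 ?addr0.
  move=> /eqP; rewrite addr_eq0 => /eqP /(congr1 (GRing.scale (c (inord a))^-1)).
  by rewrite scalerA mulVf // scale1r scalerN scaleNr.
move=> i /andP[]; rewrite -leqNgt => ia ina.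
have ia' : (i < a)%N.
  by rewrite ltn_neqAle ia andbT; apply: contraNneq ina => <-; rewrite inord_val.
case: (c i =P 0) => [-> |/eqP ci]; first by rewrite scale0r.
have := amin i; rewrite -ltnS ltn_ord inord_val ci /= leqNgt ia' => /(_ isT) //.
Qed.

End Kcat.

(** ** Local objects *)

Section Local.
Variables (k : fieldType) (C : kcat k).
Implicit Types X Y Z W M N P V : C.

Lemma nilpotent_kiso X (u : kend X) n : u ^+ n = 0 -> kiso (kid X - u).
Proof.
move=> un; have E := subrXX_comm n (commr1 u); rewrite un expr1n in E.
pose s : kend X := \sum_(i < n) u ^+ (n.-1 - i) * 1 ^+ i.
have {}E : (1 - u) * s = 1.
  by rewrite -opprB mulNr -E sub0r opprK.
exists s; split; last exact: E.
suff: s * (1 - u) = 1 by [].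
rewrite -[RHS]E; apply: commrB; first exact: commr1.
rewrite /s; apply/commr_sym/commr_sum => i _.
by rewrite expr1n mulr1; apply: commrX.
Qed.

(** The projection e onto the stable image of u, along the part where u is
    nilpotent. A map fixed by precomposition with u vanishes on the latter
    part. *)
Lemma fitting_idem X (u : kend X) : exists e : khom X X,
  [/\ e \oc e = e, e = \1 -> kiso (u : khom X X),
      e = 0 -> exists n, u ^+ n = 0 &
      forall N (f : khom X N), f \oc u = f -> f \oc e = f].
Proof.
have [a [w [uw ua]]] := fitting u.
have cuw n m : u ^+ n * w ^+ m = w ^+ m * u ^+ n.
  by apply: commrX; apply/commr_sym/commrX/commr_sym.
have ua1 : u ^+ a.+1 = u ^+ a.+2 * w.
  by rewrite [LHS]exprS ua mulrA -exprS.
have cw n : w * u ^+ n = u ^+ n * w by rewrite -[w]expr1 cuw.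
have uan n : u ^+ a.+1 = u ^+ (a.+1 + n) * w ^+ n.
  elim: n => [|n IHn]; first by rewrite addn0 mulr1.
  have -> : u ^+ (a.+1 + n.+1) = u ^+ a.+2 * u ^+ n.
    by rewrite -exprD addnS !addSn.
  rewrite [LHS]IHn exprD ua1 (exprS w n); move: (u ^+ a.+2) => z.
  by rewrite -(mulrA z w) cw !mulrA.
pose e : kend X := u ^+ a.+1 * w ^+ a.+1.
have ue : u ^+ a.+1 * e = u ^+ a.+1 by rewrite /e mulrA -exprD -uan.
have eu : e * u ^+ a.+1 = u ^+ a.+1.
  rewrite -[RHS]ue /e; have := cuw a.+1 a.+1.
  by move: (u ^+ _) (w ^+ _) => U W UW; rewrite UW mulrA UW.
have uw1 : u ^+ a.+1 * w ^+ a.+1 = u * (u ^+ a * w ^+ a.+1).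
  by rewrite mulrA -(exprS u a).
exists e; split.
- by change (e * e = e); rewrite {2}/e mulrA eu.
- move=> e1; exists (u ^+ a * w ^+ a.+1); split.
    suff: u ^+ a * w ^+ a.+1 * u = 1 by [].
    rewrite -[RHS]e1 /e (exprSr u a); have := cuw 1%N a.+1; rewrite expr1.
    by move: (w ^+ _) (u ^+ _) => W U uW; rewrite -!mulrA uW.
  by suff: u * (u ^+ a * w ^+ a.+1) = 1 by []; rewrite -uw1.
- by move=> e0; exists a.+1; rewrite -ue [e]e0 mulr0.
- move=> N f fu.
  have fun_ n : f \oc (u ^+ n : kend X) = f.
    elim: n => [|n IHn]; first exact: kcomp1r.
    by rewrite exprS kendM kcompA fu.
  have fw : f \oc (w : khom X X) = f.
    by rewrite -[in LHS](fun_ a.+1) -kcompA -kendM -ua fun_.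
  have fwn n : f \oc (w ^+ n : kend X) = f.
    elim: n => [|n IHn]; first exact: kcomp1r.
    by rewrite exprS kendM kcompA fw.
  by rewrite /e kendM kcompA fun_ fwn.
Qed.

(** By [klocal_dich] this is locality of the endomorphism ring. *)
Definition klocal P :=
  kid P <> 0 /\ forall e : khom P P, e \oc e = e -> e = 0 \/ e = \1.

Lemma klocal_dich P (x : khom P P) : klocal P -> kiso x \/ kiso (\1 - x).
Proof.
move=> [_ idem]; have [e [ee e1 e0 _]] := fitting_idem (x : kend P).
have [/e0 [n xn]|/e1] := idem e ee; last by left.
by right; apply: (nilpotent_kiso xn).
Qed.

Lemma klocal_swap P (x y : khom P P) :
  klocal P -> x \oc y = \1 -> y \oc x = \1.
Proof.
move=> [P0 idem] xy; have [||//] := idem (y \oc x).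
  by rewrite !kcompA (kcr xy) kcomp1r.
move=> yx; case: P0.
have : x \oc (y \oc x) \oc y = \1 by rewrite !kcompA xy kcomp1l xy.
by rewrite yx kcomp0r kcomp0l.
Qed.

(** If x g is not invertible, then 1 - x g is, by locality. The next lemma is
    the dual statement. *)
Lemma nonret_jrad W P (x : khom W P) : klocal P -> ~ kret x -> jrad x.
Proof.
move=> locP nx g; have [/kiso_retl //|//] := klocal_dich (x \oc g) locP.
Qed.

Lemma nonsec_jrad W P (x : khom P W) : klocal P -> ~ ksec x -> jrad x.
Proof.
move=> locP nx; apply: jradP => g.
by have [/kiso_secr //|//] := klocal_dich (g \oc x) locP.
Qed.

Lemma jrad_nonret W P (x : khom W P) (v : khom P W) :
  kid P <> 0 -> jrad x -> x \oc v <> \1.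
Proof.
move=> P0 /(_ v) [h [_ E]] xv; apply: P0.
by rewrite -E xv subrr kcomp0l.
Qed.

Lemma jrad_or_kiso P (x : khom P P) : klocal P -> jrad x \/ kiso x.
Proof.
move=> locP; have [|] := EM (kret x); last by move/(nonret_jrad locP); left.
by case=> y xy; right; exists y; rewrite (klocal_swap locP xy).
Qed.

(** ** Finite biproducts *)

Lemma kzero : exists Z : C, kid Z = 0.
Proof.
have [|Z [s [t [ts st]]]] := @ksplit k C (kgenob C) 0.
  by rewrite kcomp0l.
exists Z; have : t \oc (s \oc t) \oc s = \1 by rewrite !kcompA ts kcomp1l ts.
by rewrite st kcomp0r kcomp0l.
Qed.

(** The identity along an equality of indices, which lets a biproduct be
    described without casts. *)
Definition kdelta (I : eqType) (X : I -> C) i j : khom (X i) (X j) :=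
  match i =P j with
  | ReflectT e => match e in _ = j' return khom (X i) (X j') with
                  | erefl => \1 end
  | ReflectF _ => 0
  end.

Lemma kdelta1 (I : eqType) (X : I -> C) i : kdelta X i i = \1.
Proof. by rewrite /kdelta; case: eqP => // e; rewrite (eq_axiomK e). Qed.

Lemma kdelta0 (I : eqType) (X : I -> C) i j : i != j -> kdelta X i j = 0.
Proof. by rewrite /kdelta; case: eqP. Qed.

Lemma kbigsum (I : eqType) (X : I -> C) (r : seq I) : uniq r ->
  exists T (inj : forall l, khom (X l) T) (prj : forall l, khom T (X l)),
  [/\ forall l, l \in r -> prj l \oc inj l = \1,
      forall l l', l != l' -> prj l \oc inj l' = 0,
      \sum_(l <- r) inj l \oc prj l = \1 &
      forall l, l \notin r -> inj l = 0 /\ prj l = 0].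
Proof.
elim: r => [|a r IHr] /= => [_|/andP[ar /IHr [T [inj [prj [h1 h2 h3 h4]]]]]].
  have [Z Z0] := kzero; exists Z, (fun=> 0), (fun=> 0); split=> //.
      by move=> *; rewrite kcomp0l.
  by rewrite big_nil Z0.
have [Z [i1 [i2 [p1 [p2 [p1i1 p2i2 p1i2 p2i1 E]]]]]] := kbip (X a) T.
exists Z, (fun l => i1 \oc kdelta X l a + i2 \oc inj l).
exists (fun l => kdelta X a l \oc p1 + prj l \oc p2).
have E' l l' : (kdelta X a l \oc p1 + prj l \oc p2) \oc
    (i1 \oc kdelta X l' a + i2 \oc inj l') =
    kdelta X a l \oc kdelta X l' a + prj l \oc inj l'.
  rewrite !kcompE (kcr p1i1) (kcr p2i2) (kcr p1i2) (kcr p2i1) !kcompE.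
  by rewrite addr0 add0r.
split.
- move=> l; rewrite inE E'; case: (eqVneq l a) => [->|la /= lr].
    by rewrite kdelta1 kcomp1l (h4 _ ar).1 kcomp0r addr0.
  by rewrite kdelta0 1?eq_sym // kcomp0l add0r h1.
- move=> l l' ll'; rewrite E' h2 // addr0.
  case: (eqVneq a l) ll' => [<- al'|al _]; last by rewrite (kdelta0 _ al) kcomp0l.
  by rewrite (@kdelta0 _ _ l') 1?eq_sym // kcomp0r.
- rewrite big_cons kdelta1 (h4 _ ar).1 (h4 _ ar).2 !kcompE !addr0.
  rewrite -E -[in RHS](kcomp1l p2) -h3 kcomp_suml kcomp_sumr; congr (_ + _).
  rewrite !big_seq; apply: eq_bigr => l lr.
  have la : l != a by apply: contraNneq ar => <-.
  by rewrite !kdelta0 // 1?eq_sym // !kcompE !add0r.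
- move=> l; rewrite inE negb_or => /andP[la lr].
  rewrite (h4 _ lr).1 (h4 _ lr).2 kdelta0 // (@kdelta0 _ _ a) 1?eq_sym //.
  by rewrite !kcompE !addr0.
Qed.

(** ** Minimal approximations *)

(** A subfunctor of Hom(-, N) made of linear subspaces, such as the maps
    killed by a given map or the radical maps. *)
Definition sieve N (F : forall W, khom W N -> Prop) :=
  [/\ forall W, F W 0, forall W c (x y : khom W N), F W x -> F W y ->
      F W (c *: x + y) &
      forall W V (x : khom W N) (y : khom V W), F W x -> F V (x \oc y)].

Definition covers N (F : forall W, khom W N -> Prop) M (f : khom M N) :=
  F M f /\ forall W (x : khom W N), F W x -> exists y, x = f \oc y.

Lemma sieve_sum N (F : forall W, khom W N -> Prop) W n (c : 'I_n -> k)
    (x : 'I_n -> khom W N) :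
  sieve F -> (forall i, F W (x i)) -> F W (\sum_i c i *: x i).
Proof.
move=> [F0 FD _] Fx; elim/big_ind: _ => //.
  by move=> y z Fy Fz; have := FD _ 1 _ _ Fy Fz; rewrite scale1r.
by move=> i _; have := FD _ (c i) _ _ (Fx i) (F0 W); rewrite addr0.
Qed.

(** The functor is determined by its value at the generator, which is
    finite-dimensional: a spanning family of this value, seen as one map from
    a power of the generator, covers it. *)
Lemma sieve_cover N (F : forall W, khom W N -> Prop) :
  sieve F -> exists M (f : khom M N), covers F f.
Proof.
move=> sF; have [F0 FD FM] := sF.
have [B hB] := kfd (kgenob C) N.
have hB' := @dim_le_sub _ _ _ (F (kgenob C)) _ (fun _ _ => I) hB.
have [n [w [Fw wspan]]] := dim_le_span hB'.
have [M [inj [prj [h1 h2 h3 _]]]] :=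
  kbigsum (fun _ : 'I_n => kgenob C) (enum_uniq 'I_n).
have {}h1 l : prj l \oc inj l = \1 by apply: h1; rewrite mem_enum.
pose f := \sum_i w i \oc prj i.
have fi i : f \oc inj i = w i.
  rewrite /f kcomp_suml (bigD1 i) //= -kcompA h1 kcomp1r big1 ?addr0 // => j ji.
  by rewrite -kcompA h2 // kcomp0r.
exists M, f; split.
  have -> : f = \sum_i 1 *: (w i \oc prj i).
    by apply: eq_bigr => i _; rewrite scale1r.
  by apply: sieve_sum => // i; apply: FM.
move=> W x Fx; have [m [s [t ts]]] := kgen W.
have /choice [y yP] : forall i, exists y, x \oc t i = f \oc y.
  move=> i; have [c ->] := wspan _ (FM _ _ _ (t i) Fx).
  exists (\sum_j c j *: inj j); rewrite kcomp_sumr.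
  by apply: eq_bigr => j _; rewrite kcompZr fi.
exists (\sum_i y i \oc s i).
rewrite -[LHS]kcomp1r -ts !kcomp_sumr; apply: eq_bigr => i _.
by rewrite !kcompA yP.
Qed.

(** The dimension of the endomorphism ring drops on proper retracts, because
    the complementary idempotent is independent of the endomorphisms that
    factor through the retract. Inductions on the size of an object rest on
    this. *)
Lemma dim_le_retract X Y (s : khom Y X) (t : khom X Y) B :
  t \oc s = \1 -> s \oc t <> \1 -> dim_le (fun _ : khom X X => True) B ->
  exists2 B', B = B'.+1 & dim_le (fun _ : khom Y Y => True) B'.
Proof.
move=> ts st; have e0 : \1 - s \oc t <> 0.
  by move=> /eqP; rewrite subr_eq0 => /eqP /esym.
have e0c c : c *: (\1 - s \oc t) = 0 -> c = 0.
  by move=> /eqP; rewrite scaler_eq0 => /orP[/eqP//|/eqP].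
case: B => [|B] hB.
  have [//|c [[i]]] := hB (fun=> \1 - s \oc t).
  rewrite (ord1 i) => c0; rewrite big_ord_recl big_ord0 addr0 => /e0c c00.
  by rewrite c00 eqxx in c0.
exists B => // v _.
have [|c [[i ci0] cE]] := hB (fun i => oapp (fun i => s \oc v i \oc t)
  (\1 - s \oc t) (unlift ord0 i)); first by [].
move: cE; rewrite big_ord_recl unlift_none /=.
under eq_bigr do rewrite liftK /=.
move=> cE; have {}cE' : \sum_j c (lift ord0 j) *: v j = 0.
  have := congr1 (fun z => t \oc z \oc s) cE.
  rewrite /= kcompDr kcompZr kcompBr kcomp1r kcompA ts kcomp1l subrr scaler0.
  rewrite add0r kcomp0r kcomp0l kcomp_sumr kcomp_suml => E; rewrite -[RHS]E.
  apply: eq_bigr => j _.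
  by rewrite kcompZr kcompZl !kcompA ts kcomp1l -kcompA ts kcomp1r.
exists (fun j => c (lift ord0 j)); split=> //.
case: (unliftP ord0 i) ci0 => [j -> cj|-> c0]; first by exists j.
case/eqP: c0; apply: e0c.
have E : s \oc (\sum_j c (lift ord0 j) *: v j) \oc t = 0.
  by rewrite cE' kcomp0r kcomp0l.
rewrite -cE -[LHS]addr0 -[X in _ + X]E kcomp_sumr kcomp_suml; congr (_ + _).
by apply: eq_bigr => j _; rewrite kcompZr kcompZl.
Qed.

Definition right_min M N (f : khom M N) :=
  forall u : khom M M, f \oc u = f -> kiso u.

(** If f u = f and u is not invertible, then f still covers after restriction
    to the stable image of u, which is a proper retract. *)
Lemma min_cover N (F : forall W, khom W N -> Prop) :
  sieve F -> exists M (f : khom M N), covers F f /\ right_min f.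
Proof.
move=> sF; have [M [f cf]] := sieve_cover sF.
have [B hB] := kfd M M.
elim: B M f cf hB => [|B IHB] M f cf hB.
all: have [|] := EM (right_min f); first by exists M, f.
all: rewrite /right_min -existsNE => -[u]; rewrite not_implyE => -[fu nu].
all: have [e [ee e1 _ ef]] := fitting_idem (u : kend M).
all: have {e1} e1 : e <> \1 by move=> /e1.
all: have [Y [s [t [ts st]]]] := ksplit ee.
all: have [|B' BE hB'] := dim_le_retract ts _ hB; rewrite ?st //.
case: BE hB' => <-; apply: (IHB _ (f \oc s)).
have [F0 FD FM] := sF; case: cf => Ff cf; split; first exact: FM.
move=> W x /cf [y ->]; exists (t \oc y).
by rewrite -[in LHS](ef _ f fu) -st !kcompA.
Qed.

(** ** Minimal resolutions *)

(** A minimal projective resolution of the top of R 0. The first map covers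
    the radical of R 0, each further map covers the kernel of the preceding
    one; right minimality of each map makes the next one radical. *)
Definition min_res (R : nat -> C) (d : forall l, khom (R l.+1) (R l)) :=
  [/\ klocal (R 0%N), jrad (d 0%N),
      forall W (x : khom W (R 0%N)), jrad x -> exists y, x = d 0%N \oc y,
      forall l, right_min (d l) &
      forall l, d l \oc d l.+1 = 0 /\
      forall W (x : khom W (R l.+1)), d l \oc x = 0 ->
      exists y, x = d l.+1 \oc y].

Lemma min_res_exists P : klocal P ->
  exists (R : nat -> C) (d : forall l, khom (R l.+1) (R l)),
    R 0%N = P /\ min_res d.
Proof.
move=> locP.
have [|M0 [d0 [[jd0 cd0] md0]]] := @min_cover P (fun W x => jrad x).
  split=> [W|W c x y jx jy|W V x y jx]; first exact: jrad0.
    apply: jradD jy => g; rewrite kcompZl -kcompZr; exact: jx.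
  exact: jrad_compr.
pose st := {M : C & {N : C & khom M N}}.
have next : forall x : st, {y : {M' : C & khom M' (projT1 x)} |
    covers (fun W (z : khom W (projT1 x)) => projT2 (projT2 x) \oc z = 0)
      (projT2 y) /\ right_min (projT2 y)}.
  move=> [M [N d]]; apply: cid => /=.
  have [|M' [d' h]] := @min_cover M (fun W (z : khom W M) => d \oc z = 0).
    split=> [W|W c x y dx dy|W V x y dx]; first exact: kcomp0r.
      by rewrite kcompDr kcompZr dx dy scaler0 addr0.
    by rewrite kcompA dx kcomp0l.
  by exists (existT _ M' d').
pose step (x : st) : st :=
  existT _ _ (existT _ (projT1 x) (projT2 (sval (next x)))).
pose s0 : st := existT _ M0 (existT _ P d0).
pose R l := projT1 (projT2 (iter l step s0)).
pose d l : khom (R l.+1) (R l) := projT2 (projT2 (iter l step s0)).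
exists R, d; split=> //; split=> //.
  case=> [//|l]; exact: (svalP (next (iter l step s0))).2.
move=> l; have [[c1 c2] _] := svalP (next (iter l step s0)).
by split=> [|W x /c2]; [exact: c1|].
Qed.

Lemma min_res_jrad R (d : forall l, khom (R l.+1) (R l)) :
  min_res d -> forall l, jrad (d l).
Proof.
move=> [_ j0 _ dm ex] [//|l] g; apply: (dm l).
by rewrite kcompBr kcomp1r kcompA (ex l).1 kcomp0l subr0.
Qed.

(** ** The pairing between Hom(-, P) and Hom(P, -) *)

(** Modulo radical maps, Hom(V, P) is the dual of Hom(P, V) over the division
    ring of P. A functional a that does not factor through u is therefore
    nonzero on the kernel of u. The proof splits off from V the copies of P
    on which u is a section, where a does factor through u; when none is
    left, u is radical on all maps from P. *)
Lemma jrad_factor_or_dual V W P (u : khom V W) (a : khom V P) : klocal P ->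
  (exists r b, jrad r /\ a = r + b \oc u) \/
  (exists b : khom P V, jrad (u \oc b) /\ a \oc b = \1).
Proof.
move=> locP; have [B hB] := kfd V V.
elim: B V hB u a => [|B IHB] V hB u a.
all: have [ub|] := EM (forall b : khom P V, jrad (u \oc b)).
1,3: have [[b ab]|/(nonret_jrad locP) ja] := EM (kret a);
  [by right; exists b | left; exists a, 0; by rewrite kcomp0l addr0].
all: rewrite -existsNE => -[b ub].
all: have [[h hub]|/(nonsec_jrad locP) //] := EM (ksec (u \oc b)).
all: pose e := \1 - b \oc h \oc u.
all: have [ee eb] : e \oc e = e /\ e \oc b = 0.
1,3: rewrite /e !kcompE; move: hub; rewrite kcompA => hub;
  by rewrite (kcr3 hub) !kcompE; split; zmod.
all: have e1 : e <> \1.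
1,3: move=> e1; move: eb hub; rewrite e1 kcomp1l => ->; rewrite !kcomp0r;
  by case: locP => P0 _ /esym.
all: have [Y [s [t [ts st]]]] := ksplit ee.
all: have [|B' BE hB'] := dim_le_retract ts _ hB; rewrite ?st //.
case: BE hB' => <- hB'.
have [[r [c [jr aE]]]|[b' [jb ab]]] := IHB _ hB' (u \oc s) (a \oc s).
  (* With e = 1 - b h u, a equals a e + (a b h) u, and a e factors as a s
     followed by t. *)
  left; exists (r \oc t), (c - c \oc u \oc b \oc h + a \oc b \oc h).
  split; first exact: jrad_compr.
  have : a \oc s \oc t = (r + c \oc (u \oc s)) \oc t by rewrite aE.
  rewrite -kcompA st /e !kcompE -(kcompA _ s t) st /e !kcompE.
  move=> /(congr1 (fun z => z + a \oc b \oc h \oc u)).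
  by rewrite /= subrK => E; rewrite [LHS]E; zmod.
by right; exists (s \oc b'); rewrite !kcompA.
Qed.

End Local.

(** * The total complex of a minimal resolution *)

Section Total.
Variables (k : fieldType) (C : kcat k).
Variables (R : nat -> C) (d : forall l, khom (R l.+1) (R l)).
Hypothesis dmin : min_res d.
Variables (n : nat) (T : C).
Variables (inj : forall l, khom (R l) T) (prj : forall l, khom T (R l)).
Hypothesis prj_inj : forall l, (l < n.+2)%N -> prj l \oc inj l = \1.
Hypothesis prj_inj0 : forall l l', l != l' -> prj l \oc inj l' = 0.
Hypothesis sum_inj : \sum_(l < n.+2) inj l \oc prj l = \1.
Hypothesis prj0 : forall l, (n.+2 <= l)%N -> prj l = 0.

(** The total object of R 0, ..., R (n + 1), with the differential of the
    resolution. It carries no grading yet: a folded resolution and an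
    unfolded one differ only by the grading. *)
Definition tot_d : khom T T := \sum_(l < n.+1) inj l \oc d l \oc prj l.+1.

(** The projection onto the sum of the first m terms, which form a
    subcomplex. *)
Definition tot_q m : khom T T := \sum_(l < m) inj l \oc prj l.

Lemma tot_ext W (x y : khom W T) : (forall l, prj l \oc x = prj l \oc y) -> x = y.
Proof.
move=> h; rewrite -[x]kcomp1l -[y]kcomp1l -sum_inj !kcomp_suml.
by apply: eq_bigr => l _; rewrite -!kcompA h.
Qed.

Lemma prj_sum W m (f : forall l, khom W (R l)) l : (m <= n.+2)%N ->
  prj l \oc (\sum_(i < m) inj i \oc f i) = if (l < m)%N then f l else 0.
Proof.
move=> mn; rewrite kcomp_sumr; case: ltnP => lm.
  rewrite (bigD1 (Ordinal lm)) //= kcompA prj_inj ?(leq_trans lm) //.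
  rewrite kcomp1l big1 ?addr0 // => i; rewrite -val_eqE /= => il.
  by rewrite kcompA prj_inj0 ?kcomp0l // eq_sym.
apply: big1 => i _; rewrite kcompA prj_inj0 ?kcomp0l //.
by rewrite neq_ltn (leq_trans (ltn_ord i) lm) orbT.
Qed.

Lemma prj_tot_d l : prj l \oc tot_d = d l \oc prj l.+1.
Proof.
rewrite /tot_d; under eq_bigr do rewrite -kcompA.
rewrite (prj_sum (fun l => d l \oc prj l.+1)) //; case: ltnP => // nl.
by rewrite prj0 // kcomp0r.
Qed.

Lemma tot_dd : tot_d \oc tot_d = 0.
Proof.
apply: tot_ext => l; rewrite kcompA prj_tot_d -kcompA prj_tot_d kcompA.
by have [_ _ _ _ /(_ l) [-> _]] := dmin; rewrite kcomp0l kcomp0r.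
Qed.

Lemma tot_d_inj0 : tot_d \oc inj 0 = 0.
Proof.
by apply: tot_ext => l; rewrite kcompA prj_tot_d -kcompA prj_inj0 // !kcomp0r.
Qed.

Lemma tot_d_jrad : jrad tot_d.
Proof.
apply: jrad_sum => l _; apply/jrad_compr/jrad_compl; exact: min_res_jrad.
Qed.

Lemma prj_tot_q l m : (m <= n.+2)%N ->
  prj l \oc tot_q m = if (l < m)%N then prj l else 0.
Proof. by move=> mn; rewrite prj_sum. Qed.

Lemma tot_qq m m' : (m <= m' <= n.+2)%N -> tot_q m' \oc tot_q m = tot_q m.
Proof.
move=> /andP[mm m'n]; apply: tot_ext => l; rewrite kcompA prj_tot_q //.
rewrite prj_tot_q ?(leq_trans mm) //; case: ifP => lm'.
  by rewrite prj_tot_q ?(leq_trans mm).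
by rewrite kcomp0l; case: ifP => // lm; rewrite (leq_trans lm mm) in lm'.
Qed.

Lemma tot_q_all : tot_q n.+2 = \1. Proof. exact: sum_inj. Qed.

Lemma tot_dq m : (m < n.+2)%N ->
  tot_d \oc tot_q m.+1 = tot_q m \oc tot_d \oc tot_q m.+1.
Proof.
move=> mn; apply: tot_ext => l; rewrite !kcompA (prj_tot_q _ (ltnW mn)).
case: ifP => lm //; rewrite prj_tot_d -kcompA prj_tot_q // ltnS lm.
by rewrite !kcomp0l kcomp0r.
Qed.

(** The rows of f are made strictly triangular one after the other. On the
    first m + 1 terms, row m is a cycle once the rows above it are
    triangular, so it lifts through d m; subtracting the resulting
    null-homotopic map clears it and does not affect the rows above.
    Null-homotopic maps are radical, since the differential is. *)
Lemma tot_triangular (f : khom T T) : tot_d \oc f = f \oc tot_d ->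
  jrad (prj 0 \oc f \oc inj 0) ->
  forall m, (m < n.+2)%N -> exists g,
  [/\ tot_d \oc g = g \oc tot_d, jrad (f - g),
      forall l, (l < m)%N -> prj l \oc g \oc tot_q l.+1 = 0 &
      m = 0%N -> jrad (prj 0 \oc g \oc inj 0)].
Proof.
move=> df jf; elim=> [_|m IHm mn].
  by exists f; split=> //; rewrite subrr; apply: jrad0.
have [g [dg jg gq g0]] := IHm (ltnW mn).
have [_ _ cov0 _ ex] := dmin.
have [h hE] : exists h, prj m \oc g \oc tot_q m.+1 = d m \oc h.
  (* For m = 0 the row is the radical endomorphism of R 0, and d 0 covers
     radical maps; for m > 0 exactness applies. *)
  case: m mn gq g0 {IHm} => [|m] mn gq g0.
    apply: cov0; rewrite /tot_q big_ord_recl big_ord0 addr0 kcompA.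
    by apply/jrad_compr/g0.
  apply: (ex m).2.
  rewrite !kcompA -prj_tot_d -(kcompA _ tot_d) dg !kcompA.
  by rewrite (kcr (tot_dq (ltnW mn))) !kcompA gq // !kcomp0l.
pose h' := h \oc tot_q m.+1.
have qq : tot_q m.+1 \oc tot_q m.+1 = tot_q m.+1.
  by apply: tot_qq; rewrite leqnn ltnW.
have h'q : h' \oc tot_q m.+1 = h' by rewrite /h' -kcompA qq.
have {}hE : prj m \oc g \oc tot_q m.+1 = d m \oc h'.
  by rewrite /h' kcompA -hE (kcr qq).
clearbody h'; have [H HE] : exists H, H = inj m.+1 \oc h' by exists (inj m.+1 \oc h').
exists (g - (tot_d \oc H + H \oc tot_d)); split=> //.
- rewrite !kcompE dg tot_dd (kcr tot_dd) !kcompE; zmod.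
- have -> : f - (g - (tot_d \oc H + H \oc tot_d)) =
     (f - g) + (tot_d \oc H + H \oc tot_d) by zmod.
  apply: jradD => //; apply: jradD.
    exact/jrad_compr/tot_d_jrad.
  exact/jrad_compl/tot_d_jrad.
move=> l; rewrite ltnS => lm.
have pH i : (i <= m)%N -> prj i \oc H = 0.
  by move=> im; rewrite HE kcompA prj_inj0 ?kcomp0l // neq_ltn ltnS im.
rewrite !kcompE prj_tot_d pH // !kcomp0l addr0 -!(kcompA (d l)).
case: (eqVneq l m) => [->|lm'].
  by rewrite HE (kcompA (prj _)) prj_inj // kcomp1l h'q hE subrr.
have lm1 : (l < m)%N by rewrite ltn_neqAle lm lm'.
by rewrite gq // pH // !kcomp0l kcomp0r subr0.
Qed.

(** By [tot_triangular], up to radical maps, f is strictly triangular except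
    for its last row c. Now d n kills c, so by right minimality of d n the
    last row does not affect the invertibility of 1 - f. *)
Lemma tot_local (f : khom T T) : tot_d \oc f = f \oc tot_d ->
  jrad (prj 0 \oc f \oc inj 0) -> kiso (\1 - f).
Proof.
move=> df jf; have [g [dg jg gq _]] := tot_triangular df jf (leqnn n.+2).
have -> : \1 - f = (\1 - g) - (f - g) by zmod.
apply: kiso_jradB jg => {f df jf}.
pose S : kend T := tot_q n.+1 \oc g.
have Sq m : (m < n.+2)%N -> S \oc tot_q m.+1 = tot_q m \oc S \oc tot_q m.+1.
  move=> mn; apply: tot_ext => l; rewrite /S !kcompA (prj_tot_q _ (ltnW mn)) prj_tot_q //.
  case: (ltnP l m) => lm; first by rewrite prj_tot_q.
  case: ifP => ln; rewrite ?kcomp0l //.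
  have <- : tot_q l.+1 \oc tot_q m.+1 = tot_q m.+1.
    by apply: tot_qq; rewrite ltnS lm ltnW.
  by rewrite kcompA gq // kcomp0l.
have Sn m : (m <= n.+2)%N -> (S ^+ m : kend T) \oc tot_q m = 0.
  elim: m => [_|m IHm mn]; first by rewrite /tot_q big_ord0 kcomp0r.
  rewrite exprSr kendM -kcompA (Sq m mn) !kcompA IHm ?kcomp0l //.
  exact: ltnW.
have iS : kiso (\1 - S : khom T T).
  by apply: (@nilpotent_kiso _ _ _ S n.+2); rewrite -[LHS]kcomp1r -tot_q_all Sn.
have [G [GS SG]] := iS.
pose c := prj n.+1 \oc g.
have dc : d n \oc c = 0.
  rewrite /c kcompA -prj_tot_d -kcompA dg kcompA -[LHS]kcomp1r -tot_q_all.
  by rewrite (kcr (tot_dq (ltnSn _))) !kcompA gq // !kcomp0l.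
have gE : g = S + inj n.+1 \oc c.
  rewrite /S /c kcompA -kcompDl -[LHS]kcomp1l -tot_q_all; congr (_ \oc _).
  by rewrite /tot_q big_ord_recr.
clearbody c; have -> : \1 - g = (\1 - inj n.+1 \oc (c \oc G)) \oc (\1 - S).
  rewrite kcompDl kcomp1l kcompNl -!kcompA GS kcomp1r [in LHS]gE; zmod.
apply: kiso_comp iS; apply: kiso_swap.
have [_ _ _ dm _] := dmin; apply: (dm n).
by rewrite !kcompE dc !kcompE subr0.
Qed.

Section Complete.
Hypothesis Rn0 : kid (R n.+2) = 0.

(** The components of y are found by lifting successively through d 0, d 1,
    ...; as R (n + 2) vanishes, nothing remains to be lifted at the end. *)
Lemma tot_lift W (w : khom W W) (x : khom W (R 0%N)) :
  jrad x -> x \oc w = 0 ->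
  w \oc w = 0 ->
  exists y : khom W T, tot_d \oc y - y \oc w = inj 0 \oc x /\ prj 0 \oc y = 0.
Proof.
move=> jx xw ww; have [_ _ cov0 _ ex] := dmin.
have /cid [lft lftP] : exists lft : forall l, khom W (R l) -> khom W (R l.+1),
    forall l z, (exists y, z = d l \oc y) -> z = d l \oc lft l z.
  have h l (z : khom W (R l)) : {y : khom W (R l.+1) |
      (exists y, z = d l \oc y) -> z = d l \oc y}.
    apply: cid; have [[y zE]|] := EM (exists y, z = d l \oc y).
      by exists y.
    by exists 0.
  by exists (fun l z => sval (h l z)) => l z; apply: (svalP (h l z)).
pose fix ys l : khom W (R l.+1) :=
  match l with 0%N => lft 0%N x | l'.+1 => lft l'.+1 (ys l' \oc w) end.
have ys0 : d 0%N \oc ys 0%N = x by rewrite /= -lftP //; apply: cov0.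
have ysS l : d l.+1 \oc ys l.+1 = ys l \oc w.
  elim: l => [|l IHl]; rewrite /= -lftP //.
    by apply: (ex 0%N).2; rewrite kcompA ys0.
  by apply: (ex l.+1).2; rewrite kcompA IHl -kcompA ww kcomp0r.
pose z l : khom W (R l) := match l with 0%N => 0 | l'.+1 => ys l' end.
have [y yE] : exists y, forall l, (l <= n.+2)%N -> prj l \oc y = z l.
  exists (\sum_(i < n.+2) inj i \oc z i) => l ln; rewrite prj_sum //.
  case: ltnP => // nl; have -> : l = n.+2 by apply/eqP; rewrite eqn_leq ln.
  by rewrite -[RHS]kcomp1l Rn0 kcomp0l.
exists y; split; last by rewrite yE.
apply: tot_ext => l; rewrite kcompBr !kcompA prj_tot_d.
case: (ltnP l n.+2) => ln; last first.
  by rewrite !prj0 ?kcomp0r ?kcomp0l ?subr0 // (leq_trans ln).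
rewrite -kcompA !yE //; last exact: ltnW.
case: l ln => [|l] ln; last first.
  by rewrite /z ysS subrr prj_inj0 // kcomp0l.
by rewrite /z ys0 prj_inj // kcomp0l kcomp1l subr0.
Qed.

(** The inverse of the bottom component of f lifts to an endomorphism h, by
    [tot_lift]. The composite h f has the identity as bottom component, so it
    is invertible by [tot_local]; the same argument applies to h. *)
Lemma tot_local_iso (f : khom T T) : tot_d \oc f = f \oc tot_d ->
  kiso (prj 0 \oc f \oc inj 0) -> kiso f.
Proof.
have half (g : khom T T) : tot_d \oc g = g \oc tot_d ->
    kiso (prj 0 \oc g \oc inj 0) ->
    exists h, [/\ tot_d \oc h = h \oc tot_d, kiso (prj 0 \oc h \oc inj 0) &
                  kiso (h \oc g)].
  move=> dg [x [xg gx]].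
  have [|||y []] := @tot_lift T tot_d (x \oc prj 0 \oc tot_d).
  - by apply/jrad_compl/tot_d_jrad.
  - by rewrite -kcompA tot_dd kcomp0r.
  - exact: tot_dd.
  move=> dy py; pose h := inj 0 \oc (x \oc prj 0) + y.
  have ph : prj 0 \oc h = x \oc prj 0.
    by rewrite /h !kcompE prj_inj // kcomp1l py addr0.
  have dh : tot_d \oc h = h \oc tot_d.
    rewrite /h !kcompE tot_d_inj0 !kcomp0l add0r.
    by move: dy => /(canRL (subrK _)) ->; rewrite !kcompA.
  clearbody h; exists h; split=> //.
    rewrite ph -kcompA prj_inj // kcomp1r.
    by exists (prj 0 \oc g \oc inj 0).
  have -> : h \oc g = \1 - (\1 - h \oc g) by zmod.
  apply: tot_local.
    by rewrite !kcompE dh -!kcompA dg.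
  have -> : prj 0 \oc (\1 - h \oc g) \oc inj 0 = 0; last exact: jrad0.
  rewrite !kcompE ph prj_inj //; move: xg; rewrite !kcompA => ->.
  by rewrite subrr.
move=> df /(half f df) [h [dh /(half h dh) [h' [_ _ sh]] hf]].
have ih : kiso h by apply: kiso_secret; [exact: kiso_secr sh|exact: kiso_retl hf].
have [h1 [h1h hh1]] := ih.
have -> : f = h1 \oc (h \oc f) by rewrite kcompA h1h kcomp1l.
by apply: kiso_comp hf; exists h.
Qed.

End Complete.
End Total.

(** * The opposite category *)

Definition kop (k : fieldType) (C : kcat k) : kcat k.
Proof.
refine (@KCat k (kob C) (fun X Y => khom Y X) (fun X => kid X)
  (fun X Y Z g f => f \oc g) _ _ _ _ _ _ _ _ _ _ (kgenob C) _).
- by move=> *; rewrite kcompA.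
- by move=> *; rewrite kcomp1r.
- by move=> *; rewrite kcomp1l.
- by move=> *; rewrite kcompDr.
- by move=> *; rewrite kcompDl.
- by move=> *; rewrite kcompZr.
- by move=> *; rewrite kcompZl.
- by move=> X Y; apply: kfd.
- move=> X Y; have [Z [i1 [i2 [p1 [p2 [h1 h2 h3 h4 h5]]]]]] := kbip X Y.
  by exists Z, p1, p2, i1, i2.
- move=> X e ee; have [Y [s [t [ts st]]]] := ksplit ee.
  by exists Y, t, s.
- move=> X; have [n [s [t st]]] := kgen X; by exists n, t, s.
Defined.

Section Op.
Variables (k : fieldType) (C : kcat k).
Implicit Types X Y P : C.

Lemma kiso_op X Y (f : khom X Y) : @kiso _ (kop C) Y X f <-> kiso f.
Proof. by split=> -[g [h1 h2]]; exists g. Qed.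

Lemma jrad_op X Y (f : khom X Y) : @jrad _ (kop C) Y X f <-> jrad f.
Proof.
split=> jf; first by apply: jradP => g; apply/kiso_op/(jf g).
by move=> g; apply/kiso_op/jrad_swap.
Qed.

Lemma klocal_op P : klocal P -> @klocal _ (kop C) P.
Proof. by []. Qed.
End Op.

(** * Graded complexes *)

(** A graded object is an object with orthogonal idempotents indexed by the
    degrees, almost all zero. Homs are then those of the ambient category,
    periodic and bounded complexes are treated alike, and no transport along
    equalities of degrees occurs. *)
Record gcx (k : fieldType) (C : kcat k) (I : nzRingType) := Gcx {
  gob :> C;
  gd : khom gob gob;
  ge : I -> khom gob gob;
  gs : seq I;
  gs_uniq : uniq gs;
  ge_ort : forall i j, ge i \oc ge j = if i == j then ge i else 0;
  ge_sum : \sum_(i <- gs) ge i = \1;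
  gdeg : forall i, gd \oc ge i = ge (i + 1) \oc gd;
  gdd : gd \oc gd = 0
}.

Section Graded.
Variables (k : fieldType) (C : kcat k) (I : nzRingType).
Implicit Types X Y Z W J : gcx C I.

Definition hdeg X Y (n : I) (f : khom X Y) :=
  forall i, f \oc ge X i = ge Y (i + n) \oc f.
(** The homogeneous component of degree n. *)
Definition hpart X Y (n : I) (f : khom X Y) : khom X Y :=
  \sum_(i <- gs X) ge Y (i + n) \oc f \oc ge X i.
Definition cmap X Y (f : khom X Y) := hdeg 0 f /\ gd Y \oc f = f \oc gd X.

Lemma ge_idem X i : ge X i \oc ge X i = ge X i.
Proof. by rewrite ge_ort eqxx. Qed.

Lemma ge_ort0 X i j : i != j -> ge X i \oc ge X j = 0.
Proof. by rewrite ge_ort => /negPf->. Qed.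

Lemma ge_out X i : i \notin gs X -> ge X i = 0.
Proof.
move=> h; rewrite -[LHS]kcomp1r -ge_sum kcomp_sumr big_seq big1 // => j js.
by rewrite ge_ort0 //; apply: contraNneq h => ->.
Qed.

Lemma ge_ext X (Y : C) (f g : khom X Y) :
  (forall i, f \oc ge X i = g \oc ge X i) -> f = g.
Proof.
move=> h; rewrite -[f]kcomp1r -[g]kcomp1r -ge_sum !kcomp_sumr.
by apply: eq_bigr.
Qed.

Lemma hpart_ge X Y n (f : khom X Y) i :
  hpart n f \oc ge X i = ge Y (i + n) \oc f \oc ge X i.
Proof.
case: (boolP (i \in gs X)) => iX; last by rewrite (ge_out iX) !kcomp0r.
rewrite /hpart kcomp_suml (bigD1_seq i) ?gs_uniq //= big1 => [|j ji].
  by rewrite addr0 -kcompA ge_idem.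
by rewrite -kcompA ge_ort0 // kcomp0r.
Qed.

Lemma ge_hpart X Y n (f : khom X Y) i :
  ge Y (i + n) \oc hpart n f = ge Y (i + n) \oc f \oc ge X i.
Proof.
apply: ge_ext => j; rewrite -[LHS]kcompA hpart_ge -(kcompA _ (ge X i)) ge_ort.
case: (eqVneq i j) => [->|ij]; first by rewrite !kcompA ge_idem.
rewrite !kcompA ge_ort0 ?kcomp0l ?kcomp0r //.
by apply: contraNneq ij => /addIr ->.
Qed.

Lemma hpart_deg X Y n (f : khom X Y) : hdeg n (hpart n f).
Proof. by move=> i; rewrite hpart_ge ge_hpart. Qed.

Lemma hpart_id X Y n (f : khom X Y) : hdeg n f -> hpart n f = f.
Proof.
by move=> h; apply: ge_ext => i; rewrite hpart_ge -kcompA h kcompA ge_idem.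
Qed.

Lemma hpart_compl X Y Z n p (g : khom Y Z) (f : khom X Y) : hdeg p g ->
  hpart (n + p) (g \oc f) = g \oc hpart n f.
Proof.
move=> h; apply: ge_ext => i; rewrite -[RHS]kcompA !hpart_ge addrA !kcompA.
by rewrite -h.
Qed.

Lemma hpart_compr X Y Z n p (g : khom Y Z) (f : khom X Y) : hdeg p f ->
  hpart (p + n) (g \oc f) = hpart n g \oc f.
Proof.
move=> h; apply: ge_ext => i; rewrite -[RHS]kcompA h kcompA hpart_ge.
by rewrite hpart_ge addrA -!kcompA h.
Qed.

Lemma gd_deg X : hdeg 1 (gd X). Proof. exact: gdeg. Qed.

Lemma hpart0_d X Y (f : khom X Y) :
  gd Y \oc hpart 0 f - hpart 0 f \oc gd X = hpart 1 (gd Y \oc f - f \oc gd X).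
Proof.
rewrite -(hpart_compl _ _ (gd_deg Y)) -(hpart_compr _ _ (gd_deg X)).
rewrite add0r addr0 -sumrB; apply: eq_bigr => i _.
by rewrite kcompBr kcompBl.
Qed.

Lemma cmap_comp X Y Z (g : khom Y Z) (f : khom X Y) :
  cmap g -> cmap f -> cmap (g \oc f).
Proof.
move=> [g1 g2] [f1 f2]; split=> [i|]; last by rewrite kcompA g2 -!kcompA f2.
by rewrite -kcompA f1 kcompA g1 kcompA !addr0.
Qed.

Lemma cmap_inv X Y (f : khom X Y) (g : khom Y X) :
  g \oc f = \1 -> f \oc g = \1 -> cmap f -> cmap g.
Proof.
move=> gf fg [f1 f2]; split=> [i|].
  rewrite -[LHS]kcomp1r -fg !kcompA -(kcompA g) -(addr0 i) -f1 addr0.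
  by rewrite !kcompA gf kcomp1l addr0.
by rewrite -[RHS]kcomp1r -fg !kcompA -(kcompA g) f2 !kcompA gf kcomp1l.
Qed.

Lemma cmap_isoP X Y (f : khom X Y) : cmap f -> kiso f ->
  exists g : khom Y X, [/\ cmap g, g \oc f = \1 & f \oc g = \1].
Proof. by move=> cf [g [h1 h2]]; exists g; split=> //; apply: cmap_inv cf. Qed.

End Graded.

Section OpGraded.
Variables (k : fieldType) (C : kcat k) (I : nzRingType).

(** Degrees change sign, so that the differential still has degree 1. *)
Definition opx (X : gcx C I) : gcx (kop C) I.
Proof.
refine (@Gcx _ (kop C) I (gob X) (gd X) (fun i => ge X (- i))
  (map -%R (gs X)) _ _ _ _ _).
- by rewrite map_inj_uniq ?gs_uniq //; apply: oppr_inj.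
- move=> i j /=; rewrite ge_ort eqr_opp eq_sym; case: eqP => // -> //.
- by rewrite big_map -(ge_sum X) /=; apply: eq_bigr => i _; rewrite opprK.
- by move=> i /=; rewrite gdeg opprD subrK.
- exact: (gdd X).
Defined.

(** An inverse to [opx], used for complexes that are quantified over in the
    opposite category. *)
Definition unopx (X : gcx (kop C) I) : gcx C I.
Proof.
refine (@Gcx _ C I (gob X) (gd X) (fun i => ge X (- i))
  (map -%R (gs X)) _ _ _ _ _).
- by rewrite map_inj_uniq ?gs_uniq //; apply: oppr_inj.
- move=> i j /=; have := ge_ort X (- j) (- i); rewrite /= eqr_opp eq_sym => ->.
  by case: eqP => // ->.
- by rewrite big_map -(ge_sum X) /=; apply: eq_bigr => i _; rewrite opprK.
- move=> i /=; have := gdeg X (- (i + 1)) => /= ->.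
  by rewrite opprD subrK.
- exact: (gdd X).
Defined.

Lemma cmap_op (X Y : gcx C I) (f : khom X Y) :
  @cmap _ (kop C) I (opx Y) (opx X) f <-> cmap f.
Proof.
split=> -[h1 h2]; split=> [i|]; try exact/esym/h2.
  by have := h1 (- i); rewrite /= !addr0 opprK => ->.
by have := h1 (- i); rewrite /= !addr0 => ->.
Qed.

Lemma cmap_unop_l (X : gcx C I) (W : gcx (kop C) I) (f : khom (gob W : C) X) :
  @cmap _ (kop C) I (opx X) W f <-> @cmap _ C I (unopx W) X f.
Proof.
split=> -[h1 h2]; split=> [i|]; try exact/esym/h2.
  by have := h1 (- i); rewrite /= !addr0 opprK => ->.
by have := h1 (- i); rewrite /= !addr0 !opprK => ->.
Qed.

Lemma cmap_unop_r (X : gcx C I) (W : gcx (kop C) I) (f : khom X (gob W : C)) :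
  @cmap _ (kop C) I W (opx X) f <-> @cmap _ C I X (unopx W) f.
Proof.
split=> -[h1 h2]; split=> [i|]; try exact/esym/h2.
  by have := h1 (- i); rewrite /= !addr0 opprK => ->.
by have := h1 (- i); rewrite /= !addr0 !opprK => ->.
Qed.

End OpGraded.

(** * Resolution complexes *)

(** The families are extended by zero beyond n + 1, which avoids bounds on
    the indices. *)
Record tot_data (k : fieldType) (C : kcat k) (R : nat -> C) (n : nat) (T : C)
    (inj : forall l, khom (R l) T) (prj : forall l, khom T (R l)) := TotData {
  td_id : forall l, (l < n.+2)%N -> prj l \oc inj l = \1;
  td_ort : forall l l', l != l' -> prj l \oc inj l' = 0;
  td_sum : \sum_(l < n.+2) inj l \oc prj l = \1;
  td_prj : forall l, (n.+2 <= l)%N -> prj l = 0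
}.

Section Totcx.
Variables (k : fieldType) (C : kcat k) (I : nzRingType).
Variables (R : nat -> C) (d : forall l, khom (R l.+1) (R l)).
Hypothesis dmin : min_res d.

(** The term R l sits in degree j - l. Since I is an arbitrary ring, this
    covers the resolution itself (I the integers) and its folding. *)
Lemma totcx_exists (n : nat) (j : I) :
  exists (X : gcx C I) (inj : forall l, khom (R l) X)
    (prj : forall l, khom X (R l)),
  [/\ tot_data n inj prj, gd X = tot_d d n inj prj,
      forall l i, prj l \oc ge X i = (if j - l%:R == i then prj l else 0) &
      forall l i, ge X i \oc inj l = (if j - l%:R == i then inj l else 0)].
Proof.
have [T [inj [prj [h1 h2 h3 h4]]]] := kbigsum R (iota_uniq 0 n.+2).
have td : tot_data n inj prj.
  split=> //.
  - by move=> l ln; apply: h1; rewrite mem_iota.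
  - by rewrite -h3 -(big_mkord xpredT (fun l => inj l \oc prj l)) /index_iota subn0.
  - by move=> l ln; apply: (h4 l _).2; rewrite mem_iota -leqNgt.
have ext := tot_ext (td_sum td).
pose e i : khom T T := \sum_(l < n.+2 | j - l%:R == i) inj l \oc prj l.
have pe l i : prj l \oc e i = if j - l%:R == i then prj l else 0.
  have -> : e i = \sum_(a < n.+2) inj a \oc (if j - a%:R == i then prj a else 0).
    rewrite /e big_mkcond; apply: eq_bigr => a _.
    by case: ifP; rewrite ?kcomp0r.
  rewrite (prj_sum (td_id td) h2 (fun l => if j - l%:R == i then prj l else 0)) //.
  by case: ltnP => // nl; rewrite (td_prj td) // if_same.
have ei l i : e i \oc inj l = if j - l%:R == i then inj l else 0.
  apply: ext => l'; rewrite kcompA pe.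
  case: (eqVneq l l') => [->|ll']; first by case: ifP; rewrite ?kcomp0l ?kcomp0r.
  case: ifP; case: ifP => _ _; rewrite ?kcomp0l ?kcomp0r ?h2 // eq_sym //.
pose r := undup [seq j - l%:R | l <- iota 0 n.+2].
have prD := prj_tot_d d (td_id td) h2 (td_prj td).
have ort i i' : e i \oc e i' = if i == i' then e i else 0.
  apply: ext => l; rewrite kcompA pe; case: (eqVneq i i') => [<-|ii'].
    by rewrite pe; case: ifP => c; rewrite ?kcomp0l // pe c.
  by case: eqP => [E|_]; rewrite ?kcomp0l ?kcomp0r // pe E (negPf ii').
have sum : \sum_(i <- r) e i = \1.
  apply: ext => l; rewrite kcomp_sumr kcomp1r.
  under eq_bigr do rewrite pe.
  case: (ltnP l n.+2) => ln; last first.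
    by rewrite (td_prj td) // big1 // => i _; rewrite if_same.
  rewrite (bigD1_seq (j - l%:R)) ?undup_uniq //=; last first.
    by rewrite mem_undup; apply/mapP; exists l; rewrite // mem_iota.
  by rewrite eqxx big1 ?addr0 // => i; rewrite eq_sym => /negPf->.
have deg i : tot_d d n inj prj \oc e i = e (i + 1) \oc tot_d d n inj prj.
  apply: ext => l; rewrite !kcompA prD pe -kcompA pe.
  have -> : (j - l.+1%:R == i) = (j - l%:R == i + 1).
    by rewrite -(inj_eq (addIr 1)) -natr1 opprD addrA subrK.
  by case: ifP => _; rewrite ?kcomp0r ?kcomp0l ?prD.
have dd := tot_dd dmin (td_id td) h2 (td_sum td) (td_prj td).
by exists (Gcx (undup_uniq _) ort sum deg dd), inj, prj.
Qed.
End Totcx.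

(** What is used of the folded resolution, in a form that is invariant under
    isomorphism: P is the bottom term, with projection pr and inclusion ij,
    in the degree of the idempotent e. The field [rc_lift] says that the
    cocycle ij x is a coboundary; applied to the obstruction x = a w it lifts
    a map a from W to P to a chain map. *)
Record rescx (k : fieldType) (C : kcat k) (X : C) (D e : khom X X) (P : C)
    (pr : khom X P) (ij : khom P X) : Prop := Rescx {
  rc_pi : pr \oc ij = \1;
  rc_D : D \oc ij = 0;
  rc_jrad : jrad (pr \oc D);
  rc_pe : pr \oc e = pr;
  rc_ei : e \oc ij = ij;
  rc_lift : forall W (w : khom W W) (x : khom W P),
    w \oc w = 0 -> jrad x -> x \oc w = 0 ->
    exists y : khom W X, D \oc y - y \oc w = ij \oc x /\ pr \oc y = 0;
  rc_loc : forall f : khom X X, D \oc f = f \oc D ->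
    (jrad (pr \oc f \oc ij) -> kiso (\1 - f)) /\
    (kiso (pr \oc f \oc ij) -> kiso f)
}.

(** The dual of [rescx], for folded coresolutions. *)
Record corescx (k : fieldType) (C : kcat k) (X : C) (D e : khom X X) (P : C)
    (pr : khom X P) (ij : khom P X) : Prop := Corescx {
  cc_pi : pr \oc ij = \1;
  cc_D : pr \oc D = 0;
  cc_jrad : jrad (D \oc ij);
  cc_pe : pr \oc e = pr;
  cc_ei : e \oc ij = ij;
  cc_lift : forall W (w : khom W W) (x : khom P W),
    w \oc w = 0 -> jrad x -> w \oc x = 0 ->
    exists y : khom X W, y \oc D - w \oc y = x \oc pr /\ y \oc ij = 0;
  cc_loc : forall f : khom X X, D \oc f = f \oc D ->
    (jrad (pr \oc f \oc ij) -> kiso (\1 - f)) /\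
    (kiso (pr \oc f \oc ij) -> kiso f)
}.

Section Rescx.
Variables (k : fieldType) (C : kcat k).
Implicit Types X P : C.

Lemma rescx_op X (D e : khom X X) P (pr : khom X P) (ij : khom P X) :
  rescx D e pr ij -> @corescx _ (kop C) X D e P ij pr.
Proof.
case=> h1 h2 h3 h4 h5 h6 h7; split=> //; first exact/jrad_op.
  by move=> W w x ww /jrad_op jx xw; apply: h6.
move=> f Df; have [l1 l2] := h7 f (esym Df); rewrite /= kcompA.
by split=> [/jrad_op /l1 /kiso_op|/kiso_op /l2 /kiso_op].
Qed.

Lemma corescx_op X (D e : khom X X) P (pr : khom X P) (ij : khom P X) :
  corescx D e pr ij -> @rescx _ (kop C) X D e P ij pr.
Proof.
case=> h1 h2 h3 h4 h5 h6 h7; split=> //; first exact/jrad_op.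
  by move=> W w x ww /jrad_op jx xw; apply: h6.
move=> f Df; have [l1 l2] := h7 f (esym Df); rewrite /= kcompA.
by split=> [/jrad_op /l1 /kiso_op|/kiso_op /l2 /kiso_op].
Qed.

Lemma corescx_unop X (D e : khom X X) P (pr : khom X P) (ij : khom P X) :
  @rescx _ (kop C) X D e P ij pr -> corescx D e pr ij.
Proof.
case=> h1 h2 h3 h4 h5 h6 h7; split=> //; first exact/jrad_op.
  by move=> W w x ww jx xw; apply: h6 => //; apply/jrad_op.
move=> f Df; have [l1 l2] := h7 f (esym Df); rewrite /= kcompA in l1 l2.
by split=> [/jrad_op /l1 /kiso_op|/kiso_op /l2 /kiso_op].
Qed.

Lemma rescx_iso X X' (D e : khom X X) (D' e' : khom X' X') P (pr : khom X P)
    (ij : khom P X) (f : khom X X') (g : khom X' X) :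
  g \oc f = \1 -> f \oc g = \1 -> D' \oc f = f \oc D -> e' \oc f = f \oc e ->
  rescx D e pr ij -> rescx D' e' (pr \oc g) (f \oc ij).
Proof.
move=> gf fg Df ef [h1 h2 h3 h4 h5 h6 h7].
have Dg : D \oc g = g \oc D'.
  by rewrite -[RHS]kcomp1r -fg !kcompA -(kcompA g) Df kcompA gf kcomp1l.
have eg : e \oc g = g \oc e'.
  by rewrite -[RHS]kcomp1r -fg !kcompA -(kcompA g) ef kcompA gf kcomp1l.
split.
- by rewrite kcompA (kcr gf) kcomp1r.
- by rewrite kcompA Df -kcompA h2 kcomp0r.
- by rewrite -kcompA -Dg kcompA; apply: jrad_compr.
- by rewrite -kcompA -eg kcompA h4.
- by rewrite kcompA ef -kcompA h5.
- move=> W w x ww jx xw; have [y [yE py]] := h6 W w x ww jx xw.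
  exists (f \oc y); rewrite !kcompA (kcr gf) kcomp1r py; split=> //.
  by rewrite Df -!kcompA -kcompBr yE.
move=> a Da; have [|l1 l2] := h7 (g \oc a \oc f).
  by rewrite !kcompA Dg -(kcompA g D') Da -!kcompA Df.
have isoc b : kiso (g \oc b \oc f) -> kiso b.
  move=> ib; have -> : b = f \oc (g \oc b \oc f) \oc g.
    by rewrite !kcompA fg kcomp1l (kcr fg) kcomp1r.
  apply: kiso_comp; last by exists f.
  by apply: (kiso_comp _ ib); exists g.
rewrite !kcompA in l1 l2 *; split=> [/l1|/l2]; last exact: isoc.
by move=> h; apply: isoc; rewrite !kcompE gf.
Qed.

Lemma rescx_exists (I : nzRingType) (R : nat -> C)
    (d : forall l, khom (R l.+1) (R l)) n (j : I) :
  min_res d -> kid (R n.+2) = 0 ->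
  exists (X : gcx C I) (pr : khom X (R 0%N)) (ij : khom (R 0%N) X),
  rescx (gd X) (ge X j) pr ij.
Proof.
move=> dmin R0; have [X [inj [prj [[h1 h2 h3 h5] DE pe ei]]]] :=
  totcx_exists dmin n j.
exists X, (prj 0%N), (inj 0%N); split; rewrite ?DE.
- exact: h1.
- exact: tot_d_inj0.
- exact/jrad_compl/tot_d_jrad.
- by rewrite pe subr0 eqxx.
- by rewrite ei subr0 eqxx.
- move=> W w x ww jx xw; exact: tot_lift.
move=> f Df; split; first exact: (tot_local dmin h1 h2 h3 h5 Df).
exact: (tot_local_iso dmin h1 h2 h3 h5 R0 Df).
Qed.
End Rescx.

(** * Lifting to resolution complexes *)

Section Lifting.
Variables (k : fieldType) (C : kcat k) (I : nzRingType).
Implicit Types (X Y W J : gcx C I) (P : C).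

Lemma ge_pr X P (pr : khom X P) i j : pr \oc ge X j = pr ->
  pr \oc ge X i = if i == j then pr else 0.
Proof.
move=> pe; rewrite -[in LHS]pe -kcompA ge_ort eq_sym.
by case: eqP => _; rewrite ?pe ?kcomp0r.
Qed.

Lemma ge_ij X P (ij : khom P X) i j : ge X j \oc ij = ij ->
  ge X i \oc ij = if i == j then ij else 0.
Proof.
move=> pe; rewrite -[in LHS]pe kcompA ge_ort.
by case: eqP => [->|_]; rewrite ?pe ?kcomp0l.
Qed.

(** The map provided by [rc_lift] need not be homogeneous; its component of
    degree 0 solves the same equation. *)
Lemma rescx_lift_cmap X W j P (pr : khom X P) ij (a : khom W P) :
  rescx (gd X) (ge X j) pr ij -> a \oc ge W j = a -> jrad (a \oc gd W) ->
  exists f : khom W X, cmap f /\ pr \oc f = a.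
Proof.
move=> rX ae ja; have [|y [yE py]] := rc_lift rX (gdd W) ja.
  by rewrite -kcompA gdd kcomp0r.
exists (hpart 0 (ij \oc a + y)); split.
  split; first exact: hpart_deg.
  apply/eqP; rewrite -subr_eq0 hpart0_d !kcompE (rc_D rX) kcomp0l.
  have -> : 0 + gd X \oc y - (ij \oc a \oc gd W + y \oc gd W) =
    gd X \oc y - y \oc gd W - ij \oc a \oc gd W by zmod.
  rewrite yE kcompA subrr; apply/eqP/big1 => i _.
  by rewrite kcomp0r kcomp0l.
rewrite -{1}(rc_pe rX) -(addr0 j) -kcompA ge_hpart !kcompA addr0 (rc_pe rX).
by rewrite kcompDr kcompA (rc_pi rX) kcomp1l py addr0.
Qed.

(** One half of the classification of the maps into the shift of a resolution
    by the cohomology of Hom(W, P)/rad. *)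
Lemma rescx_null X W j P (pr : khom X P) ij (a r : khom W P) b :
  rescx (gd X) (ge X (j + 1)) pr ij -> a \oc ge W j = a -> a \oc gd W = 0 ->
  jrad r -> a = r + b \oc gd W ->
  exists s : khom W X, hdeg 0 s /\ ij \oc a = s \oc gd W - gd X \oc s.
Proof.
move=> rX ae ad jr aE.
pose r' := r \oc ge W j; pose b' := b \oc ge W (j + 1).
have aE' : a = r' + b' \oc gd W.
  by rewrite -[LHS]ae aE kcompDl /b' -!kcompA gdeg.
have {}jr : jrad r' by apply: jrad_compr.
clearbody r' b'; have [|y [yE _]] := rc_lift rX (gdd W) jr.
  have : (r' + b' \oc gd W) \oc gd W = 0 by rewrite -aE'.
  by rewrite kcompDl -kcompA gdd kcomp0r addr0.
pose s := y - ij \oc b'.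
have E : gd X \oc s - s \oc gd W = ij \oc a.
  rewrite /s !kcompE (rc_D rX) kcomp0l aE' kcompDr -yE kcompA; zmod.
have dega : hdeg 1 (ij \oc a).
  move=> i; rewrite -kcompA (ge_pr i ae) kcompA (ge_ij _ (rc_ei rX)).
  by rewrite (inj_eq (addIr 1)); case: eqP; rewrite ?kcomp0r ?kcomp0l.
exists (- hpart 0 s); split.
  by move=> i; rewrite kcompNl kcompNr hpart_deg.
rewrite kcompNl kcompNr opprK addrC hpart0_d E; exact/esym/hpart_id.
Qed.

(** A contractible complex P = P, in degrees j and j + 1: u includes the
    term of degree j and v projects to the term of degree j + 1, so u v is a
    contraction. *)
Record jdata J P j (u : khom P J) (v : khom J P) : Prop := Jdata {
  jd_u : ge J j \oc u = u;
  jd_v : v \oc ge J (j + 1) = v;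
  jd_vdu : v \oc gd J \oc u = \1;
  jd_uv : u \oc v \oc gd J + gd J \oc u \oc v = \1
}.

Definition gret X Y (f : khom X Y) := exists g, cmap g /\ f \oc g = \1.
Definition gsec X Y (f : khom X Y) := exists g, cmap g /\ g \oc f = \1.
Definition girr X Y (f : khom X Y) := forall W (h : khom W Y) (g : khom X W),
  cmap h -> cmap g -> f = h \oc g -> gsec g \/ gret h.

(** Let S be the resolution complex of P, with bottom term in degree j + 1,
    and h the map from S to J that corresponds to pr. Then h is not a
    retraction, and f factors through it. As f is irreducible, the first
    factor is a section g; as the endomorphisms of S are detected on P, the
    idempotent g t cannot be proper, and X is isomorphic to S. *)
Lemma irreducible_to_contractible (R : nat -> C)
    (d : forall l, khom (R l.+1) (R l)) n X J P j (u : khom P J) v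
    (f : khom X J) :
  min_res d -> R 0%N = P -> kid (R n.+2) = 0 -> jdata j u v ->
  kid X <> 0 -> cmap f -> ~ gret f -> girr f ->
  exists pr ij, @rescx _ _ X (gd X) (ge X (j + 1)) P pr ij.
Proof.
move=> dmin RP R0 [ju jv vdu uv] X0 [fdeg fd] nf irrf.
have locP : klocal P by rewrite -RP; case: dmin.
have [S [pr [ij rS]]] := rescx_exists (j + 1) dmin R0.
rewrite RP in pr ij rS.
pose h := u \oc pr \oc gd S + gd J \oc u \oc pr.
have hu i : ge J i \oc u = if i == j then u else 0 by exact: ge_ij.
have pre i : pr \oc ge S i = if i == j + 1 then pr else 0.
  exact/ge_pr/(rc_pe rS).
have ch : cmap h.
  split=> [i|]; last by rewrite /h !kcompE gdd !kcompE (kcr (gdd S)) !kcompE addrC.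
  rewrite addr0 /h !kcompE; congr (_ + _).
    rewrite -(kcompA _ (gd S)) gdeg kcompA -(kcompA u) pre (inj_eq (addIr 1)) hu.
    by case: eqP; rewrite ?kcompE.
  rewrite -(kcompA _ pr) pre; case: eqP => [->|/eqP ij1].
    by rewrite -gdeg (kcr ju).
  rewrite kcomp0r -[i](subrK 1) -gdeg (kcr (hu _)).
  rewrite ifF ?kcompE //; apply: contraNF ij1 => /eqP <-.
  by rewrite subrK.
have nh : ~ gret h.
  move=> [t [[_ td] ht]].
  apply: (@jrad_nonret _ _ P P (pr \oc gd S \oc t \oc u) \1 locP.1).
    exact/jrad_compr/jrad_compr/(rc_jrad rS).
  rewrite kcomp1r.
  have := congr1 (fun z => v \oc gd J \oc z \oc u) ht.
  rewrite /= kcomp1r vdu => <-; rewrite /h !kcompE (kcr (gdd J)) !kcompE addr0.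
  by rewrite vdu kcomp1l.
pose a := v \oc f.
have ae : a \oc ge X (j + 1) = a.
  by rewrite /a -kcompA fdeg addr0 kcompA jv.
have aeX : a \oc gd X \oc ge X j = a \oc gd X.
  by rewrite -kcompA gdeg kcompA ae.
have fE : f = u \oc a \oc gd X + gd J \oc u \oc a.
  by rewrite -[LHS]kcomp1l -uv kcompDl /a -!kcompA fd.
clearbody a; have ja : jrad (a \oc gd X).
  apply: nonret_jrad => // -[w adw]; apply: nf.
  (* A right inverse w of a d, taken in degree j, extends to a right inverse
     of f, because J is the contractible complex on P. *)
  pose w' := ge X j \oc w.
  have adw' : a \oc gd X \oc w' = \1 by rewrite /w' kcompA aeX.
  have we i : ge X i \oc w' = if i == j then w' else 0.
    by apply: ge_ij; rewrite /w' kcompA ge_idem.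
  have ve i : v \oc ge J i = if i == j + 1 then v else 0 by exact: ge_pr.
  clearbody w'; exists (gd X \oc w' \oc v + w' \oc v \oc gd J); split.
    split=> [i|]; last by rewrite !kcompE gdd (kcr (gdd J)) !kcompE addrC.
    rewrite addr0 !kcompE; congr (_ + _).
      rewrite -(kcompA _ v) ve; case: eqP => [->|/eqP ij1].
        by rewrite -gdeg (kcr (we _)) eqxx.
      rewrite kcomp0r -[i](subrK 1) -gdeg (kcr (we _)).
      rewrite ifF ?kcompE //; apply: contraNF ij1 => /eqP <-.
      by rewrite subrK.
    rewrite -(kcompA _ (gd J)) gdeg kcompA -(kcompA w') ve (inj_eq (addIr 1)) we.
    by case: eqP; rewrite ?kcompE.
  have aw' : a \oc w' = 0.
    rewrite -ae -kcompA we [j + 1 == j](_ : _ = false) ?kcomp0r //.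
    by rewrite -subr_eq0 addrAC subrr add0r oner_eq0.
  rewrite fE !kcompE (kcr (gdd X)) !(kcr3 adw') (kcr aw') !kcompE.
  by rewrite add0r addr0 uv.
have [g [cg pg]] := rescx_lift_cmap rS ae ja.
have [|[t [ct tg]]|//] := irrf S h g ch cg.
  rewrite {1}fE -pg /h !kcompE; congr (_ + _).
  by rewrite -(kcompA _ (gd S)) cg.2 !kcompA.
have gt1 : g \oc t = \1.
  have [_ deg_gt] := cmap_comp cg ct.
  have [l1 l2] := rc_loc rS deg_gt.
  have gtgt : g \oc t \oc (g \oc t) = g \oc t.
    by rewrite !kcompA (kcr tg) kcomp1r.
  have [/l1|/l2] := jrad_or_kiso (pr \oc (g \oc t) \oc ij) locP.
    move=> [z [_ z1]]; case: X0.
    have gt0 : g \oc t = 0.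
      have := congr1 (kcomp (g \oc t)) z1.
      by rewrite kcomp1r kcompBl kcomp1l kcompBr [_ \oc (_ \oc z)]kcompA gtgt subrr.
    have : t \oc (g \oc t) \oc g = \1 by rewrite !kcompA tg kcomp1l tg.
    by rewrite gt0 kcomp0r kcomp0l.
  move=> [z [z1 _]].
  by rewrite -[LHS]kcomp1l -z1 -kcompA gtgt.
exists (pr \oc g), (t \oc ij); apply: rescx_iso rS => //; first exact: ct.2.
by have := ct.1 (j + 1); rewrite addr0.
Qed.

End Lifting.

(** * Twisted sums *)

(** The extension of Y by X with class th. Conflations being split in each
    degree, all of them have this form. *)
Record twist (k : fieldType) (C : kcat k) (I : nzRingType) (X Y E : gcx C I)
    (th : khom Y X) (f : khom X E) (g : khom E Y) (p : khom E X)
    (s : khom Y E) : Prop := Twist {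
  tw_f : hdeg 0 f;
  tw_g : hdeg 0 g;
  tw_p : hdeg 0 p;
  tw_s : hdeg 0 s;
  tw_pf : p \oc f = \1;
  tw_gs : g \oc s = \1;
  tw_gf : g \oc f = 0;
  tw_ps : p \oc s = 0;
  tw_sum : f \oc p + s \oc g = \1;
  tw_df : gd E \oc f = f \oc gd X;
  tw_gd : g \oc gd E = gd Y \oc g;
  tw_ds : gd E \oc s = s \oc gd Y + f \oc th
}.

Section Twist.
Variables (k : fieldType) (C : kcat k) (I : nzRingType).
Implicit Types (X Y W E : gcx C I) (P : C).

Lemma ge_sum_sup X r : uniq r -> {subset gs X <= r} ->
  \sum_(i <- r) ge X i = \1.
Proof.
move=> ur sub; apply: ge_ext => i; rewrite kcomp1l kcomp_suml.
case: (boolP (i \in r)) => ir.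
  rewrite (bigD1_seq i) //= ge_idem big1 ?addr0 // => j ji.
  by rewrite ge_ort0.
have ig : ge X i = 0 by apply: ge_out; apply: contra ir; apply: sub.
by rewrite ig big1 // => j _; rewrite kcomp0r.
Qed.

Lemma twist_exists X Y (th : khom Y X) : hdeg 1 th ->
  gd X \oc th + th \oc gd Y = 0 -> exists E f g p s, @twist _ _ _ X Y E th f g p s.
Proof.
move=> thdeg thd.
have [Z [f [s [p [g [pf gs_ ps gf sum]]]]]] := kbip X Y.
pose e i : khom Z Z := f \oc ge X i \oc p + s \oc ge Y i \oc g.
pose D : khom Z Z := f \oc gd X \oc p + s \oc gd Y \oc g + f \oc th \oc g.
have ort i j : e i \oc e j = if i == j then e i else 0.
  rewrite /e !kcompE !(kcr pf) !(kcr gs_) !(kcr gf) !(kcr ps) !kcompE.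
  rewrite (kcr (ge_ort X i j)) (kcr (ge_ort Y i j)) addr0 add0r.
  by case: eqP => _; rewrite ?kcompE ?addr0.
pose r := undup (gs X ++ gs Y).
have E1 : \sum_(i <- r) e i = \1.
  rewrite big_split -!kcomp_suml -!kcomp_sumr.
  rewrite !ge_sum_sup ?undup_uniq // ?kcomp1r //.
  - by move=> i iY; rewrite mem_undup mem_cat iY orbT.
  - by move=> i iY; rewrite mem_undup mem_cat iY.
have deg i : D \oc e i = e (i + 1) \oc D.
  rewrite /D /e !kcompE !(kcr pf) !(kcr gs_) !(kcr gf) !(kcr ps) !kcompE.
  rewrite !addr0 !add0r (kcr (gdeg X i)) (kcr (gdeg Y i)) (kcr (thdeg i)).
  by rewrite !kcompA; zmod.
have dd : D \oc D = 0.
  rewrite /D !kcompE !(kcr pf) !(kcr gs_) !(kcr gf) !(kcr ps) !kcompE.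
  rewrite (kcr (gdd X)) (kcr (gdd Y)) !kcompE !addr0 !add0r.
  by have := congr1 (fun z => f \oc z \oc g) thd; rewrite /= !kcompE.
exists (Gcx (undup_uniq _) ort E1 deg dd), f, g, p, s; split=> //=.
- by move=> i; rewrite addr0 /e kcompDl (kcr pf) (kcr gf) !kcompE addr0.
- move=> i; rewrite addr0 /= /e kcompDr !kcompA gf gs_ !kcompE.
  by rewrite add0r.
- move=> i; rewrite addr0 /= /e kcompDr !kcompA pf ps !kcompE.
  by rewrite addr0.
- by move=> i; rewrite addr0 /e kcompDl (kcr gs_) (kcr ps) !kcompE add0r.
- by rewrite /D !kcompDl (kcr pf) !(kcr gf) !kcompE !addr0.
- by rewrite /D !kcompDr !kcompA gf gs_ !kcompE add0r addr0.
- by rewrite /D !kcompDl (kcr ps) !(kcr gs_) !kcompE add0r.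
Qed.

(** The component p t of a splitting t is a homotopy from th to zero. *)
Lemma twist_split X Y E (th : khom Y X) f g p s (t : khom Y E) :
  @twist _ _ _ X Y E th f g p s -> gd E \oc t = t \oc gd Y -> g \oc t = \1 ->
  th = p \oc t \oc gd Y - gd X \oc (p \oc t).
Proof.
case=> fdg gdg pdg sdg pf gs_ gf ps sum df dg ds td gt.
have pd : p \oc gd E = gd X \oc p + th \oc g.
  rewrite -[LHS]kcomp1r -sum kcompDr !kcompA -!(kcompA p) df ds !kcompE.
  by rewrite pf ps !kcompE add0r.
by rewrite -kcompA -td kcompA pd kcompDl -!kcompA gt kcomp1r; zmod.
Qed.

(** Right almost split and right minimal, among chain maps of graded
    complexes. *)
Definition right_ar E Y (g : khom E Y) :=
  [/\ ~ gret g,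
      forall W (h : khom W Y), cmap h ->
        gret h \/ exists h' : khom W E, cmap h' /\ g \oc h' = h &
      forall u : khom E E, cmap u -> g \oc u = g ->
        exists u', [/\ cmap u', u' \oc u = \1 & u \oc u' = \1]].

Definition left_ar X E (f : khom X E) :=
  [/\ ~ gsec f,
      forall W (h : khom X W), cmap h ->
        gsec h \/ exists h' : khom E W, cmap h' /\ h' \oc f = h &
      forall u : khom E E, cmap u -> u \oc f = f ->
        exists u', [/\ cmap u', u' \oc u = \1 & u \oc u' = \1]].

End Twist.

Section TwistOp.
Variables (k : fieldType) (C : kcat k) (I : nzRingType).
Implicit Types (X Y W E : gcx C I) (P : C).

Lemma hdeg0_op X Y (f : khom X Y) :
  hdeg 0 f -> @hdeg _ (kop C) I (opx Y) (opx X) 0 f.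
Proof. by move=> h i; have := h (- i); rewrite /= !addr0 => ->. Qed.

Lemma twist_op X Y E (th : khom Y X) f g p s : @twist _ _ _ X Y E th f g p s ->
  @twist _ (kop C) I (opx Y) (opx X) (opx E) th g f s p.
Proof.
case=> fdg gdg pdg sdg pf gs_ gf ps sum df dg ds.
split=> //=; try exact: hdeg0_op.
- by rewrite addrC.
have -> : p \oc gd E = p \oc gd E \oc (f \oc p + s \oc g).
  by rewrite sum kcomp1r.
rewrite kcompDr !kcompA -!(kcompA p) df ds !kcompE pf ps !kcompE.
by rewrite add0r.
Qed.

Lemma left_ar_unop X E (f : khom X E) :
  @right_ar _ (kop C) I (opx E) (opx X) f -> left_ar f.
Proof.
case=> h1 h2 h3; split.
- by move=> [g [cg gf]]; apply: h1; exists g; split=> //; apply/cmap_op.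
- move=> W h /cmap_op ch; case: (h2 (opx W) h ch).
    by move=> [t [/cmap_op ct th]]; left; exists t.
  by move=> [t [/cmap_op ct th]]; right; exists t.
- move=> u /cmap_op cu uf; have [u' [/cmap_op cu' e1 e2]] := h3 u cu uf.
  by exists u'.
Qed.
End TwistOp.

(** * Almost split sequences *)

Section AR.
Variables (k : fieldType) (C : kcat k) (I : nzRingType).
Implicit Types (X Y W E : gcx C I).
Variable P : C.
Hypothesis locP : klocal P.

Lemma corescx_lift_cmap Y W j (pr : khom Y P) ij (b : khom P W) :
  corescx (gd Y) (ge Y j) pr ij -> ge W j \oc b = b -> jrad (gd W \oc b) ->
  exists f : khom Y W, cmap f /\ f \oc ij = b.
Proof.
move=> cY eb jb.
have := @rescx_lift_cmap _ (kop C) I (opx Y) (opx W) (- j) P ij pr b.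
rewrite /= !opprK => h; have [||f [/cmap_op cf fE]] := h (corescx_op cY).
- exact: eb.
- exact/jrad_op.
by exists f.
Qed.

Variables (X Y : gcx C I) (j : I) (prX : khom X P) (ijX : khom P X)
  (prY : khom Y P) (ijY : khom P Y).
Hypothesis rX : rescx (gd X) (ge X (j + 1)) prX ijX.
Hypothesis cY : corescx (gd Y) (ge Y j) prY ijY.

(** If a = pr h is radical modulo maps that factor through the differential
    of W, then theta h is null homotopic by [rescx_null]. Otherwise
    [jrad_factor_or_dual] gives b with a b = 1; it extends to a chain map f
    from Y to W, and h f is invertible since its component on P is the
    identity. *)
Lemma serre_pairing W (h : khom W Y) : cmap h -> gret h \/
  exists y : khom W X,
    hdeg 0 y /\ ijX \oc prY \oc h = y \oc gd W - gd X \oc y.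
Proof.
move=> [hdg hd]; pose a := prY \oc h.
have ae : a \oc ge W j = a.
  by rewrite /a -kcompA hdg addr0 kcompA (cc_pe cY).
have ad : a \oc gd W = 0.
  by rewrite /a -kcompA -hd kcompA (cc_D cY) kcomp0l.
have [[r [b [jr aE]]]|[b [jb ab]]] := jrad_factor_or_dual (gd W) a locP.
  have [y [y0 yE]] := rescx_null rX ae ad jr aE.
  by right; exists y; rewrite -kcompA yE.
left; pose b' := ge W j \oc b.
have [||f [cf fE]] := @corescx_lift_cmap Y W j _ _ b' cY.
- by rewrite /b' kcompA ge_idem.
- by rewrite /b' kcompA gdeg -kcompA; apply: jrad_compl.
have chf : cmap (h \oc f) by apply: cmap_comp.
have [|u [cu u1 u2]] := cmap_isoP chf.
  apply: (cc_loc cY chf.2).2; rewrite -!kcompA fE /b' !kcompA -/a ae ab.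
  exact: kiso1.
by exists (f \oc u); split; [exact: cmap_comp|rewrite kcompA].
Qed.

(** On P, theta is the identity, whereas null-homotopic maps are radical
    there. *)
Lemma nonsplit y : ijX \oc prY <> y \oc gd Y - gd X \oc y.
Proof.
move=> E; have := congr1 (fun z => prX \oc z \oc ijY) E.
rewrite /= !kcompA (rc_pi rX) kcomp1l (cc_pi cY) kcompBr kcompBl => E1.
have : jrad (kid P).
  rewrite E1; apply: jradD.
    by rewrite -!kcompA; do 2!apply: jrad_compl; apply: (cc_jrad cY).
  by apply/jradN; rewrite !kcompA; do 2!apply: jrad_compr; apply: (rc_jrad rX).
by move/(jrad_nonret (v := \1) locP.1); rewrite kcomp1r.
Qed.

(** For minimality: an endomorphism u of E with g u = g restricts to an
    endomorphism v of X. If v is not invertible then 1 - v is, and (1 - v)^-1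
    p (1 - u) is a retraction for f, which contradicts [nonsplit]. *)
Lemma twist_right_ar E f g p s : @twist _ _ _ X Y E (ijX \oc prY) f g p s ->
  right_ar g.
Proof.
move=> tw; case: (tw) => fdg gdg pdg sdg pf gs_ gf ps sum df dg ds.
have nsec (t : khom E X) : gd X \oc t = t \oc gd E -> t \oc f <> \1.
  move=> td tf; apply: (@nonsplit (- (t \oc s))).
  rewrite kcompNl kcompNr opprK addrC kcompA td -!kcompA ds kcompDr !kcompA tf.
  by rewrite kcomp1l addrAC subrr add0r.
split.
- move=> [t [[_ td] gt]]; apply: (@nonsplit (p \oc t)).
  exact: twist_split tw td gt.
- move=> W h ch; case: (serre_pairing ch); first by left.
  move=> [y [ydg yE]]; right; exists (s \oc h + f \oc y); split; last first.
    by rewrite kcompDr !kcompA gs_ gf kcomp1l kcomp0l addr0.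
  split=> [i|].
    rewrite addr0 kcompDl kcompDr -!kcompA ch.1 ydg !addr0 !kcompA.
    by have := sdg i; have := fdg i; rewrite addr0 => -> ->.
  rewrite !kcompDr !kcompDl !kcompA df ds kcompDl -!kcompA ch.2.
  rewrite (kcompA ijX) yE !kcompBr; zmod.
- move=> u cu gu.
  pose v := p \oc u \oc f.
  have ufv : u \oc f = f \oc v.
    rewrite -[LHS]kcomp1l -sum kcompDl -[s \oc g \oc _]kcompA (kcompA g) gu gf.
    by rewrite kcomp0r addr0 /v !kcompA.
  clearbody v; have vd : gd X \oc v = v \oc gd X.
    have : f \oc (gd X \oc v) = f \oc (v \oc gd X).
      rewrite kcompA -df -kcompA -ufv kcompA cu.2 -kcompA df !kcompA.
      by rewrite ufv.
    by move=> /(congr1 (kcomp p)); rewrite !kcompA pf !kcomp1l.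
  have [l1 l2] := rc_loc rX vd.
  have [/l1 iv|/l2 [v' [v'v vv']]] := jrad_or_kiso (prX \oc v \oc ijX) locP.
    pose w := p \oc (\1 - u).
    have fw : f \oc w = \1 - u.
      rewrite /w kcompA; have -> : f \oc p = \1 - s \oc g.
        by rewrite -sum addrK.
      by rewrite !kcompE -[s \oc g \oc u]kcompA gu; zmod.
    have wf : w \oc f = \1 - v.
      by rewrite /w !kcompE pf -kcompA ufv kcompA pf kcomp1l.
    clearbody w; have wd : gd X \oc w = w \oc gd E.
      have : f \oc (gd X \oc w) = f \oc (w \oc gd E).
        by rewrite !kcompA fw -df -kcompA fw !kcompE cu.2.
      move=> /(congr1 (kcomp p)); rewrite !kcompA pf !kcomp1l.
      by [].
    have [z [z1 z2]] := iv.
    case: (nsec (z \oc w)); last by rewrite -kcompA wf.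
    have zd : gd X \oc z = z \oc gd X.
      rewrite -[RHS]kcomp1r -z2 !kcompA -(kcompA z).
      have -> : gd X \oc (\1 - v) = (\1 - v) \oc gd X by rewrite !kcompE vd.
      by rewrite !kcompA z1 kcomp1l.
    by rewrite kcompA zd -!kcompA wd.
  apply: cmap_isoP cu _.
  pose w := p \oc u \oc s.
  have us : u \oc s = s + f \oc w.
    rewrite -[LHS]kcomp1l -sum kcompDl -!kcompA (kcompA g) gu gs_ kcomp1r addrC.
    by rewrite /w !kcompA.
  have uE : u = f \oc v \oc p + (s + f \oc w) \oc g.
    by rewrite -us -ufv -!kcompA -kcompDr sum kcomp1r.
  clearbody w; exists (f \oc v' \oc p + (s - f \oc v' \oc w) \oc g).
  rewrite uE; split; rewrite !kcompE !(kcr pf) !(kcr gs_) !(kcr gf) !(kcr ps)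
    !kcompE.
    by rewrite !(kcr v'v) !kcompE -[RHS]sum; zmod.
  by rewrite !(kcr vv') !kcompE -[RHS]sum; zmod.
Qed.

End AR.

(** The map theta = ijX prY has degree 1 because P sits in degree j in Y and
    in degree j + 1 in X. The statement for f is the one for g in the
    opposite category. *)
Theorem ar_sequence (k : fieldType) (C : kcat k) (I : nzRingType) (P : C)
    (X Y : gcx C I) (j : I) (prX : khom X P) (ijX : khom P X)
    (prY : khom Y P) (ijY : khom P Y) : klocal P ->
  rescx (gd X) (ge X (j + 1)) prX ijX -> corescx (gd Y) (ge Y j) prY ijY ->
  exists E f g p s, @twist _ _ _ X Y E (ijX \oc prY) f g p s /\
    left_ar f /\ right_ar g.
Proof.
move=> locP rX cY; have [||E [f [g [p [s tw]]]]] :=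
  @twist_exists _ _ _ X Y (ijX \oc prY).
- move=> i; rewrite -kcompA (ge_pr i (cc_pe cY)) kcompA (ge_ij _ (rc_ei rX)).
  by rewrite (inj_eq (addIr 1)); case: eqP; rewrite ?kcomp0r ?kcomp0l.
- by rewrite kcompA (rc_D rX) -kcompA (cc_D cY) kcomp0l kcomp0r addr0.
exists E, f, g, p, s; split=> //; split; last exact: (twist_right_ar locP rX cY tw).
apply: left_ar_unop.
apply: (@twist_right_ar _ (kop C) I P locP (opx Y) (opx X) (- (j + 1))
  ijY prY ijX prX _ _ (opx E) g f s p _).
- by rewrite /= opprD opprK addrK; apply: corescx_op.
- by rewrite /= opprK; apply: rescx_op.
- exact: twist_op tw.
Qed.

(** * The category of finitely generated projective modules *)

Definition mklin (A : pzRingType) (U V : lmodType A) (f : U -> V)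
    (h : linear f) : {linear U -> V} :=
  HB.pack f (GRing.isLinear.Build A U V _ f h).

(** The compatibility proofs bundled in a linear map are irrelevant. *)
Lemma linear_ext (A : pzRingType) (U V : lmodType A) (f g : {linear U -> V}) :
  f =1 g -> f = g.
Proof.
case: f g => [f [[f1] [f2]]] [g [[g1] [g2]]] /= fg.
have {}fg : f = g by apply: funext.
case: _ / fg g1 g2 => g1 g2.
by rewrite (Prop_irrelevance g1 f1) (Prop_irrelevance g2 f2).
Qed.

Section Plin.
Variables (k : fieldType) (A : falgType k).
Implicit Types U V W : lmodType A.

(** A name for the linear maps between two modules, on which the vector space
    structure over k is declared: a scalar acts through its image in A, which
    is central. *)
Definition plin U V : Type := {linear U -> V}.
Identity Coercion plin_linear : plin >-> GRing.Linear.type.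

Lemma plin_app U V (f g : plin U V) x : f = g -> f x = g x.
Proof. by move=> ->. Qed.

HB.instance Definition _ U V := gen_eqMixin (plin U V).
HB.instance Definition _ U V := gen_choiceMixin (plin U V).

Section Ops.
Variables U V : lmodType A.
Implicit Types f g : plin U V.

Definition plin_zero : plin U V := (\0 : {linear U -> V}).
Definition plin_opp f : plin U V := (\- f : {linear U -> V}).
Definition plin_add f g : plin U V := (f \+ g : {linear U -> V}).

Fact plin_addA : associative plin_add.
Proof. by move=> f g h; apply: linear_ext => x; apply: addrA. Qed.
Fact plin_addC : commutative plin_add.
Proof. by move=> f g; apply: linear_ext => x; apply: addrC. Qed.
Fact plin_add0 : left_id plin_zero plin_add.
Proof. by move=> f; apply: linear_ext => x; apply: add0r. Qed.
Fact plin_addN : left_inverse plin_zero plin_opp plin_add.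
Proof. by move=> f; apply: linear_ext => x; apply: addNr. Qed.

HB.instance Definition _ := GRing.isZmodule.Build (plin U V)
  plin_addA plin_addC plin_add0 plin_addN.

Fact plin_scale_linear (c : k) f : linear (fun x => c%:A *: f x).
Proof.
move=> a x y; rewrite linearP scalerDr !scalerA.
by rewrite mulr_algl mulr_algr.
Qed.

Definition plin_scale (c : k) f : plin U V := mklin (plin_scale_linear c f).

Fact plin_scaleA a b f : plin_scale a (plin_scale b f) = plin_scale (a * b) f.
Proof.
by apply: linear_ext => x; rewrite /= scalerA mulr_algl scalerA.
Qed.
Fact plin_scale1 : left_id 1 plin_scale.
Proof. by move=> f; apply: linear_ext => x; rewrite /= !scale1r. Qed.
Fact plin_scaleDr : right_distributive plin_scale +%R.
Proof. by move=> c f g; apply: linear_ext => x; rewrite /= scalerDr. Qed.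
Fact plin_scaleDl f : {morph plin_scale^~ f : a b / a + b}.
Proof. by move=> a b; apply: linear_ext => x; rewrite /= !scalerDl. Qed.

HB.instance Definition _ := GRing.Zmodule_isLmodule.Build k (plin U V)
  plin_scaleA plin_scale1 plin_scaleDr plin_scaleDl.

Lemma plinDE f g x : (f + g : plin U V) x = f x + g x. Proof. by []. Qed.
Lemma plinZE c f x : (c *: f : plin U V) x = c%:A *: f x. Proof. by []. Qed.
Lemma plin_sumE J (r : seq J) (p : pred J) (F : J -> plin U V) x :
  (\sum_(i <- r | p i) F i : plin U V) x = \sum_(i <- r | p i) F i x.
Proof. by apply: (big_morph (fun f : plin U V => f x)). Qed.
End Ops.

Definition plin_comp U V W (g : plin V W) (f : plin U V) : plin U W :=
  (g \o f : {linear U -> W}).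
Definition plin_id U : plin U U := (idfun : {linear U -> U}).

(** ** Retracts *)

Section Fixed.
Variables (X : lmodType A) (e : plin X X).

Definition fixpred : {pred X} := fun x => e x == x.
Fact fixpred_closed : submod_closed fixpred.
Proof.
split=> [|a x y]; rewrite !unfold_in ?linear0 //.
by move=> /eqP ex /eqP ey; rewrite linearP ex ey.
Qed.
HB.instance Definition _ := GRing.isSubmodClosed.Build A X fixpred fixpred_closed.

Record fixsub : predArgType := Fixsub { fixval : X; _ : fixval \in fixpred }.
HB.instance Definition _ := [isSub of fixsub for fixval].
HB.instance Definition _ := [Choice of fixsub by <:].
HB.instance Definition _ := [SubChoice_isSubZmodule of fixsub by <:].
HB.instance Definition _ := [SubZmodule_isSubLmodule of fixsub by <:].

Fact fixval_linear : linear fixval. Proof. by []. Qed.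
Definition fixincl : plin fixsub X := mklin fixval_linear.

Hypothesis ee : plin_comp e e = e.
Fact fix_mem x : e x \in fixpred.
Proof. by rewrite unfold_in -[in X in _ == X]ee. Qed.
Definition fixproj_fun x := Fixsub (fix_mem x).
Fact fixproj_linear : linear fixproj_fun.
Proof. by move=> a x y; apply: val_inj; rewrite /= linearP. Qed.
Definition fixproj : plin X fixsub := mklin fixproj_linear.

Lemma fixprojK : plin_comp fixproj fixincl = plin_id fixsub.
Proof.
apply: linear_ext => x; apply: val_inj => /=.
by have := valP x; rewrite unfold_in => /eqP.
Qed.
Lemma fixinclK : plin_comp fixincl fixproj = e.
Proof. by apply: linear_ext => x. Qed.
End Fixed.

Lemma fin_gen_surj U V (f : plin U V) :
  (forall y, exists x, f x = y) -> fin_gen U -> fin_gen V.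
Proof.
move=> fsurj [s sP]; exists [seq f x | x <- s] => y.
have [x <-] := fsurj y; have [c ->] := sP x; exists c.
rewrite size_map linear_sum; apply: eq_bigr => i _.
by rewrite linearZ (nth_map 0).
Qed.

Lemma retract_projmod (X : projmod A) U (s : plin U X) (t : plin X U) :
  plin_comp t s = plin_id U -> fin_gen U /\ projective_module U.
Proof.
move=> ts; have tsx x : t (s x) = x by exact: (plin_app x ts).
split; first by apply: fin_gen_surj (projmod_fin_gen X) => y; exists (s y).
move=> M N g f gsurj.
have [h hP] := projmod_projective (f \o t : {linear X -> N}) gsurj.
by exists (h \o s : {linear U -> M}) => x; rewrite /= hP /= tsx.
Qed.

Lemma pair_projmod (X Y : projmod A) :
  fin_gen (X * Y)%type /\ projective_module (X * Y)%type.
Proof.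
split.
  have [s sP] := projmod_fin_gen X; have [t tP] := projmod_fin_gen Y.
  exists ([seq (x, 0) | x <- s] ++ [seq (0, y) | y <- t]) => -[x y].
  have [c cE] := sP x; have [d dE] := tP y.
  exists (fun i => if (i < size s)%N then c i else d (i - size s)%N).
  rewrite size_cat !size_map big_split_ord /=.
  under eq_bigr => i _ do
    rewrite nth_cat size_map ltn_ord (nth_map 0) ?ltn_ord //.
  under [X in _ + X]eq_bigr => i _ do
    rewrite nth_cat size_map ltnNge leq_addr /= addKn (nth_map 0) ?ltn_ord //.
  have -> : (x, y) = (x, 0) + (0, y) by congr pair; rewrite /= ?addr0 ?add0r.
  congr (_ + _).
    rewrite cE (big_morph (fun z => (z, 0)) (id1 := 0) (op1 := +%R)) //.
      by apply: eq_bigr => i _; congr pair; rewrite /= scaler0.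
    by move=> a b; congr pair; rewrite /= addr0.
  rewrite dE (big_morph (fun z => (0, z)) (id1 := 0) (op1 := +%R)) //.
    by apply: eq_bigr => i _; congr pair; rewrite /= scaler0.
  by move=> a b; congr pair; rewrite /= addr0.
move=> M N g f gsurj.
have fl : linear (fun x : X => f (x, 0 : Y)).
  move=> a x x'; rewrite -linearP; congr (f _).
  by congr pair; rewrite /= scaler0 addr0.
have fr : linear (fun y : Y => f (0 : X, y)).
  move=> a y y'; rewrite -linearP; congr (f _).
  by congr pair; rewrite /= scaler0 addr0.
have [h hP] := projmod_projective (mklin fl) gsurj.
have [h' hP'] := projmod_projective (mklin fr) gsurj.
have hl : linear (fun z : X * Y => h z.1 + h' z.2).
  move=> a z z'; rewrite /= !linearP scalerDr -!addrA; congr (_ + _).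
  by rewrite addrCA.
exists (mklin hl) => -[x y] /=; rewrite linearD hP hP' /= -linearD.
by congr (f _); congr pair; rewrite /= ?addr0 ?add0r.
Qed.

Lemma regular_projmod : fin_gen (A^o : lmodType A) /\
  projective_module (A^o : lmodType A).
Proof.
split.
  exists [:: 1] => x; exists (fun=> x); rewrite big_ord1 /=.
  by rewrite [_ *: _]mulr1.
move=> M N g f gsurj; have [m mE] := gsurj (f 1).
have hl : linear (fun x : A^o => (x : A) *: m).
  by move=> a x y; rewrite scalerDl scalerA.
exists (mklin hl) => x /=; rewrite linearZ mE -linearZ.
by congr (f _); rewrite [_ *: _]mulr1.
Qed.

Definition regmod : projmod A := Projmod regular_projmod.1 regular_projmod.2.

Lemma projmod_coords (X : projmod A) : exists n (s : 'I_n -> plin X regmod)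
  (t : 'I_n -> plin regmod X), \sum_i plin_comp (t i) (s i) = plin_id X.
Proof.
have [w wP] := projmod_fin_gen X.
have gl : linear (fun v : 'rV[A]_(size w) => \sum_i v 0 i *: w`_i).
  move=> a u v; rewrite scaler_sumr -big_split; apply: eq_bigr => i _.
  by rewrite !mxE scalerDl scalerA.
have gsurj : forall x : X, exists v, mklin gl v = x.
  move=> x; have [c ->] := wP x; exists (\row_i c i) => /=.
  by apply: eq_bigr => i _; rewrite mxE.
have [h hP] := projmod_projective (idfun : {linear X -> X}) gsurj.
have cl i : linear (fun x : X => h x 0 i : A^o).
  by move=> a x y; rewrite linearP !mxE.
have tl i : linear (fun a : A^o => (a : A) *: w`_i).
  by move=> a x y; rewrite scalerDl scalerA.
exists (size w), (fun i => mklin (cl i)), (fun i : 'I_(size w) => mklin (tl i)).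
by apply: linear_ext => x; rewrite plin_sumE; exact: (hP x).
Qed.

Lemma dim_le_inj (V : lmodType k) (W : vectType k) (phi : {linear V -> W}) :
  injective phi -> exists N, dim_le (fun _ : V => True) N.
Proof.
move=> phi_inj; exists (\dim {:W}) => v _.
pose X := [tuple phi (v i) | i < (\dim {:W}).+1].
have /freeP nX : ~~ free X.
  apply: contraTN (dimvS (subvf <<X>>)); rewrite /free => /eqP ->.
  by rewrite size_tuple ltnn.
have /existsNP [c /not_implyP [cE /existsNP [i ci]]] :
  ~ forall c : 'I_(\dim {:W}).+1 -> k,
    \sum_i c i *: X`_i = 0 -> forall i, c i = 0 by exact: nX.
exists c; split; first by exists i; apply/eqP.
apply: phi_inj; rewrite linear0 linear_sum -[RHS]cE; apply: eq_bigr => l _.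
by rewrite linearZ -tnth_nth tnth_mktuple.
Qed.

(** A linear map is determined by its matrix over A with respect to
    generators of X and coordinates of Y. *)
Lemma plin_fd (X Y : projmod A) : exists N, dim_le (fun _ : plin X Y => True) N.
Proof.
have [n [s [t ts]]] := projmod_coords X.
have [n' [s' [t' ts']]] := projmod_coords Y.
pose W : vectType k := {ffun 'I_n * 'I_n' -> A}.
pose phi (f : plin X Y) : W :=
  [ffun p : 'I_n * 'I_n' => (s' p.2 (f (t p.1 (1 : A)))) : A].
have phil : linear phi.
  move=> c f g; apply/ffunP => p; rewrite !ffunE plinDE plinZE.
  rewrite linearD linearZ /= [RHS](_ : _ = c *: (s' p.2 (f (t p.1 (1 : A))) : A)
    + (s' p.2 (g (t p.1 (1 : A))) : A)).
    by congr (_ + _); rewrite [_ *: _]mulr_algl.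
  by [].
have xE x : x = \sum_i t i (s i x).
  by rewrite -[LHS]/(plin_id X x) -(plin_app x ts) plin_sumE.
have yE y : y = \sum_i t' i (s' i y).
  by rewrite -[LHS]/(plin_id Y y) -(plin_app y ts') plin_sumE.
apply: (@dim_le_inj (plin X Y) W (mklin phil)) => f g /= fg.
apply: linear_ext => x; rewrite (xE x) !linear_sum.
apply: eq_bigr => i _.
have -> : s i x = (s i x : A) *: (1 : A^o) by rewrite [RHS]mulr1.
rewrite !linearZ; congr (_ *: _).
rewrite [LHS]yE [RHS]yE; apply: eq_bigr => j _; congr (t' j _).
by have /ffunP /(_ (i, j)) := fg; rewrite !ffunE.
Qed.

Definition projcat : kcat k.
Proof.
refine (@KCat k (projmod A) (fun X Y => plin X Y) (fun X => plin_id X)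
  (fun X Y Z g f => plin_comp g f) _ _ _ _ _ _ _ _ _ _ regmod _).
- by move=> *; apply: linear_ext.
- by move=> *; apply: linear_ext.
- by move=> *; apply: linear_ext.
- by move=> *; apply: linear_ext.
- by move=> X Y Z g f f'; apply: linear_ext => x; rewrite /= linearD.
- by move=> *; apply: linear_ext.
- by move=> X Y Z c g f; apply: linear_ext => x; apply: linearZ.
- exact: plin_fd.
- move=> X Y; exists (Projmod (pair_projmod X Y).1 (pair_projmod X Y).2).
  have l1 : linear (fun x : X => (x, 0 : Y)).
    by move=> a x x'; congr pair; rewrite /= scaler0 addr0.
  have l2 : linear (fun y : Y => (0 : X, y)).
    by move=> a x x'; congr pair; rewrite /= scaler0 addr0.
  have p1 : linear (fun z : X * Y => z.1) by [].
  have p2 : linear (fun z : X * Y => z.2) by [].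
  exists (mklin l1), (mklin l2), (mklin p1), (mklin p2).
  split; apply: linear_ext => // -[x y].
  by congr pair; rewrite /= ?addr0 ?add0r.
- move=> X e ee; have ts := fixprojK ee; have st := fixinclK ee.
  have [h1 h2] := retract_projmod ts.
  by exists (Projmod h1 h2), (fixincl e), (fixproj ee).
- exact: projmod_coords.
Defined.
End Plin.
Arguments projcat {k} A.

(** * Complexes of modules as graded complexes *)

(* In the category of modules, simplification would replace composites by their
   definition. *)
Arguments kcomp : simpl never.
Arguments khom : simpl never.
Arguments kid : simpl never.
Arguments kob : simpl never.

Section Realization.
Variables (k : fieldType) (A : falgType k) (I : nzRingType).
Notation C := (projcat A).
Implicit Types X Y Z W : complex I A.
Implicit Types T U V : gcx C I.

Lemma khomP (M N : C) (f g : khom M N) :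
  (forall x : (M : projmod A), (f : plin _ _) x = (g : plin _ _) x) -> f = g.
Proof. exact: linear_ext. Qed.

Lemma khom_app (M N : C) (f g : khom M N) (x : (M : projmod A)) :
  f = g -> (f : plin _ _) x = (g : plin _ _) x.
Proof. by move=> ->. Qed.

Definition cxd X i : khom (X i : C) (X (i + 1) : C) := cx_d X i.
Definition cmk X Y (f : chain_map X Y) i : khom (X i : C) (Y i : C) :=
  cm_fun f i.

(** A total object for the complex X: the sum of the X^i over all degrees,
    with its inclusions and projections. *)
Record real X : Type := Real {
  rT : gcx C I;
  rs : forall i, khom (X i : C) rT;
  rt : forall i, khom rT (X i : C);
  rts : forall i, rt i \oc rs i = \1;
  rst : forall i, rs i \oc rt i = ge rT i;
  rds : forall i, gd rT \oc rs i = rs (i + 1) \oc cxd X i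
}.
Arguments rs {X} r i.
Arguments rt {X} r i.

Lemma rge X (r : real X) i j : ge (rT r) i \oc rs r j = if i == j then rs r j else 0.
Proof.
have E : rs r j = ge (rT r) j \oc rs r j.
  by rewrite -rst -kcompA rts kcomp1r.
by rewrite E kcompA ge_ort; case: eqP => [->|_]; rewrite ?kcomp0l.
Qed.

Lemma rtg X (r : real X) i j : rt r j \oc ge (rT r) i = if j == i then rt r j else 0.
Proof.
have E : rt r j = rt r j \oc ge (rT r) j by rewrite -rst kcompA rts kcomp1l.
by rewrite E -kcompA ge_ort; case: eqP => [->|_]; rewrite ?kcomp0r.
Qed.

Lemma rs_out X (r : real X) i : i \notin gs (rT r) -> rs r i = 0.
Proof.
by move=> /ge_out e0; have := rge r i i; rewrite eqxx e0 kcomp0l.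
Qed.

Lemma rtd X (r : real X) i : rt r (i + 1) \oc gd (rT r) = cxd X i \oc rt r i.
Proof.
have -> : rt r (i + 1) \oc gd (rT r) = rt r (i + 1) \oc ge _ (i + 1) \oc gd (rT r).
  by rewrite rtg eqxx.
by rewrite -kcompA -gdeg -rst !kcompA -(kcompA _ _ (rs r i)) rds kcompA rts kcomp1l.
Qed.

Lemma rs_ext X (r : real X) (M : C) (f g : khom (rT r) M) :
  (forall i, f \oc rs r i = g \oc rs r i) -> f = g.
Proof. by move=> h; apply: ge_ext => i; rewrite -rst !kcompA h. Qed.

Lemma rs_inj X (r : real X) (M : C) i (f g : khom M (X i : C)) :
  rs r i \oc f = rs r i \oc g -> f = g.
Proof. by move=> /(congr1 (kcomp (rt r i))); rewrite !kcompA rts !kcomp1l. Qed.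

Lemma real_of_complex X (r : seq I) : uniq r -> (forall i, i \in r) ->
  inhabited (real X).
Proof.
move=> ur ar; have [T [s [t [h1 h2 h3 _]]]] := kbigsum (fun i => X i : C) ur.
have {}h1 i : t i \oc s i = \1 by apply: h1.
have ort i j : s i \oc t i \oc (s j \oc t j) = if i == j then s i \oc t i else 0.
  rewrite !kcompA; case: eqP => [<-|/eqP ij]; first by rewrite (kcr (h1 i)) kcomp1r.
  by rewrite (kcr (h2 _ _ ij)) kcomp0r kcomp0l.
pose D : khom T T := \sum_(i <- r) s (i + 1) \oc cxd X i \oc t i.
have Ds i : D \oc s i = s (i + 1) \oc cxd X i.
  rewrite kcomp_suml (bigD1_seq i) //= (kcr (h1 i)) kcomp1r big1 ?addr0 // => j ji.
  by rewrite (kcr (h2 _ _ ji)) kcomp0r.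
have ext (M : C) (f g : khom T M) : (forall i, f \oc s i = g \oc s i) -> f = g.
  move=> h; rewrite -[f]kcomp1r -[g]kcomp1r -h3 !kcomp_sumr.
  by apply: eq_bigr => i _; rewrite !kcompA h.
have deg i : D \oc (s i \oc t i) = s (i + 1) \oc t (i + 1) \oc D.
  apply: ext => j; rewrite -!(kcompA _ D) Ds !kcompA Ds.
  case: (eqVneq i j) => [<-|ij]; first by rewrite (kcr (h1 _)) (kcr (h1 _)) !kcomp1r.
  rewrite (kcr (h2 _ _ ij)) (kcr (h2 _ _ _)) ?kcomp0r ?kcomp0l //.
  by rewrite (inj_eq (addIr 1)).
have dd : D \oc D = 0.
  apply: ext => i; rewrite -kcompA Ds kcompA Ds -kcompA kcomp0l.
  have -> : cxd X (i + 1) \oc cxd X i = 0 by apply: khomP => x; apply: cx_dd.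
  by rewrite kcomp0r.
by split; apply: (@Real X (Gcx ur ort h3 deg dd) s t).
Qed.

Lemma complex_of_gcx T : exists (X : complex I A) (r : real X), rT r = T.
Proof.
have sp i : {M : projmod A & {s : khom (M : C) T & {t : khom T (M : C) |
    t \oc s = \1 /\ s \oc t = ge T i}}}.
  have /cid [M /cid [s /cid [t h]]] := ksplit (ge_idem T i).
  by exists M, s, t.
pose M i := projT1 (sp i).
pose s i : khom (M i : C) T := projT1 (projT2 (sp i)).
pose t i : khom T (M i : C) := sval (projT2 (projT2 (sp i))).
have ts i : t i \oc s i = \1 by exact: (svalP (projT2 (projT2 (sp i)))).1.
have st i : s i \oc t i = ge T i by exact: (svalP (projT2 (projT2 (sp i)))).2.
pose D i : khom (M i : C) (M (i + 1) : C) := t (i + 1) \oc gd T \oc s i.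
have Ds i : gd T \oc s i = s (i + 1) \oc D i.
  rewrite /D !kcompA st -gdeg -[RHS]kcompA -st.
  by rewrite -(kcompA (s i)) ts kcomp1r.
have dd i x : (D (i + 1) : plin _ _) ((D i : plin _ _) x) = 0.
  have E : D (i + 1) \oc D i = 0.
    rewrite -[LHS]kcomp1l -ts -kcompA (kcompA (s _)) -Ds -(kcompA (gd T)) -Ds.
    by rewrite (kcompA (gd T)) gdd kcomp0l kcomp0r.
  exact: khom_app x E.
pose X := @Complex I A M (fun i => D i : plin _ _) dd.
by exists X, (@Real X T s t ts st Ds).
Qed.

(** F is the map between total objects that f induces. As a relation it
    spares the choice of an inverse, and it is compatible with all
    operations. *)
Definition lifts X Y (rX : real X) (rY : real Y) (f : chain_map X Y)
    (F : khom (rT rX) (rT rY)) :=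
  forall i, F \oc rs rX i = rs rY i \oc cmk f i.

Section Lifts.
Variables (X Y : complex I A) (rX : real X) (rY : real Y).

Lemma lift_exists (f : chain_map X Y) : exists F, lifts (rX := rX) (rY := rY) f F.
Proof.
exists (\sum_(i <- gs (rT rX)) rs rY i \oc cmk f i \oc rt rX i) => i.
rewrite kcomp_suml; case: (boolP (i \in gs (rT rX))) => ir; last first.
  have s0 := rs_out ir.
  rewrite -[RHS]kcomp1r -(rts rX i) s0 !kcomp0r big1 // => j _.
  by rewrite kcomp0r.
rewrite (bigD1_seq i) ?gs_uniq //= (kcr (rts _ _)) kcomp1r big1 ?addr0 // => j ji.
have E : rt rX j \oc rs rX i = 0.
  have -> : rt rX j = rt rX j \oc ge _ j by rewrite rtg eqxx.
  by rewrite -kcompA rge (negPf ji) kcomp0r.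
by rewrite (kcr E) kcomp0r.
Qed.

Lemma lifts_cmap (f : chain_map X Y) F : lifts (rX := rX) (rY := rY) f F -> cmap F.
Proof.
move=> fF; split=> [i|].
  apply: rs_ext => j; rewrite addr0 -!kcompA fF rge kcompA rge.
  by case: eqP => _; rewrite ?fF ?kcomp0r ?kcomp0l.
apply: rs_ext => i; rewrite -!kcompA fF rds !kcompA rds fF -!kcompA.
by congr (_ \oc _); apply: khomP => x; apply/esym/cm_d.
Qed.

Lemma lower_exists F : @cmap _ C I (rT rX) (rT rY) F ->
  exists f, lifts (rX := rX) (rY := rY) f F.
Proof.
move=> [F1 F2].
pose g i : khom (X i : C) (Y i : C) := rt rY i \oc F \oc rs rX i.
have Fs i : F \oc rs rX i = rs rY i \oc g i.
  have -> : rs rX i = ge _ i \oc rs rX i by rewrite rge eqxx.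
  by rewrite kcompA F1 addr0 /g !kcompA rst.
clearbody g.
have gd_ i x :
    (g (i + 1) : plin _ _) (cx_d X i x) = cx_d Y i ((g i : plin _ _) x).
  have E : g (i + 1) \oc cxd X i = cxd Y i \oc g i.
    apply: (@rs_inj _ rY); rewrite !kcompA -Fs -rds -!kcompA -Fs -rds.
    by rewrite !kcompA F2.
  exact: khom_app x E.
by exists (@ChainMap I A X Y (fun i => g i : plin _ _) gd_).
Qed.

Lemma lifts_eq (f g : chain_map X Y) F : cm_eq f g ->
  lifts (rX := rX) (rY := rY) f F -> lifts (rX := rX) (rY := rY) g F.
Proof.
move=> fg fF i; rewrite fF; congr (_ \oc _).
by apply: khomP => x; apply: fg.
Qed.

Lemma lifts_uniq (f : chain_map X Y) F G : lifts (rX := rX) (rY := rY) f F ->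
  lifts (rX := rX) (rY := rY) f G -> F = G.
Proof. by move=> fF fG; apply: rs_ext => i; rewrite fF fG. Qed.

Lemma lifts_inj (f g : chain_map X Y) F : lifts (rX := rX) (rY := rY) f F ->
  lifts (rX := rX) (rY := rY) g F -> cm_eq f g.
Proof.
move=> fF gF i x; have E : cmk f i = cmk g i.
  by apply: (@rs_inj _ rY); rewrite -fF -gF.
exact: khom_app x E.
Qed.

Lemma lifts0 : lifts (rX := rX) (rY := rY) (cm_zero X Y) 0.
Proof.
move=> i; rewrite kcomp0l; have -> : cmk (cm_zero X Y) i = 0 by exact: khomP.
by rewrite kcomp0r.
Qed.

Lemma liftsD (f g : chain_map X Y) F G : lifts (rX := rX) (rY := rY) f F ->
  lifts (rX := rX) (rY := rY) g G -> lifts (rX := rX) (rY := rY) (cm_add f g) (F + G).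
Proof. by move=> fF gG i; rewrite kcompDl fF gG -kcompDr. Qed.

(** ** Homotopies *)
Lemma homotopy_lift (f g : chain_map X Y) F G : homotopic f g ->
  lifts (rX := rX) (rY := rY) f F -> lifts (rX := rX) (rY := rY) g G ->
  exists H, F - G = gd (rT rY) \oc H + H \oc gd (rT rX).
Proof.
move=> [h hP] fF gG.
pose hh i : khom (X (i + 1) : C) (Y i : C) := h i.
pose K i := rs rY i \oc hh i \oc rt rX (i + 1).
have Ks i j : i + 1 != j -> K i \oc rs rX j = 0.
  move=> ij; have E : rt rX (i + 1) \oc rs rX j = 0.
    have -> : rs rX j = ge _ j \oc rs rX j by rewrite rge eqxx.
    by rewrite kcompA rtg (negPf ij) kcomp0l.
  by rewrite (kcr E) kcomp0r.
have [H Hs] : exists H, forall i, H \oc rs rX (i + 1) = rs rY i \oc hh i.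
  exists (\sum_(j <- gs (rT rX)) K (j - 1)) => i; rewrite kcomp_suml.
  have E : K i \oc rs rX (i + 1) = rs rY i \oc hh i by rewrite (kcr (rts _ _)) kcomp1r.
  case: (boolP (i + 1 \in gs (rT rX))) => ir; last first.
    have s0 := rs_out ir.
    by rewrite -E s0 kcomp0r big1 // => j _; rewrite kcomp0r.
  rewrite (bigD1_seq (i + 1)) ?gs_uniq //= addrK E big1 ?addr0 // => j ji.
  by rewrite Ks // subrK.
exists H; apply: rs_ext => j; rewrite -(subrK 1 j); set i := j - 1.
rewrite kcompBl fF gG kcompDl -!kcompA Hs rds !kcompA Hs rds -!kcompA.
rewrite -kcompBr -kcompDr; congr (_ \oc _).
by apply: khomP => x; apply: hP.
Qed.

Lemma homotopy_lower (f g : chain_map X Y) F G H :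
  lifts (rX := rX) (rY := rY) f F -> lifts (rX := rX) (rY := rY) g G ->
  F - G = gd (rT rY) \oc H + H \oc gd (rT rX) -> homotopic f g.
Proof.
move=> fF gG FG.
pose h i : khom (X (i + 1) : C) (Y i : C) := rt rY i \oc H \oc rs rX (i + 1).
exists (fun i => h i : plin _ _) => i x.
have E : cmk f (i + 1) - cmk g (i + 1) = cxd Y i \oc h i + h (i + 1) \oc cxd X (i + 1).
  have := congr1 (fun z => rt rY (i + 1) \oc z \oc rs rX (i + 1)) FG.
  rewrite /= kcompBr kcompBl -!(kcompA (rt rY _)) fF gG !kcompA rts !kcomp1l => ->.
  rewrite /h kcompDr kcompDl !kcompA rtd.
  by rewrite -(kcompA _ (gd _)) rds !kcompA.
exact: khom_app x E.
Qed.

End Lifts.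

Lemma lifts1 X (rX : real X) : lifts (rX := rX) (rY := rX) (cm_id X) \1.
Proof.
move=> i; rewrite kcomp1l; have -> : cmk (cm_id X) i = \1 by exact: khomP.
by rewrite kcomp1r.
Qed.

Lemma lifts_comp X Y Z (rX : real X) (rY : real Y) (rZ : real Z)
    (g : chain_map Y Z) (f : chain_map X Y) F G :
  lifts (rX := rY) (rY := rZ) g G -> lifts (rX := rX) (rY := rY) f F ->
  lifts (rX := rX) (rY := rZ) (cm_comp g f) (G \oc F).
Proof.
by move=> gG fF i; rewrite -kcompA fF kcompA gG -kcompA.
Qed.

End Realization.
Arguments rs {k A I X} r i.
Arguments rt {k A I X} r i.
Arguments lifts {k A I X Y} rX rY f F.

(** * Periodic complexes *)

Section Periodic.
Variables (k : fieldType) (A : falgType k) (m : nat).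
Notation C := (projcat A).
Notation I := ('Z_m : nzRingType).
Implicit Types X Y Z W E J : Cper m A.

Lemma real_per X : inhabited (real (X : complex I A)).
Proof.
by apply: (@real_of_complex k A I X (enum 'Z_m)) (enum_uniq _) _ => i;
  rewrite mem_enum.
Qed.

Section Mor.
Variables (X Y : Cper m A) (rX : real X) (rY : real Y).
Variables (f : mor X Y) (F : khom (rT rX) (rT rY)).
Hypothesis fF : lifts rX rY f F.

Lemma gret_lower : gret F -> retraction_mor f.
Proof.
move=> [G [cG FG]]; have [g gG] := lower_exists cG.
exists g; apply: (lifts_inj (lifts_comp fF gG)).
by rewrite FG; apply: lifts1.
Qed.

Lemma gsec_lower : gsec F -> section_mor f.
Proof.
move=> [G [cG FG]]; have [g gG] := lower_exists cG.
exists g; apply: (lifts_inj (lifts_comp gG fF)).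
by rewrite FG; apply: lifts1.
Qed.

Lemma gret_lift : retraction_mor f -> gret F.
Proof.
move=> [g fg]; have [G gG] := lift_exists rY rX g.
exists G; split; first exact: lifts_cmap gG.
exact: (lifts_uniq (lifts_eq fg (lifts_comp fF gG)) (lifts1 rY)).
Qed.

Lemma gsec_lift : section_mor f -> gsec F.
Proof.
move=> [g fg]; have [G gG] := lift_exists rY rX g.
exists G; split; first exact: lifts_cmap gG.
exact: (lifts_uniq (lifts_eq fg (lifts_comp gG fF)) (lifts1 rX)).
Qed.

End Mor.

Lemma irreducible_girr X Y (rX : real X) (rY : real Y) (f : mor X Y) F :
  lifts rX rY f F -> irreducible_mor f -> [/\ ~ gsec F, ~ gret F & girr F].
Proof.
move=> fF [nsec nret irr]; split.
- by move/(gsec_lower fF).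
- by move/(gret_lower fF).
move=> W; have [W' [rW <-]] := complex_of_gcx W => H G cH cG FE.
have [h hH] := lower_exists cH; have [g gG] := lower_exists cG.
case: (irr W' h g); last by move/(gret_lift hH); right.
  by apply: (lifts_inj fF); rewrite FE; apply: lifts_comp.
by move/(gsec_lift gG); left.
Qed.

Lemma zero_obP X (rX : real X) : kid (rT rX) = 0 -> zero_ob X.
Proof.
move=> r0; apply: (lifts_inj (lifts1 rX)).
by rewrite r0; apply: lifts0.
Qed.

Lemma zero_ob_lift X (rX : real X) : zero_ob X -> kid (rT rX) = 0.
Proof.
move=> z; exact: (lifts_uniq (lifts_eq z (lifts1 rX)) (lifts0 rX rX)).
Qed.

Lemma split_cmap (T : gcx C I) (e : khom T T) : cmap e -> e \oc e = e ->
  exists (M : gcx C I) (s : khom M T) (t : khom T M),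
    [/\ cmap s, cmap t, t \oc s = \1 & s \oc t = e].
Proof.
move=> [edeg ed] ee; have [M [s [t [ts st]]]] := ksplit ee.
have es : e \oc s = s by rewrite -st -kcompA ts kcomp1r.
have te : t \oc e = t by rewrite -st kcompA ts kcomp1l.
have eg i : e \oc ge T i = ge T i \oc e by rewrite edeg addr0.
have ort i j : t \oc ge T i \oc s \oc (t \oc ge T j \oc s) =
    if i == j then t \oc ge T i \oc s else 0.
  rewrite !kcompA (kcr st) -(kcompA t) -eg kcompA te (kcr (ge_ort T i j)).
  by case: eqP => _ //; rewrite kcomp0r kcomp0l.
have sum : \sum_(i <- gs T) t \oc ge T i \oc s = \1.
  by rewrite -kcomp_suml -kcomp_sumr ge_sum kcomp1r.
have deg i : t \oc gd T \oc s \oc (t \oc ge T i \oc s) =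
    t \oc ge T (i + 1) \oc s \oc (t \oc gd T \oc s).
  rewrite !kcompA !(kcr st) -(kcompA t (gd T)) ed kcompA te.
  by rewrite -(kcompA t (ge T _)) -eg kcompA te (kcr (gdeg T i)) kcompA.
have dd : t \oc gd T \oc s \oc (t \oc gd T \oc s) = 0.
  rewrite !kcompA !(kcr st) -(kcompA t (gd T)) ed kcompA te (kcr (gdd T)).
  by rewrite kcomp0r kcomp0l.
exists (Gcx (gs_uniq T) ort sum deg dd), s, t; split=> //; split=> [i|] /=.
- by rewrite addr0 !kcompA st eg -kcompA es.
- by rewrite !kcompA st -ed -kcompA es.
- by rewrite addr0 -!kcompA st -eg kcompA te.
- by rewrite -!kcompA st ed kcompA te.
Qed.

(** An idempotent chain map and its complement split, which decomposes X. *)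
Lemma indecomposable_idem X (rX : real X) : indecomposable X ->
  kid (rT rX) <> 0 /\
  forall e : khom (rT rX) (rT rX), cmap e -> e \oc e = e -> e = 0 \/ e = \1.
Proof.
move=> [X0 dec]; split; first by move/zero_obP.
move=> e ce ee; pose e' := \1 - e.
have ce' : cmap e'.
  case: ce => e1 e2; split=> [i|]; rewrite /e' !kcompE ?e1 ?e2 //.
  by rewrite addr0.
have ee' : e' \oc e' = e' by rewrite /e' !kcompE ee; zmod.
have [M [s [t [cs ct ts st]]]] := split_cmap ce ee.
have [M' [s' [t' [cs' ct' ts' st']]]] := split_cmap ce' ee'.
have [Y [rY YM]] := complex_of_gcx M; have [Z [rZ ZM]] := complex_of_gcx M'.
rewrite -{}YM in s t cs ct ts st.
rewrite -{}ZM in s' t' cs' ct' ts' st'.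
have [i1 l1] := lower_exists cs; have [i2 l2] := lower_exists cs'.
have [p1 l3] := lower_exists ct; have [p2 l4] := lower_exists ct'.
have ee0 : e \oc e' = 0 by rewrite /e' kcompBr kcomp1r ee subrr.
have ee0' : e' \oc e = 0 by rewrite /e' kcompBl kcomp1l ee subrr.
have te : t \oc e = t by rewrite -st kcompA ts kcomp1l.
have es : e \oc s = s by rewrite -st -kcompA ts kcomp1r.
have te' : t' \oc e' = t' by rewrite -st' kcompA ts' kcomp1l.
have es' : e' \oc s' = s' by rewrite -st' -kcompA ts' kcomp1r.
have ts0 : t \oc s' = 0.
  by rewrite -te -es' kcompA -(kcompA t) ee0 kcomp0r kcomp0l.
have ts0' : t' \oc s = 0.
  by rewrite -te' -es kcompA -(kcompA t') ee0' kcomp0r kcomp0l.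
have [|Y0|Z0] := dec Y Z.
- exists i1, i2, p1, p2; split.
  + by apply: (lifts_inj (lifts_comp l3 l1)); rewrite ts; apply: lifts1.
  + by apply: (lifts_inj (lifts_comp l4 l2)); rewrite ts'; apply: lifts1.
  + by apply: (lifts_inj (lifts_comp l3 l2)); rewrite ts0; apply: lifts0.
  + by apply: (lifts_inj (lifts_comp l4 l1)); rewrite ts0'; apply: lifts0.
  + apply: (lifts_inj (liftsD (lifts_comp l1 l3) (lifts_comp l2 l4))).
    by rewrite st st' /e' addrCA subrr addr0; apply: lifts1.
- by left; rewrite -st -[s]kcomp1r (zero_ob_lift rY Y0) kcomp0r kcomp0l.
right; apply/esym/eqP; rewrite -subr_eq0 -/e' -st' -[s']kcomp1r.
by rewrite (zero_ob_lift rZ Z0) kcomp0r kcomp0l.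
Qed.

Lemma twist_conflation X Y E (rX : real X) (rY : real Y) (rE : real E)
    th F G p s (f : mor X E) (g : mor E Y) :
  @twist _ _ _ (rT rX) (rT rY) (rT rE) th F G p s ->
  lifts rX rE f F -> lifts rE rY g G -> conflation f g.
Proof.
case=> Fdg Gdg pdg sdg pf gs_ gf ps sum df dg ds fF gG i.
have cs Y' Z' (r : real Y') (r' : real Z') (H : khom (rT r) (rT r')) :
    hdeg 0 H -> H \oc rs r i = rs r' i \oc (rt r' i \oc H \oc rs r i).
  move=> Hdg; rewrite !kcompA rst.
  by have := Hdg i; rewrite addr0 => <-; rewrite -kcompA rge eqxx.
pose pi := rt rX i \oc p \oc rs rE i; pose si := rt rE i \oc s \oc rs rY i.
have pE : p \oc rs rE i = rs rX i \oc pi by apply: cs.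
have sE : s \oc rs rY i = rs rE i \oc si by apply: cs.
clearbody pi si.
have pf' : pi \oc cmk f i = \1.
  apply: (@rs_inj _ _ _ _ rX).
  by rewrite kcompA -pE -kcompA -fF kcompA pf kcomp1l kcomp1r.
have gs' : cmk g i \oc si = \1.
  apply: (@rs_inj _ _ _ _ rY).
  by rewrite kcompA -gG -kcompA -sE kcompA gs_ kcomp1l kcomp1r.
have gf' : cmk g i \oc cmk f i = 0.
  apply: (@rs_inj _ _ _ _ rY).
  by rewrite kcompA -gG -kcompA -fF kcompA gf kcomp0l kcomp0r.
have sum' : cmk f i \oc pi + si \oc cmk g i = \1.
  apply: (@rs_inj _ _ _ _ rE).
  rewrite kcompDr !kcompA -fF -sE -!kcompA -pE -gG !kcompA -kcompDl sum.
  by rewrite kcomp1l kcomp1r.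
split.
- move=> x y xy; rewrite -[x](khom_app x pf') -[y](khom_app y pf').
  exact: congr1 xy.
- move=> y; split=> [gy|[x <-]]; last exact: khom_app x gf'.
  exists ((pi : plin _ _) y); have := khom_app y sum' => /= eqy.
  rewrite -[RHS]eqy; rewrite -[LHS]addr0; congr (_ + _).
  by rewrite -[LHS](linear0 (si : plin _ _)) -gy.
- by exists (si : plin _ _) => z; exact: khom_app z gs'.
Qed.

Lemma left_minimal_lower X E (rX : real X) (rE : real E) (f : mor X E) F :
  lifts rX rE f F ->
  (forall u : khom (rT rE) (rT rE), cmap u -> u \oc F = F ->
     exists u', [/\ cmap u', u' \oc u = \1 & u \oc u' = \1]) ->
  left_minimal f.
Proof.
move=> fF h u uf; have [U uU] := lift_exists rE rE u.
have [|U' [cU' e1 e2]] := h U (lifts_cmap uU).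
  exact: (lifts_uniq (lifts_eq uf (lifts_comp uU fF)) fF).
have [u' uU'] := lower_exists cU'; exists u'.
split; [apply: (lifts_inj (lifts_comp uU' uU))|
        apply: (lifts_inj (lifts_comp uU uU'))].
  by rewrite e1; apply: lifts1.
by rewrite e2; apply: lifts1.
Qed.

Lemma right_minimal_lower E Y (rE : real E) (rY : real Y) (g : mor E Y) G :
  lifts rE rY g G ->
  (forall u : khom (rT rE) (rT rE), cmap u -> G \oc u = G ->
     exists u', [/\ cmap u', u' \oc u = \1 & u \oc u' = \1]) ->
  right_minimal g.
Proof.
move=> gG h u gu; have [U uU] := lift_exists rE rE u.
have [|U' [cU' e1 e2]] := h U (lifts_cmap uU).
  exact: (lifts_uniq (lifts_eq gu (lifts_comp gG uU)) gG).
have [u' uU'] := lower_exists cU'; exists u'.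
split; [apply: (lifts_inj (lifts_comp uU' uU))|
        apply: (lifts_inj (lifts_comp uU uU'))].
  by rewrite e1; apply: lifts1.
by rewrite e2; apply: lifts1.
Qed.

(** The complexes over which the almost split conditions quantify have total
    objects, and chain maps between total objects come from chain maps of
    complexes. *)
Lemma tau_inv_of_ar X Y (rX : real X) (rY : real Y) (E : gcx C I) th F G p s :
  @twist _ _ _ (rT rX) (rT rY) E th F G p s ->
  @left_ar _ _ _ (rT rX) E F -> @right_ar _ _ _ E (rT rY) G -> is_tau_inv X Y.
Proof.
have [E' [rE EE]] := complex_of_gcx E; case: {E} _ / EE F G p s => F G p s tw.
move=> [nsF lF mF] [nrG rG mG].
have cF : @cmap _ _ _ (rT rX) (rT rE) F.
  by split; [exact: tw_f tw|exact: tw_df tw].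
have cG : @cmap _ _ _ (rT rE) (rT rY) G.
  by split; [exact: tw_g tw|exact/esym/(tw_gd tw)].
have [f fF] := lower_exists cF; have [g gG] := lower_exists cG.
exists E', f, g; split.
- exact: twist_conflation tw fF gG.
- exact: left_minimal_lower fF mF.
- split=> [/(gsec_lift fF)//|W h nh].
  have [rW] := real_per W; have [H hH] := lift_exists rX rW h.
  have [/(gsec_lower hH)//|[H' [cH' HE]]] := lF _ H (lifts_cmap hH).
  have [h' hH'] := lower_exists cH'; exists h'.
  by apply: (lifts_inj (lifts_comp hH' fF)); rewrite HE.
- exact: right_minimal_lower gG mG.
- split=> [/(gret_lift gG)//|W h nh].
  have [rW] := real_per W; have [H hH] := lift_exists rW rY h.
  have [/(gret_lower hH)//|[H' [cH' HE]]] := rG _ H (lifts_cmap hH).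
  have [h' hH'] := lower_exists cH'; exists h'.
  by apply: (lifts_inj (lifts_comp gG hH')); rewrite HE.
Qed.

(** The conflation J[-1] -> cone of the identity -> J splits when J is
    projective. *)
Lemma projective_contraction J (rJ : real J) : ex_projective J ->
  exists h : khom (rT rJ) (rT rJ), hdeg (-1) h /\
    h \oc gd (rT rJ) + gd (rT rJ) \oc h = \1.
Proof.
move=> projJ; pose T := rT rJ.
have ort i j : ge T (i - 1) \oc ge T (j - 1) = if i == j then ge T (i - 1) else 0.
  by rewrite ge_ort (inj_eq (addIr _)).
have us : uniq [seq i + 1 | i <- gs T].
  by rewrite map_inj_uniq ?gs_uniq //; apply: addIr.
have sum : \sum_(i <- [seq i + 1 | i <- gs T]) ge T (i - 1) = \1.
  by rewrite big_map -(ge_sum T); apply: eq_bigr => i _; rewrite addrK.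
have deg i : (- gd T) \oc ge T (i - 1) = ge T (i + 1 - 1) \oc (- gd T).
  by rewrite kcompNl kcompNr gdeg subrK addrK.
have dd : (- gd T) \oc (- gd T) = 0 by rewrite kcompNl kcompNr opprK gdd.
pose S : gcx C I := Gcx us ort sum deg dd.
have [th thE] : exists th : khom T S, th = kid T by exists (kid T).
have [||E [F [G [p [s tw]]]]] := @twist_exists _ _ _ S T th.
- by move=> i /=; rewrite thE addrK kcomp1l kcomp1r.
- by rewrite /= thE kcomp1l kcomp1r addNr.
have [S' [rS SE]] := complex_of_gcx S.
have [E' [rE EE]] := complex_of_gcx E.
case: {E} _ / EE F G p s tw => F G p s tw.
have tdeg t : cmap t -> @hdeg _ _ _ T S 0 (p \oc t).
  by move=> ct i; rewrite -kcompA ct.1 kcompA (tw_p tw) !kcompA !addr0.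
have tsplit t := twist_split (t := t) tw.
suff [t [ct Gt]] : exists t : khom T (rT rE), cmap t /\ G \oc t = \1.
  exists (p \oc t); split; first by move=> i; have := tdeg t ct i; rewrite /= !addr0.
  by rewrite -[RHS]thE (tsplit t ct.2 Gt) /= kcompNl opprK.
clear thE tdeg tsplit; move: th F p s tw; rewrite -SE => th F p s tw.
have cF : @cmap _ _ _ (rT rS) (rT rE) F.
  by split; [exact: tw_f tw|exact: tw_df tw].
have cG : @cmap _ _ _ (rT rE) (rT rJ) G.
  by split; [exact: tw_g tw|exact/esym/(tw_gd tw)].
have [f fF] := lower_exists cF; have [g gG] := lower_exists cG.
have [t tg] := projJ _ _ _ f g (twist_conflation tw fF gG) (idm J).
have [t' tt'] := lift_exists rJ rE t; exists t'; split; first exact: lifts_cmap tt'.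
exact: (lifts_uniq (lifts_eq tg (lifts_comp gG tt')) (lifts1 rJ)).
Qed.

End Periodic.

Import Order.TTheory Num.Theory.

(** * Contractible complexes *)

Section Contractible.
Variables (k : fieldType) (C : kcat k) (I : nzRingType).

Lemma add1_neq (i : I) : i + 1 != i.
Proof. by rewrite -subr_eq0 addrAC subrr add0r oner_eq0. Qed.

(** If h is a contraction then a = h d and b = d h are complementary
    idempotents of degree 0. For each j, a in degree j together with b in
    degree j + 1 is an idempotent chain map, the projection onto a summand of
    the form P = P. Since T is indecomposable, one of these is the identity.
    Idempotents of P extend to T, so P is indecomposable as well. *)
Lemma contractible_jdata (T : gcx C I) (h : khom T T) :
  hdeg (-1) h -> h \oc gd T + gd T \oc h = \1 -> kid T <> 0 ->
  (forall e : khom T T, cmap e -> e \oc e = e -> e = 0 \/ e = \1) ->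
  exists (P : C) j (u : khom P T) v, klocal P /\ jdata j u v.
Proof.
move=> hdg hd T0 idem.
have hg i : h \oc ge T (i + 1) = ge T i \oc h by rewrite hdg addrK.
have [a aE] : exists a, a = h \oc gd T by exists (h \oc gd T).
have [b bE] : exists b, b = gd T \oc h by exists (gd T \oc h).
have ab1 : a + b = \1 by rewrite aE bE.
have ab : a \oc b = 0 by rewrite aE bE kcompA (kcr (gdd T)) kcomp0r kcomp0l.
have aa : a \oc a = a.
  by rewrite -[RHS]kcomp1r -ab1 kcompDr ab addr0.
have bE1 : b = \1 - a by rewrite -ab1 addrAC subrr add0r.
have ba : b \oc a = 0 by rewrite bE1 kcompBl kcomp1l aa subrr.
have bb : b \oc b = b by rewrite {2}bE1 kcompBr kcomp1r ba subr0.
have ae i : a \oc ge T i = ge T i \oc a.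
  by rewrite aE -kcompA gdeg kcompA hg kcompA.
have be i : b \oc ge T i = ge T i \oc b.
  by rewrite bE1 kcompBl kcompBr ae kcomp1l kcomp1r.
have da : gd T \oc a = gd T.
  by rewrite -[RHS]kcomp1r -ab1 kcompDr bE kcompA gdd kcomp0l addr0.
have ad : a \oc gd T = 0 by rewrite aE -kcompA gdd kcomp0r.
have db : gd T \oc b = 0 by rewrite bE kcompA gdd kcomp0l.
have bd : b \oc gd T = gd T by rewrite bE1 kcompBl kcomp1l ad subr0.
pose e j : khom T T := a \oc ge T j + b \oc ge T (j + 1).
have gc i i' : ge T i \oc ge T i' = ge T i' \oc ge T i.
  by rewrite !ge_ort eq_sym; case: eqP => [->|].
have ce j : cmap (e j).
  split=> [i|]; rewrite /e.
    rewrite addr0 kcompDl kcompDr (kcompA _ a) (kcompA _ b) -ae -be.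
    by rewrite -!kcompA !(gc i).
  rewrite kcompDl kcompDr !kcompA da db kcomp0l addr0.
  rewrite -!kcompA -gdeg !kcompA bd -kcompA (_ : a \oc (ge T j \oc gd T) = 0).
    by rewrite add0r.
  by rewrite kcompA ae -kcompA ad kcomp0r.
have ee j : e j \oc e j = e j.
  rewrite /e kcompDl !kcompDr !kcompA.
  rewrite !(kcr (esym (ae _))) !(kcr (esym (be _))) !kcompA aa ab ba bb !kcomp0l.
  by rewrite addr0 add0r !(kcr (ge_idem _ _)).
have [|] := EM (exists j, e j = \1); last first.
  move=> ne; have e0 j : e j = 0.
    by have [//|e1] := idem _ (ce j) (ee j); case: ne; exists j.
  case: T0; rewrite -ab1; suff -> : a = 0.
    rewrite add0r; apply: ge_ext => i; rewrite kcomp0l -(subrK 1 i).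
    have := congr1 (fun z => z \oc ge T (i - 1 + 1)) (e0 (i - 1)).
    rewrite /e /= kcompDl -!kcompA ge_idem ge_ort0 1?eq_sym ?add1_neq //.
    by rewrite kcomp0r kcomp0l add0r.
  apply: ge_ext => i; rewrite kcomp0l.
  have := congr1 (fun z => z \oc ge T i) (e0 i).
  rewrite /e /= kcompDl -!kcompA ge_idem ge_ort0 ?add1_neq //.
  by rewrite kcomp0r kcomp0l addr0.
move=> [j e1].
have gj : a \oc ge T j = ge T j.
  rewrite -[RHS]kcomp1l -e1 /e kcompDl -!kcompA ge_idem ge_ort0 ?add1_neq //.
  by rewrite kcomp0r addr0.
have [P [s [t [ts st]]]] := ksplit (ge_idem T j).
have gs_ : ge T j \oc s = s by rewrite -st -kcompA ts kcomp1r.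
have tg : t \oc ge T j = t by rewrite -st kcompA ts kcomp1l.
have [v vE] : exists v, v = t \oc h by exists (t \oc h).
have vg : v \oc ge T (j + 1) = v by rewrite vE -kcompA hg kcompA tg.
have vdu : v \oc gd T \oc s = \1.
  by rewrite vE -(kcompA t) -aE -gs_ kcompA -(kcompA t) gj tg ts.
have uv : s \oc v \oc gd T + gd T \oc s \oc v = \1.
  by rewrite vE !kcompA st (kcr st) -!kcompA -aE -hg (kcompA (gd T)) -bE -ae.
have jd : jdata j s v by split.
exists P, j, s, v; split=> //; split.
  move=> P0; apply: T0; rewrite -uv -[s]kcomp1r P0 !kcomp0r !kcomp0l addr0 //.
have vs : v \oc s = 0.
  by rewrite -vg -gs_ kcompA -(kcompA v) ge_ort0 ?add1_neq // kcomp0r kcomp0l.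
have gs' i : ge T i \oc s = if i == j then s else 0 by exact: ge_ij.
have vg' i : v \oc ge T i = if i == j + 1 then v else 0 by exact: ge_pr.
move=> p pp; pose q := s \oc p \oc v \oc gd T + gd T \oc s \oc p \oc v.
have cq : cmap q.
  split=> [i|]; last first.
    by rewrite /q !kcompE gdd (kcr (gdd T)) !kcompE addrC.
  rewrite addr0 /q !kcompE; congr (_ + _).
    rewrite -(kcompA _ (gd T)) gdeg kcompA -(kcompA (s \oc p)) vg' gs'.
    by rewrite (inj_eq (addIr 1)); case: eqP; rewrite ?kcompE.
  rewrite -(kcompA _ v) vg' -[i in RHS](subrK 1) -gdeg (kcr (gs' _)).
  rewrite subr_eq; case: eqP; rewrite ?kcompE //.
have qq : q \oc q = q.
  rewrite /q !kcompE (kcr (gdd T)) !kcompE.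
  rewrite !(kcr3 vdu) !(kcr vs) !kcompE !addr0.
  by rewrite !(kcr pp) add0r.
have vdq : v \oc gd T \oc q \oc s = p.
  rewrite /q !kcompE (kcr (gdd T)) !kcompE vdu kcomp1l (kcr3 vdu).
  by rewrite kcomp1r addr0.
clearbody q.
have [q0|q1] := idem q cq qq; [left|right].
  by rewrite -vdq q0 kcomp0r kcomp0l.
by rewrite -vdq q1 kcomp1r.
Qed.

Lemma girr_op (X Y : gcx C I) (F : khom X Y) :
  girr F -> @girr _ (kop C) I (opx Y) (opx X) F.
Proof.
move=> irr W h g /cmap_unop_r ch /cmap_unop_l cg FE.
have [[t [ct th]]|[t [ct th]]] := irr (unopx W) g h cg ch FE.
  by right; exists t; split=> //; apply/cmap_unop_l.
by left; exists t; split=> //; apply/cmap_unop_r.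
Qed.

End Contractible.

(** * Finite strong global dimension bounds minimal resolutions *)

(** A property of bounded graded complexes that is self-dual and forces
    indecomposability in the homotopy category. *)
Definition htpy_local (k : fieldType) (C : kcat k) (I : nzRingType)
    (T : gcx C I) :=
  forall f h : khom T T, cmap f -> f \oc f - f = gd T \oc h + h \oc gd T ->
  kiso f \/ kiso (\1 - f).

Section Bound.
Variables (k : fieldType) (C : kcat k).

(** Graded by the integers, P is alone in degree 0. Hence the bottom
    component x of f is idempotent modulo the radical, so x or 1 - x is
    radical, and [tot_local] applies to f or to 1 - f. *)
Lemma res_htpy_local (R : nat -> C) (d : forall l, khom (R l.+1) (R l)) n :
  min_res d -> kid (R n.+1) <> 0 ->
  exists T : gcx C int, [/\ jrad (gd T), htpy_local T, ge T 0 <> 0,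
    ge T (- n.+1%:Z) <> 0 & forall i, ge T i <> 0 -> - n.+1%:Z <= i <= 0].
Proof.
move=> dmin Rn; have [T [inj [prj [[h1 h2 h3 h5] DE pe ei]]]] :=
  @totcx_exists _ _ int _ _ dmin n 0.
have locP : klocal (R 0%N) by case: dmin.
have natz (l : nat) : 0 - l%:R = - l%:Z :> int by rewrite sub0r natz.
have jd : jrad (gd T) by rewrite DE; apply: tot_d_jrad.
exists T; split=> //.
- move=> f h cf ff.
  pose x := prj 0%N \oc f \oc inj 0%N.
  (* In degree 0, f maps no other term to P. *)
  have pf l : (l < n.+2)%N -> (0 < l)%N -> prj 0%N \oc f \oc inj l = 0.
    move=> ln l0; have -> : prj 0%N = prj 0%N \oc ge T 0 by rewrite pe subr0 eqxx.
    rewrite -(kcompA _ (ge T 0)); have := cf.1 0; rewrite addr0 => <-.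
    rewrite !kcompA -(kcompA _ (ge T 0)) ei natz oppr_eq0 eqz_nat gtn_eqF //.
    by rewrite kcomp0r.
  have xx : x \oc x = prj 0%N \oc (f \oc f) \oc inj 0%N.
    rewrite -{2}[f]kcomp1l -h3 kcomp_suml !kcomp_sumr kcomp_suml.
    rewrite big_ord_recl big1 ?addr0 => [|i _]; first by rewrite /x !kcompA.
    by rewrite !kcompA pf ?kcomp0l // ltnS.
  have jx : jrad (x \oc x - x).
    have -> : x \oc x - x = prj 0%N \oc (f \oc f - f) \oc inj 0%N.
      by rewrite xx kcompBr kcompBl.
    rewrite ff; apply/jrad_compr/jrad_compl/jradD.
      exact: jrad_compr.
    exact: jrad_compl.
  have loc g : gd T \oc g = g \oc gd T -> jrad (prj 0%N \oc g \oc inj 0%N) ->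
      kiso (\1 - g).
    by rewrite DE; apply: (tot_local dmin h1 h2 h3 h5).
  have [jrx|[y [yx xy]]] := jrad_or_kiso x locP.
    by right; apply: loc jrx; case: cf.
  left; have -> : f = \1 - (\1 - f) by zmod.
  apply: loc; first by rewrite kcompBr kcompBl kcomp1l kcomp1r cf.2.
  have -> : prj 0%N \oc (\1 - f) \oc inj 0%N = y \oc (- (x \oc x - x)).
    have yE : y \oc (x \oc x - x) = x - \1 by rewrite kcompBr kcompA yx kcomp1l.
    rewrite kcompNr yE kcompBr kcomp1r kcompBl h1 // -/x; zmod.
  exact/jrad_compl/jradN.
- move=> e0; case: locP => + _; apply.
  by rewrite -(h1 0%N) //; have := pe 0%N 0; rewrite e0 subr0 eqxx kcomp0r => <-;
    rewrite kcomp0l.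
- move=> e0; apply: Rn.
  rewrite -(h1 n.+1) //; have := pe n.+1 (- n.+1%:Z).
  by rewrite e0 natz eqxx kcomp0r => <-; rewrite kcomp0l.
move=> i ei0; case: (boolP (_ <= _ <= _)) => // ni; case: ei0.
apply: (tot_ext h3) => l; rewrite pe kcomp0r; case: eqP => // il.
case: (ltnP l n.+2) => ln; last by rewrite h5.
case/negP: ni; rewrite -il natz oppr_le0 lerN2 !lez_nat -ltnS ln; by case: l {il ln}.
Qed.

End Bound.

Section Kb.
Variables (k : fieldType) (A : falgType k).
Notation C := (projcat A).

(** The identity of Y is (p i)(p i), which factors through i p. *)
Lemma factor_null_zero_ob (X Y : Kb A) (i : mor Y X) (p : mor X Y) :
  p \om i =m idm Y -> i \om p =m zerom X X -> zero_ob Y.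
Proof.
move=> pi ip.
have E1 : idm Y =m (p \om i) \om (p \om i).
  apply: meq_trans (mcomp_meq (meq_sym pi) (meq_sym pi)).
  exact: meq_sym (mcomp1m _).
have E2 : p \om ((i \om p) \om i) =m p \om (zerom X X \om i).
  exact: mcomp_meq (meq_refl _) (mcomp_meq ip (meq_refl _)).
apply: meq_trans E1 (meq_trans _ (meq_trans E2 _)).
  exact: cm_eq_homotopic.
by apply: cm_eq_homotopic => j x; apply: linear0.
Qed.

(** As d is radical, a null-homotopic idempotent is zero. Were a complex
    isomorphic to T in the homotopy category zero in degree a or a + l, the
    corresponding grading idempotent of T would vanish; so the length of T is
    l. Given a decomposition of T with projections f1 and f2, one of f1 and 1
    - f1 is invertible, and the idempotent relation modulo homotopy makes the
    other one null homotopic. *)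
Lemma kb_bound (T : gcx C int) (a : int) (l n : nat) :
  jrad (gd T) -> htpy_local T -> ge T a <> 0 -> ge T (a + l%:Z) <> 0 ->
  (forall i, ge T i <> 0 -> a <= i <= a + l%:Z) ->
  length_bound A n -> (l <= n)%N.
Proof.
have [B [r rE]] := complex_of_gcx T; case: {T} _ / rE => jd hl ea eb rng bnd.
have jh (h : khom (rT r) (rT r)) : jrad (gd (rT r) \oc h + h \oc gd (rT r)).
  by apply: jradD; [apply: jrad_compr|apply: jrad_compl].
have Bconc : concentrated B a (a + l%:Z).
  move=> i ni x; have e0 : ge (rT r) i = 0.
    by apply: contrapT => /rng; rewrite (negPf ni).
  have E : kid (B i : C) = 0.
    have : rt r i \oc (rs r i \oc rt r i) \oc rs r i = \1.
      by rewrite !kcompA rts kcomp1l rts.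
    by rewrite rst e0 kcomp0r kcomp0l.
  exact: khom_app x E.
have bB : exists a b, concentrated B a b by exists a, (a + l%:Z).
pose BB : Kb A := Bcomplex bB.
have null (f : chain_map B B) F h : lifts r r f F ->
    F = gd (rT r) \oc h + h \oc gd (rT r) -> @homotopic _ A B B f (cm_zero B B).
  move=> fF FE; apply: (homotopy_lower (H := h) fF (lifts0 r r)).
  by rewrite subr0.
have T0 : kid (rT r) <> 0.
  by move=> T0; apply: ea; rewrite -[LHS]kcomp1l T0 kcomp0l.
have indB : indecomposable BB.
  split.
    move=> zB; have [h] := homotopy_lift zB (lifts1 r) (lifts0 r r).
    rewrite subr0 => E; apply: T0; apply: (@jrad_idem _ _ (rT r)).
      exact: kcomp1l.
    by rewrite E; apply: jh.
  move=> Y Z [i1 [i2 [p1 [p2 [p1i1 p2i2 p1i2 p2i1 sum]]]]].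
  pose f1 : chain_map B B := cm_comp i1 p1.
  pose f2 : chain_map B B := cm_comp i2 p2.
  have ff : @homotopic _ A B B (cm_comp f1 f1) f1.
    have E : (i1 \om (p1 \om i1)) \om p1 =m (i1 \om idm Y) \om p1.
      exact: mcomp_meq (mcomp_meq (meq_refl _) p1i1) (meq_refl _).
    exact: E.
  have [F1 lF1] := lift_exists r r f1; have [F2 lF2] := lift_exists r r f2.
  have [H HE] := homotopy_lift ff (lifts_comp lF1 lF1) lF1.
  have [K KE] := homotopy_lift (sum : homotopic (cm_add f1 f2) (cm_id B))
    (liftsD lF1 lF2) (lifts1 r).
  have cF1 := lifts_cmap lF1.
  have [iF|iF] := hl F1 H cF1 HE; [right|left].
    have [G [cG GF FG]] := cmap_isoP cF1 iF.
    apply: (factor_null_zero_ob p2i2); apply: (null f2 F2 (K - H \oc G)) lF2 _.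
    have FE : F1 - \1 = gd (rT r) \oc (H \oc G) + H \oc G \oc gd (rT r).
      rewrite -(kcompA H) -cG.2 !kcompA -kcompDl -HE kcompBl FG.
      by rewrite -kcompA FG kcomp1r.
    have -> : F2 = (F1 + F2 - \1) - (F1 - \1) by zmod.
    by rewrite KE FE !kcompBr !kcompBl; zmod.
  have cF1' : cmap (\1 - F1).
    case: cF1 => c1 c2; split=> [i|]; rewrite !kcompE ?c1 ?c2 //.
    by rewrite addr0.
  have [G [cG GF FG]] := cmap_isoP cF1' iF.
  apply: (factor_null_zero_ob p1i1); apply: (null f1 F1 (- (H \oc G))) lF1 _.
  have FE : F1 = (F1 - F1 \oc F1) \oc G.
    by rewrite -[in LHS](kcomp1r F1) -FG !kcompE.
  have -> : F1 = - ((F1 \oc F1 - F1) \oc G) by rewrite -kcompNl opprB -FE.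
  by rewrite HE kcompDl kcompNl kcompNr opprD -!kcompA cG.2.
apply: (bnd BB l indB); split.
  exists a, BB; split=> //; exists (idm BB), (idm BB).
  by split; apply: mcomp1m.
move=> n' [a' [Y [Yc [ph [ps [psph _]]]]]].
have inY p : ge (rT r) p <> 0 -> a' <= p <= a' + n'%:Z.
  move=> ep; apply: contrapT => /negP np; apply: ep.
  have [F lF] := lift_exists r r (cm_comp ps ph : chain_map B B).
  have [H HE] := homotopy_lift psph lF (lifts1 r).
  have F0 : F \oc ge (rT r) p = 0.
    rewrite -rst kcompA lF; have -> : cmk (cm_comp ps ph : chain_map B B) p = 0.
      apply: khomP => x; rewrite [LHS]/= (Yc p np (ph p x)); exact: linear0.
    by rewrite kcomp0r kcomp0l.
  apply: jrad_idem; first exact: ge_idem.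
  have -> : ge (rT r) p = - ((F - \1) \oc ge (rT r) p).
    by rewrite kcompBl F0 kcomp1l sub0r opprK.
  by rewrite HE; apply/jradN/jrad_compr/jh.
have /andP[a1 _] := inY _ ea; have /andP[_ b2] := inY _ eb.
rewrite -lez_nat -(lerD2l a); apply: le_trans b2 _.
by rewrite lerD2r.
Qed.

Lemma res_bounded (R : nat -> C) (d : forall l, khom (R l.+1) (R l)) n :
  length_bound A n -> min_res d -> kid (R n.+1) = 0.
Proof.
move=> bnd dmin; apply: contrapT => Rn.
have [T [jd hl e0 en rng]] := res_htpy_local dmin Rn.
suff: (n.+1 <= n)%N by rewrite ltnn.
apply: (kb_bound (T := T) (a := - n.+1%:Z)) bnd => //.
  by rewrite addNr.
by move=> i /rng; rewrite addNr.
Qed.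

(** The coresolution is a resolution in the opposite category; the complex of
    the original category that it defines has P in degree 0 and its last term
    in degree n + 1. *)
Lemma cores_bounded (R : nat -> kop C) (d : forall l, khom (R l.+1) (R l)) n :
  length_bound A n -> min_res d -> kid (R n.+1) = 0.
Proof.
move=> bnd dmin; apply: contrapT => Rn.
have [T [jd hl e0 en rng]] := res_htpy_local dmin Rn.
suff: (n.+1 <= n)%N by rewrite ltnn.
apply: (kb_bound (T := unopx T) (a := 0)) bnd.
- exact/jrad_op.
- move=> f h cf E; have [||/kiso_op|/kiso_op] := hl f h; [| |by left|by right].
    case: cf => c1 c2; split=> [i|]; last exact/esym.
    by have := c1 (- i); rewrite /= !addr0 opprK => /esym.
  by rewrite /= E addrC.
- by rewrite /= oppr0.
- by rewrite /= add0r.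
by move=> i /rng; rewrite oppr_le0 lerN2 add0r andbC.
Qed.

End Kb.

Lemma min_res_stays0 (k : fieldType) (C : kcat k) (R : nat -> C)
    (d : forall l, khom (R l.+1) (R l)) n :
  min_res d -> kid (R n) = 0 -> kid (R n.+1) = 0.
Proof.
move=> [_ _ _ dm _] R0; have d0 : d n = 0 by rewrite -[LHS]kcomp1l R0 kcomp0l.
have [|g [E _]] := dm n 0; first by rewrite kcomp0r d0.
by rewrite -E kcomp0r.
Qed.

(** * Irreducible morphisms through a projective-injective complex *)

Lemma tau_inv_across_projective (k : fieldType) (A : falgType k) (n m : nat)
    (X J Y : Cper m A) (f : mor X J) (g : mor J Y) :
  length_bound A n ->
  indecomposable X -> indecomposable J -> indecomposable Y ->
  irreducible_mor f -> irreducible_mor g -> ex_projective J -> is_tau_inv X Y.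
Proof.
move=> bnd iX iJ iY irf irg pJ.
have [rX] := real_per X; have [rJ] := real_per J; have [rY] := real_per Y.
have [F fF] := lift_exists rX rJ f; have [G gG] := lift_exists rJ rY g.
have [_ nF iF] := irreducible_girr fF irf.
have [nG _ iG] := irreducible_girr gG irg.
have [X0 _] := indecomposable_idem rX iX.
have [Y0 _] := indecomposable_idem rY iY.
have [J0 idJ] := indecomposable_idem rJ iJ.
have [h [hdg hE]] := projective_contraction rJ pJ.
have [P [j [u [v [locP jd]]]]] := contractible_jdata hdg hE J0 idJ.
have [R [d [RP dmin]]] := min_res_exists locP.
have [R' [d' [RP' dmin']]] := min_res_exists (klocal_op locP).
have Rn := min_res_stays0 dmin (res_bounded bnd dmin).
have Rn' := min_res_stays0 dmin' (cores_bounded bnd dmin').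
have [prX [ijX rsX]] :=
  irreducible_to_contractible dmin RP Rn jd X0 (lifts_cmap fF) nF iF.
have jd' : @jdata _ _ _ (opx (rT rJ)) P (- (j + 1)) v u.
  case: jd => h1 h2 h3 h4; split=> /=.
  - by rewrite opprK.
  - by rewrite opprD opprK addrK.
  - by have E : v \oc (gd (rT rJ) \oc u) = \1 by rewrite kcompA.
  - by have E : gd (rT rJ) \oc (u \oc v) + u \oc (v \oc gd (rT rJ)) = \1
      by rewrite addrC !kcompA.
have nG' : ~ @gret _ _ _ (opx (rT rY)) (opx (rT rJ)) G.
  by move=> [t [/cmap_op ct tG]]; apply: nG; exists t.
have cG' : @cmap _ _ _ (opx (rT rY)) (opx (rT rJ)) G.
  by apply/cmap_op; apply: lifts_cmap gG.
have [ijY [prY rsY]] := irreducible_to_contractible (X := opx (rT rY))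
  (J := opx (rT rJ)) (f := G)
  dmin' RP' Rn' jd' Y0 cG' nG' (girr_op iG).
have cY : corescx (gd (rT rY)) (ge (rT rY) j) prY ijY.
  by apply: corescx_unop; move: rsY; rewrite /= opprD opprK addrK.
have [E [F' [G' [p [s [tw [lar rar]]]]]]] := ar_sequence locP rsX cY.
exact: tau_inv_of_ar tw lar rar.
Qed.

Theorem proposition5p8 (k : fieldType) (A : falgType k)
    (hA : exists n : nat, is_sgldim A n)
    (m : nat) (hm : (1 < m)%N)
    (r : nat) (X : nat -> Cper m A) (f : forall i : nat, mor (X i) (X i.+1))
    (hpath : sectional_path r f)
    (hnz : ~ meq (path_comp f r) (zerom (X 0%N) (X r))) :
  [\/ forall i : nat, (1 <= i <= r)%N -> ~ projective_injective (X i),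
      forall i : nat, (i < r)%N -> ~ projective_injective (X i) |
      [/\ projective_injective (X 0%N), projective_injective (X r) &
          forall i : nat, (0 < i < r)%N -> ~ projective_injective (X i)]].
Proof.
have [n [bnd _]] := hA; case: hpath => ind irr sec.
have interior i : (0 < i < r)%N -> ~ projective_injective (X i).
  case: i => // i /andP[_ ir] [pi _].
  have tau : is_tau_inv (X i) (X i.+2).
    exact: (tau_inv_across_projective bnd (ind i (ltnW (ltnW ir)))
      (ind i.+1 (ltnW ir)) (ind i.+2 ir) (irr i (ltnW ir)) (irr i.+1 ir) pi).
  apply: (sec i ir _ tau); exists (idm _), (idm _).
  by split; apply: mcomp1m.
have [p0|n0] := EM (projective_injective (X 0%N)); last first.
  apply: Or32 => -[|i] ir //; exact: interior.
have [pr|nr] := EM (projective_injective (X r)); first by apply: Or33.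
apply: Or31 => i /andP[i0]; rewrite leq_eqVlt => /orP[/eqP-> //|ir].
by apply: interior; rewrite i0.
Qed.
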